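(* Let $(A,\le)$ be a properly stratified algebra, let $T$ be the basic tilting module with $\mathrm{add}(T)=\mathcal F(\Delta)\cap\mathcal F(\overline{\nabla})$ and let $S$ be the basic cotilting module with $\mathrm{add}(S)=\mathcal F(\nabla)\cap\mathcal F(\overline{\Delta})$. Then $$\overline{\nabla}\text{-}\mathrm{gfd}(A)=\mathrm{proj.dim}(T)=T\text{-}\mathrm{codim}({}_AA)=\overline{\nabla}\text{-}\mathrm{gfd}({}_AA)$$ and $$\overline{\Delta}\text{-}\mathrm{gfd}(A)=\mathrm{inj.dim}(S)=S\text{-}\mathrm{dim}(D(A_A))=\overline{\Delta}\text{-}\mathrm{gfd}(D(A_A)).$$
   Context: Setting: $R$ is a commutative Artin ring, $A$ is a basic Artin $R$-algebra, $A\text{-mod}$ is the category of finitely generated left $A$-modules, and $D$ is the standard duality for Artin algebras, so $D(A_A)$ is the injective cogenerator in $A\text{-mod}$. Fix an ordered complete set $e_1,\dots,e_n$ of primitive orthogonal idempotents of $A$; put $\Lambda=\{1,\dots,n\}$ with its natural order $\le$. For $i\in\Lambda$, $P(i)=Ae_i$, $E(i)$ is the simple top of $P(i)$, and $I(i)$ is the injective envelope of $E(i)$. The standard module $\Delta(i)$ is the maximal factor module of $P(i)$ having no composition factor $E(j)$ with $j>i$; the proper standard module $\overline{\Delta}(i)$ is the maximal factor module of $\Delta(i)$ in which $E(i)$ occurs as a composition factor with multiplicity exactly $1$. Dually, the costandard module $\nabla(i)$ is the maximal submodule of $I(i)$ having no composition factor $E(j)$ with $j>i$, and the proper costandard module $\overline{\nabla}(i)$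 is the maximal submodule of $\nabla(i)$ in which $E(i)$ occurs with multiplicity exactly $1$. For a class $\Theta$ of $A$-modules, $\mathcal F(\Theta)$ is the full subcategory of $A\text{-mod}$ of modules having a finite filtration whose successive factors are isomorphic to objects of $\Theta$; $\Delta,\overline{\Delta},\nabla,\overline{\nabla}$ also denote the corresponding families indexed by $\Lambda$. $(A,\le)$ is properly stratified if ${}_AA\in\mathcal F(\Delta)$ and ${}_AA\in\mathcal F(\overline{\Delta})$. For such an algebra the (generalized) tilting module $T$ and the (generalized) cotilting module $S$ of the claim exist. For $X\in A\text{-mod}$, $\overline{\nabla}\text{-}\mathrm{gfd}(X)$ is the smallest $d\ge0$ for which there is an exact sequence $0\to X\to M_0\to\cdots\to M_d\to0$ with all $M_i\in\mathcal F(\overline{\nabla})$, and $\overline{\Delta}\text{-}\mathrm{gfd}(X)$ is the smallest $d\ge0$ for which there is an exact sequence $0\to M_d\to\cdots\to M_0\to X\to0$ with all $M_i\in\mathcal F(\overline{\Delta})$. For the algebra, $\overline{\nabla}\text{-}\mathrm{gfd}(A)$ and $\overline{\Delta}\text{-}\mathrm{gfd}(A)$ are the suprema of these numbers over all $X\in A\text{-mod}$, whereas $\overline{\nabla}\text{-}\mathrm{gfd}({}_AA)$ refers to the left module ${}_AA$. $T\text{-}\mathrm{codim}(X)$ is the smallest $s\ge0$ with an exact sequence $0\to X\to T_0\to\cdots\to T_s\to0$, $T_i\in\mathrm{add}(T)$; $S\text{-}\mathrm{dim}(X)$ is the smallest $s\ge0$ with an exact sequence $0\to S_s\to\cdots\to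 S_0\to X\to0$, $S_i\in\mathrm{add}(S)$. *)

(* Defs.v *)
From HB Require Import structures.
From mathcomp Require Import all_boot all_order all_algebra.
From mathcomp Require Import boolp classical_sets functions.

Set Implicit Arguments.
Unset Strict Implicit.
Unset Printing Implicit Defensive.

Import GRing.Theory.
Local Open Scope ring_scope.
Local Open Scope classical_set_scope.

(* N ∪ {∞}, with [None] standing for ∞. *)
Definition enat := option nat.

Definition enat_le (x : enat) (d : nat) : bool :=
  if x is Some k then (k <= d)%N else false.

Lemma asbool_exists (P : nat -> Prop) :
  (exists d, P d) -> exists d, (fun k => `[< P k >]) d.
Proof. by case=> d Pd; exists d; apply/asboolP. Qed.

(* Least natural number satisfying P, and ∞ if there is none. *)
Definition enat_min (P : nat -> Prop) : enat :=
  if pselect (exists d, P d) is left h then Some (ex_minn (asbool_exists h))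
  else None.

(* Supremum in N ∪ {∞} of the values F x for x in the class C. *)
Definition enat_sup (I : Type) (C : I -> Prop) (F : I -> enat) : enat :=
  enat_min (fun d => forall x, C x -> enat_le (F x) d).

Section Modules.
Context {B : nzRingType}.
Implicit Types L M N X Y T S : lmodType B.

Definition zero_module M : Prop := forall x : M, x = 0.

Definition isomorphic M N : Prop := exists f : {linear M -> N}, bijective f.

Definition surjective M N (f : {linear M -> N}) : Prop :=
  forall y, exists x, f x = y.

Definition exact L M N (f : {linear L -> M}) (g : {linear M -> N}) : Prop :=
  forall y, g y = 0 <-> exists x, f x = y.

Definition submodule M (U : set M) : Prop :=
  [/\ U 0, forall x y, U x -> U y -> U (x + y)
    & forall (a : B) x, U x -> U (a *: x)].

Definition maximal_submodule M (U : set M) : Prop :=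
  [/\ submodule U, U <> setT
    & forall V, submodule V -> U `<=` V -> V = U \/ V = setT].

Definition radical M : set M :=
  [set x | forall U : set M, maximal_submodule U -> U x].

(* N is (isomorphic to) the top M / rad M of M. *)
Definition is_top M N : Prop :=
  exists p : {linear M -> N}, surjective p /\ forall x, p x = 0 <-> radical x.

Definition simple M : Prop :=
  ~ zero_module M /\
  forall U : set M, submodule U -> U = [set 0] \/ U = setT.

Definition indecomposable M : Prop :=
  ~ zero_module M /\
  forall X Y, isomorphic M (X * Y)%type -> zero_module X \/ zero_module Y.

Definition finitely_generated M : Prop :=
  exists (m : nat) (v : 'I_m -> M),
    forall x, exists c : 'I_m -> B, x = \sum_i c i *: v i.

Definition artinian_module M : Prop :=
  forall U : nat -> set M, (forall k, submodule (U k)) ->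
    (forall k, U k.+1 `<=` U k) ->
    exists m, forall k, (m <= k)%N -> U k = U m.

Definition projective M : Prop :=
  forall X Y (g : {linear X -> Y}) (f : {linear M -> Y}), surjective g ->
    exists h : {linear M -> X}, forall x, f x = g (h x).

Definition injective_module M : Prop :=
  forall X Y (g : {linear X -> Y}) (f : {linear X -> M}), injective g ->
    exists h : {linear Y -> M}, forall x, f x = h (g x).

(* M is an injective envelope of N: M is injective and contains N as an
   essential submodule. *)
Definition injective_envelope N M : Prop :=
  injective_module M /\
  exists j : {linear N -> M}, injective j /\
    forall U : set M, submodule U -> U <> [set 0] ->
      exists x, j x <> 0 /\ U (j x).

(* The largest factor module of M in the class Q: every factor module of M in Q
   is a factor of it, compatibly with the projections from M. *)
Definition largest_factor (Q : lmodType B -> Prop) M X : Prop :=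
  Q X /\ exists p : {linear M -> X}, surjective p /\
    forall Y (q : {linear M -> Y}), surjective q -> Q Y ->
      exists h : {linear X -> Y}, forall x, q x = h (p x).

Definition largest_sub (Q : lmodType B -> Prop) M X : Prop :=
  Q X /\ exists j : {linear X -> M}, injective j /\
    forall Y (i : {linear Y -> M}), injective i -> Q Y ->
      exists h : {linear Y -> X}, forall y, i y = j (h y).

(* [filtration M s]: M has a finite filtration with successive factors
   isomorphic to the entries of s, the first entry being the top factor. *)
Inductive filtration : lmodType B -> seq (lmodType B) -> Prop :=
| filtration_nil M : zero_module M -> filtration M [::]
| filtration_cons L M N s (f : {linear L -> M}) (g : {linear M -> N}) :
    injective f -> exact f g -> surjective g ->
    filtration L s -> filtration M (N :: s).

Definition all_in (C : lmodType B -> Prop) (s : seq (lmodType B)) : Prop :=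
  foldr (fun N P => C N /\ P) True s.

(* The category F(Θ) *)
Definition filtered (Theta : lmodType B -> Prop) M : Prop :=
  exists s, filtration M s /\ all_in Theta s.

Definition composition_series M s : Prop := filtration M s /\ all_in simple s.

(* The simple module whose isomorphism class is E occurs exactly m times as a
   composition factor of M; by Jordan-Hölder m does not depend on the
   composition series. *)
Definition multiplicity (E : lmodType B -> Prop) M (m : nat) : Prop :=
  exists2 s, composition_series M s & count (fun N => `[< E N >]) s = m.

(* Exact sequence 0 -> X -> M_0 -> ... -> M_d -> 0 with all M_k in C; it is
   continued by zero modules in degrees k > d. *)
Definition coresolution (C : lmodType B -> Prop) X (d : nat) : Prop :=
  exists (M : nat -> lmodType B) (eps : {linear X -> M 0%N})
         (f : forall k, {linear M k -> M k.+1}),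
    [/\ injective eps, exact eps (f 0%N), forall k, exact (f k) (f k.+1),
        forall k, (k <= d)%N -> C (M k)
      & forall k, (d < k)%N -> zero_module (M k)].

(* Exact sequence 0 -> M_d -> ... -> M_0 -> X -> 0 with all M_k in C. *)
Definition resolution (C : lmodType B -> Prop) X (d : nat) : Prop :=
  exists (M : nat -> lmodType B) (eps : {linear M 0%N -> X})
         (f : forall k, {linear M k.+1 -> M k}),
    [/\ surjective eps, exact (f 0%N) eps, forall k, exact (f k.+1) (f k),
        forall k, (k <= d)%N -> C (M k)
      & forall k, (d < k)%N -> zero_module (M k)].

Definition coresolution_dim C X : enat := enat_min (coresolution C X).
Definition resolution_dim C X : enat := enat_min (resolution C X).

Definition proj_dim X : enat := resolution_dim projective X.
Definition inj_dim X : enat := coresolution_dim injective_module X.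

(* Ext^{k+1}(X, Y) = 0, computed with projective resolutions of X. *)
Definition Ext_succ_vanishes (k : nat) X Y : Prop :=
  forall (P : nat -> lmodType B) (eps : {linear P 0%N -> X})
         (d : forall i, {linear P i.+1 -> P i}),
    (forall i, projective (P i)) -> surjective eps -> exact (d 0%N) eps ->
    (forall i, exact (d i.+1) (d i)) ->
    forall f : {linear P k.+1 -> Y}, (forall x, f (d k.+1 x) = 0) ->
      exists g : {linear P k -> Y}, forall x, f x = g (d k x).

(* Direct summands of finite direct sums of copies of T. *)
Definition add_closure T X : Prop :=
  exists (m : nat) (f : {linear X -> {ffun 'I_m -> T}})
         (g : {linear {ffun 'I_m -> T} -> X}), forall x, g (f x) = x.

(* T is a finite direct sum of pairwise non-isomorphic indecomposable modules;
   the direct sum is expressed by its injections and projections. *)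
Definition basic_module T : Prop :=
  exists (m : nat) (X : 'I_m -> lmodType B)
         (inj : forall i, {linear X i -> T}) (pr : forall i, {linear T -> X i}),
    [/\ forall i, indecomposable (X i),
        forall i j, isomorphic (X i) (X j) -> i = j,
        forall i x, pr i (inj i x) = x,
        forall i j x, i <> j -> pr i (inj j x) = 0
      & forall t, t = \sum_i inj i (pr i t)].

(* Generalized (Miyashita) tilting modules *)
Definition tilting T : Prop :=
  [/\ finitely_generated T, proj_dim T <> None,
      forall k, Ext_succ_vanishes k T T
    & exists s, coresolution (add_closure T) B^o s].

(* Generalized cotilting modules, relative to the injective cogenerator DB. *)
Definition cotilting (DB : lmodType B) S : Prop :=
  [/\ finitely_generated S, inj_dim S <> None,
      forall k, Ext_succ_vanishes k S S
    & exists s, resolution (add_closure S) DB s].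

End Modules.

Section PrincipalLeftIdeal.
Context (B : nzRingType) (e : B).

Definition principal_pred : {pred B^o} :=
  fun x => `[< exists a : B, x = a * e >].

Fact principal_submod_closed : submod_closed principal_pred.
Proof.
split=> [|a x y /asboolP [b ->] /asboolP [c ->]]; apply/asboolP.
  by exists 0; rewrite mul0r.
by exists (a * b + c); rewrite mulrDl -mulrA.
Qed.

HB.instance Definition _ :=
  GRing.isSubmodClosed.Build B B^o principal_pred principal_submod_closed.

Record principal_left_ideal : Type := PrincipalLeftIdeal {
  principal_val : B^o;
  _ : principal_val \in principal_pred }.

HB.instance Definition _ := [isSub for principal_val].
HB.instance Definition _ := [Choice of principal_left_ideal by <:].
HB.instance Definition _ :=
  [SubChoice_isSubLmodule of principal_left_ideal by <:].

End PrincipalLeftIdeal.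

Section Dual.
Context (R : comNzRingType) (A : algType R) (J : lmodType R).

Definition linear_pred : {pred A -> J} :=
  fun f => `[< forall (r : R) (x y : A), f (r *: x + y) = r *: f x + f y >].

Fact linear_zmod_closed : zmod_closed linear_pred.
Proof.
split=> [|f g /asboolP fl /asboolP gl]; apply/asboolP => r x y.
  by rewrite scaler0 addr0.
change (f (r *: x + y) - g (r *: x + y) = r *: (f x - g x) + (f y - g y)).
by rewrite fl gl scalerBr opprD addrACA.
Qed.

HB.instance Definition _ :=
  GRing.isZmodClosed.Build (A -> J) linear_pred linear_zmod_closed.

(* Hom_R(A, J), made a left A-module by (b f)(x) = f (x b). *)
Record dual_module : Type := DualModule {
  dual_fun : A -> J;
  dual_linear : dual_fun \in linear_pred }.

HB.instance Definition _ := [isSub for dual_fun].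
HB.instance Definition _ := [Choice of dual_module by <:].
HB.instance Definition _ := [SubChoice_isSubZmodule of dual_module by <:].

Fact dual_scale_subproof (b : A) (f : dual_module) :
  (fun x => dual_fun f (x * b)) \in linear_pred.
Proof.
apply/asboolP => r x y; have /asboolP fl := dual_linear f.
by rewrite mulrDl -scalerAl fl.
Qed.

Definition dual_scale (b : A) (f : dual_module) : dual_module :=
  DualModule (dual_scale_subproof b f).

Fact dual_scaleA a b f : dual_scale a (dual_scale b f) = dual_scale (a * b) f.
Proof. by apply/val_inj/funext => x /=; rewrite mulrA. Qed.

Fact dual_scale1 : left_id 1 dual_scale.
Proof. by move=> f; apply/val_inj/funext => x /=; rewrite mulr1. Qed.

Fact dual_scaleDr : right_distributive dual_scale +%R.
Proof. by move=> a f g; apply/val_inj/funext. Qed.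

Fact dual_scaleDl f : {morph dual_scale^~ f : a b / a + b}.
Proof.
move=> a b; apply/val_inj/funext => x /=.
change (dual_fun f (x * (a + b)) = dual_fun f (x * a) + dual_fun f (x * b)).
have /asboolP fl := dual_linear f.
by rewrite mulrDr -[x * a]scale1r fl !scale1r.
Qed.

HB.instance Definition _ := GRing.Zmodule_isLmodule.Build A dual_module
  dual_scaleA dual_scale1 dual_scaleDr dual_scaleDl.

End Dual.

(* J is an injective envelope of R / rad R, so that Hom_R(-, J) is the standard
   duality D of Artin R-algebras. *)
Definition dualizing_module (R : comNzRingType) (J : lmodType R) : Prop :=
  exists K : lmodType R, is_top R^o K /\ injective_envelope K J.

Definition artin_ring (R : comNzRingType) : Prop := artinian_module R^o.

Definition artin_algebra (R : comNzRingType) (A : algType R) : Prop :=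
  artin_ring R /\ @finitely_generated R A.

Section Stratification.
Context {A : nzRingType} {n : nat} (e : 'I_n -> A).
Implicit Types (i j : 'I_n) (X Y E I : lmodType A).

Definition primitive_idempotent (u : A) : Prop :=
  [/\ u != 0, u * u = u
    & forall v w : A, v * v = v -> w * w = w -> v * w = 0 -> w * v = 0 ->
        u = v + w -> v = 0 \/ w = 0].

Definition complete_primitive_orthogonal_idempotents : Prop :=
  [/\ forall i, primitive_idempotent (e i),
      forall i j, i <> j -> e i * e j = 0
    & \sum_i e i = 1].

Definition indec_proj i : lmodType A := principal_left_ideal (e i).

(* A is basic: the indecomposable summands P(i) of A are pairwise
   non-isomorphic. *)
Definition basic_algebra : Prop :=
  forall i j, isomorphic (indec_proj i) (indec_proj j) -> i = j.

(* The isomorphism class of the simple top E(i) of P(i); similarly, the families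
   below are given as isomorphism-closed classes of modules. *)
Definition simple_top i X : Prop := simple X /\ is_top (indec_proj i) X.

Definition no_factor_above i X : Prop :=
  forall j, (i < j)%N -> multiplicity (simple_top j) X 0%N.

Definition Delta i X : Prop := 
  largest_factor (no_factor_above i) (indec_proj i) X.

Definition proper_Delta i X : Prop :=
  exists Y, Delta i Y /\
    largest_factor (fun Z => multiplicity (simple_top i) Z 1%N) Y X.

Definition Nabla i X : Prop :=
  exists E I, [/\ simple_top i E, injective_envelope E I
    & largest_sub (no_factor_above i) I X].

Definition proper_Nabla i X : Prop :=
  exists Y, Nabla i Y /\
    largest_sub (fun Z => multiplicity (simple_top i) Z 1%N) Y X.

Definition Filt (Theta : 'I_n -> lmodType A -> Prop) : lmodType A -> Prop :=
  filtered (fun X => exists i, Theta i X).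

Definition properly_stratified : Prop :=
  Filt Delta A^o /\ Filt proper_Delta A^o.

Definition proper_Nabla_gfd X : enat := coresolution_dim (Filt proper_Nabla) X.
Definition proper_Delta_gfd X : enat := resolution_dim (Filt proper_Delta) X.

Definition proper_Nabla_gfd_algebra : enat :=
  enat_sup finitely_generated proper_Nabla_gfd.
Definition proper_Delta_gfd_algebra : enat :=
  enat_sup finitely_generated proper_Delta_gfd.

End Stratification.

(* Main.v *)
Require Import Defs.
From HB Require Import structures.
From mathcomp Require Import all_boot all_order all_algebra.
From mathcomp Require Import boolp classical_sets functions.
From mathcomp Require Import zify.

(* Ext^k(Delta(i), properNabla(j)) and Ext^k(properDelta(i), Nabla(j)) vanish for
   all k > 0, because the regular module is filtered by standard as well as by
   proper standard modules; hence every module that is right Ext-orthogonal to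
   the standard modules is filtered by proper costandard ones.  A module Y with
   Ext^k(T, Y) = 0 for all k > 0 is resolved by add(T), and the standard modules
   have finite projective dimension, so such a Y is orthogonal to the standard
   modules too and lies in F(properNabla).  Applied to the cosyzygies of an
   arbitrary module this bounds its properNabla-dimension by proj.dim(T); the
   other comparisons are shifts of dimension along coresolutions of A, using
   Ext^r(T, A) <> 0 for r = proj.dim(T).  The second half is the same argument in
   the opposite category, for the pair (properDelta, Nabla), the cotilting module
   S and the injective cogenerator D(A). *)

Set Implicit Arguments.
Unset Strict Implicit.
Unset Printing Implicit Defensive.

Import GRing.Theory.
Local Open Scope ring_scope.
Local Open Scope classical_set_scope.

(** Only the vanishing of Ext^k(X, Y) matters, so no Ext group is built: vanishing is a predicate,
    and the long exact sequences become implications between such predicates, a list that is stable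
    under reversing arrows. The symmetry of the two halves breaks at one place. Both filtrations
    live on A, and none is given on D(A). Standard modules have finite projective dimension because
    they are retracts of factors of A, but the finite injective dimension of Nabla(j) has no such
    source; it comes from filtering the cokernel of Nabla(j) in its injective envelope by the
    Nabla(l) with l > j. In the same way, Ext from properDelta(i) cannot be shifted along A, since
    properDelta(i) may have infinite projective dimension; the vanishing is transported from
    Delta(i) through one module filtered by both. The finiteness conditions behind the category of
    finitely generated modules are extracted from the definitions: the length of A from the
    composition series that multiplicities carry, finite generation of D(A) from the cotilting
    module, the cogenerator property from the injective envelope of R / rad R. *)

Section LinearMaps.
Context {B : nzRingType}.
Implicit Types I K L M N P Q X Y Z : lmodType B.

Lemma linear_exists M N (f : M -> N) :
  (forall a x y, f (a *: x + y) = a *: f x + f y) ->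
  exists g : {linear M -> N}, g =1 f.
Proof.
move=> fl.
pose g : {linear M -> N} := HB.pack f (GRing.isLinear.Build _ _ _ _ f fl).
by exists g.
Qed.

Lemma add_linear_exists M N (f g : {linear M -> N}) :
  exists h : {linear M -> N}, forall x, h x = f x + g x.
Proof.
apply: linear_exists => a x y.
by rewrite !linearP scalerDr addrACA.
Qed.

Lemma sub_linear_exists M N (f g : {linear M -> N}) :
  exists h : {linear M -> N}, forall x, h x = f x - g x.
Proof.
apply: linear_exists => a x y.
by rewrite (linearP f) (linearP g) scalerBr opprD addrACA.
Qed.

Lemma inj_lift K M Z (i : {linear K -> M}) (f : {linear Z -> M}) :
  injective i -> (forall z, exists k, i k = f z) ->
  exists g : {linear Z -> K}, forall z, i (g z) = f z.
Proof.
move=> ii h; have [g gP] := choice h.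
have [|g' g'E] := @linear_exists _ _ g.
  by move=> a x y; apply: ii; rewrite gP !linearP !gP.
by exists g' => z; rewrite g'E.
Qed.

Lemma surj_factor M X Y (p : {linear M -> X}) (f : {linear M -> Y}) :
  surjective p -> (forall x, p x = 0 -> f x = 0) ->
  exists g : {linear X -> Y}, forall x, g (p x) = f x.
Proof.
move=> ps h; have [s sP] := choice ps.
have fE x y : p x = p y -> f x = f y.
  by move=> e; apply/eqP; rewrite -subr_eq0 -linearB h ?linearB ?e ?subrr.
have [|g gE] := @linear_exists _ _ (fun x => f (s x)).
  by move=> a x y; rewrite -linearP; apply: fE; rewrite !linearP !sP.
by exists g => x; rewrite gE; apply: fE; rewrite sP.
Qed.

Lemma linear_inj M N (f : {linear M -> N}) :
  (forall x, f x = 0 -> x = 0) -> injective f.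
Proof.
move=> h x y e; apply/eqP; rewrite -subr_eq0; apply/eqP/h.
by rewrite linearB e subrr.
Qed.

(** * Submodules and quotients as modules in their own right *)

Section Submodule.
Variables (M : lmodType B) (U : set M) (HU : submodule U).

Definition sub_pred of submodule U : {pred M} := fun x => `[< U x >].

Fact sub_pred_closed : submod_closed (sub_pred HU).
Proof.
case: (HU) => U0 UD UZ; split; first exact/asboolP.
move=> a x y /asboolP Ux /asboolP Uy; apply/asboolP.
by apply: UD => //; apply: UZ.
Qed.

HB.instance Definition _ :=
  GRing.isSubmodClosed.Build B M (sub_pred HU) sub_pred_closed.

Record sub_module : Type := SubModule {
  sub_val : M; _ : sub_val \in sub_pred HU }.

HB.instance Definition _ := [isSub for sub_val].
HB.instance Definition _ := [Choice of sub_module by <:].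
HB.instance Definition _ := [SubChoice_isSubLmodule of sub_module by <:].

Lemma sub_exists : exists (K : lmodType B) (i : {linear K -> M}),
  injective i /\ forall x, U x <-> exists k, i k = x.
Proof.
exists sub_module; have [|i iE] := @linear_exists sub_module M val.
  by move=> a x y; rewrite linearP.
exists i; split; first by move=> x y; rewrite !iE; apply: val_inj.
move=> x; split=> [Ux|[k <-]]; last first.
  by rewrite iE; apply/asboolP; case: k.
have xP : x \in sub_pred HU by apply/asboolP.
by exists (SubModule xP); rewrite iE.
Qed.

Import Quotient.
Local Open Scope quotient_scope.
Definition quot_module := quot (sub_pred HU).
HB.instance Definition _ := GRing.Zmodule.on quot_module.
Definition quot_pi (x : M) : quot_module := \pi_(quot (sub_pred HU)) x.

Lemma quot_piD x y : quot_pi (x + y) = quot_pi x + quot_pi y.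
Proof. exact: raddfD. Qed.

Lemma quot_pi_eq x y : quot_pi x = quot_pi y <-> U (x - y).
Proof.
have H := idealrBE (sub_pred HU) x y.
by split=> [/eqP e|Uxy]; [move: H; rewrite e => /asboolP | apply/eqP; rewrite -H; apply/asboolP].
Qed.

Lemma quot_pi_surj z : exists x, quot_pi x = z.
Proof. by exists (repr z); exact: reprK. Qed.

Definition quot_scale (a : B) (x : quot_module) : quot_module :=
  quot_pi (a *: projT1 (cid (quot_pi_surj x))).

Lemma quot_scaleE a (x : M) : quot_scale a (quot_pi x) = quot_pi (a *: x).
Proof.
rewrite /quot_scale; case: cid => y /= /quot_pi_eq Uyx; apply/quot_pi_eq.
by rewrite -scalerBr; case: HU => _ _; apply.
Qed.

Fact quot_scaleA a b x :
  quot_scale a (quot_scale b x) = quot_scale (a * b) x.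
Proof. by case: (quot_pi_surj x) => y <-; rewrite !quot_scaleE scalerA. Qed.
Fact quot_scale1 : left_id 1 quot_scale.
Proof. by move=> x; case: (quot_pi_surj x) => y <-; rewrite quot_scaleE scale1r. Qed.
Fact quot_scaleDr : right_distributive quot_scale +%R.
Proof.
move=> a x y; case: (quot_pi_surj x) => x' <-; case: (quot_pi_surj y) => y' <-.
by rewrite -quot_piD !quot_scaleE scalerDr quot_piD.
Qed.
Fact quot_scaleDl x : {morph quot_scale^~ x : a b / a + b}.
Proof.
by move=> a b; case: (quot_pi_surj x) => y <-; rewrite !quot_scaleE scalerDl quot_piD.
Qed.

HB.instance Definition _ := GRing.Zmodule_isLmodule.Build B quot_module
  quot_scaleA quot_scale1 quot_scaleDr quot_scaleDl.

Lemma quot_exists : exists (Q : lmodType B) (p : {linear M -> Q}),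
  surjective p /\ forall x, p x = 0 <-> U x.
Proof.
exists quot_module; have [|p pE] := @linear_exists M quot_module quot_pi.
  by move=> a x y; rewrite quot_piD -quot_scaleE.
exists p; split; first by move=> y; case: (quot_pi_surj y) => x <-; exists x.
by move=> x; rewrite -(linear0 p) !pE quot_pi_eq subr0.
Qed.

End Submodule.
End LinearMaps.

(** * Short exact sequences, free modules and finite generation *)

Section Sequences.
Context {B : nzRingType}.
Implicit Types I K L M N P Q S T X Y Z : lmodType B.

Definition ses_maps L M N (i : {linear L -> M}) (p : {linear M -> N}) :=
  [/\ injective i, exact i p & surjective p].

Definition mod_ses L M N := exists i p, @ses_maps L M N i p.

Lemma ses_comp0 L M N (i : {linear L -> M}) (p : {linear M -> N}) x :
  ses_maps i p -> p (i x) = 0.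
Proof. by case=> _ e _; apply/e; exists x. Qed.

Lemma ses_ker L M N (i : {linear L -> M}) (p : {linear M -> N}) x :
  ses_maps i p -> p x = 0 -> exists y, i y = x.
Proof. by case=> _ e _; move/e. Qed.

Lemma submodule_ker M N (f : {linear M -> N}) : submodule [set x | f x = 0].
Proof.
split=> [|x y /= fx fy|a x /= fx] /=.
- by rewrite linear0.
- by rewrite linearD fx fy addr0.
- by rewrite linearZ /= fx scaler0.
Qed.

Lemma submodule_im M N (f : {linear M -> N}) :
  submodule [set y | exists x, f x = y].
Proof.
split=> [|x y [u <-] [v <-]|a x [u <-]] /=.
- by exists 0; rewrite linear0.
- by exists (u + v); rewrite linearD.
- by exists (a *: u); rewrite linearZ.
Qed.

Lemma submodule_preim M N (f : {linear M -> N}) (U : set N) :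
  submodule U -> submodule [set x | U (f x)].
Proof.
case=> U0 UD UZ; split=> [|x y /= fx fy|a x /= fx] /=.
- by rewrite linear0.
- by rewrite linearD; apply: UD.
- by rewrite linearZ; apply: UZ.
Qed.

Lemma submodule_image M N (f : {linear M -> N}) (U : set M) :
  submodule U -> submodule [set y | exists2 x, U x & f x = y].
Proof.
case=> U0 UD UZ; split=> [|x y [u Uu <-] [v Uv <-]|a x [u Uu <-]] /=.
- by exists 0; rewrite ?linear0.
- by exists (u + v); rewrite ?linearD //; apply: UD.
- by exists (a *: u); rewrite ?linearZ //; apply: UZ.
Qed.

Lemma submodule_setI M (U V : set M) :
  submodule U -> submodule V -> submodule [set x | U x /\ V x].
Proof.
case=> U0 UD UZ [V0 VD VZ]; split=> // [x y [? ?] [? ?]|a x [? ?]].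
  by split; [apply: UD|apply: VD].
by split; [apply: UZ|apply: VZ].
Qed.

Lemma submodule_zero M : submodule [set (0 : M)].
Proof.
by split=> // [x y -> ->|a x ->]; rewrite ?addr0 ?scaler0.
Qed.

Lemma submodule_full M : submodule (setT : set M).
Proof. by []. Qed.

Lemma submodule_cyclic M (x : M) : submodule [set y | exists a, a *: x = y].
Proof.
split=> [|y z [a <-] [b <-]|c y [a <-]] /=.
- by exists 0; rewrite scale0r.
- by exists (a + b); rewrite scalerDl.
- by exists (c * a); rewrite scalerA.
Qed.

Lemma submodule_sum M (U : set M) (J : finType) (F : J -> M) : submodule U ->
  (forall i, U (F i)) -> U (\sum_i F i).
Proof. by case=> U0 UD _ UF; elim/big_ind: _. Qed.

Lemma sub_ses M (U : set M) : submodule U ->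
  exists K Q (i : {linear K -> M}) (p : {linear M -> Q}),
    [/\ ses_maps i p, forall x, U x <-> exists k, i k = x
      & forall x, U x <-> p x = 0].
Proof.
move=> HU; have [K [i [ii iU]]] := sub_exists HU.
have [Q [p [ps pU]]] := quot_exists HU.
exists K, Q, i, p; split=> //; last by move=> x; split=> /pU.
by split=> // x; split=> [/pU /iU|/iU /pU].
Qed.

Lemma ker_ses M N (p : {linear M -> N}) : surjective p ->
  exists K (i : {linear K -> M}), ses_maps i p.
Proof.
move=> ps; have [K [Q [i [_ [[ii _ _] iU _]]]]] := sub_ses (submodule_ker p).
by exists K, i; split=> // x; apply: iU.
Qed.

Lemma coker_ses L M (i : {linear L -> M}) : injective i ->
  exists N (p : {linear M -> N}), ses_maps i p.
Proof.
move=> ii; have [_ [N [_ [p [[_ _ ps] _ pU]]]]] := sub_ses (submodule_im i).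
by exists N, p; split=> // x; split=> /pU.
Qed.

Lemma zero_submodule M (U : set M) : submodule U -> (forall x, U x -> x = 0) ->
  U = [set 0].
Proof. by case=> U0 _ _ h; apply/seteqP; split=> [x /h|x ->]. Qed.

Lemma full_submodule M (U : set M) : (forall x, U x) -> U = setT.
Proof. by move=> h; apply/seteqP; split=> // x _; apply: h. Qed.

Section Powers.
Variables (m : nat) (T : lmodType B).
Local Notation "'T^m'" := {ffun 'I_m -> T}.

Lemma pow_proj (j : 'I_m) : exists p : {linear T^m -> T}, forall f, p f = f j.
Proof. by apply: linear_exists => a f g; rewrite !ffunE. Qed.

Lemma pow_in Y (g : 'I_m -> {linear T -> Y}) :
  exists h : {linear T^m -> Y}, forall f, h f = \sum_j g j (f j).
Proof.
apply: linear_exists => a f f'; rewrite scaler_sumr -big_split /=.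
by apply: eq_bigr => j _; rewrite !ffunE linearP.
Qed.

Lemma pow_out X (g : 'I_m -> {linear X -> T}) :
  exists h : {linear X -> T^m}, forall x j, h x j = g j x.
Proof.
have [|h hE] := @linear_exists _ X _ (fun x => [ffun j => g j x] : T^m).
  by move=> a x y; apply/ffunP => j; rewrite !ffunE linearP.
by exists h => x j; rewrite hE ffunE.
Qed.

Definition pow_single (j : 'I_m) (t : T) : T^m :=
  [ffun k => if k == j then t else 0].

Lemma pow_inj (j : 'I_m) : exists q : {linear T -> T^m}, q =1 pow_single j.
Proof.
apply: linear_exists => a x y; apply/ffunP => k; rewrite !ffunE.
by case: ifP; rewrite ?scaler0 ?addr0.
Qed.

Lemma pow_sum (f : T^m) : f = \sum_j pow_single j (f j).
Proof.
apply/ffunP => k; rewrite sum_ffunE (bigD1 k) //= big1 => [|j /negPf jk].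
  by rewrite ffunE eqxx addr0.
by rewrite ffunE eq_sym jk.
Qed.
End Powers.

Lemma free_cover M : finitely_generated M ->
  exists m (p : {linear {ffun 'I_m -> B^o} -> M}), surjective p.
Proof.
case=> m [v vP].
have [|p pE] := @linear_exists _ _ _
    (fun c : {ffun 'I_m -> B^o} => \sum_j c j *: v j).
  move=> a c d; rewrite scaler_sumr -big_split /=; apply: eq_bigr => j _.
  by rewrite !ffunE scalerDl scalerA.
exists m, p => x; have [c cE] := vP x; exists [ffun j => c j].
by rewrite pE cE; apply: eq_bigr => j _; rewrite ffunE.
Qed.

Lemma fg_surj M N (p : {linear M -> N}) :
  finitely_generated M -> surjective p -> finitely_generated N.
Proof.
case=> m [v vP] ps; exists m, (fun j => p (v j)) => y.
have [x <-] := ps y; have [c ->] := vP x; exists c.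
by rewrite linear_sum; apply: eq_bigr => j _; rewrite linearZ.
Qed.

Lemma fg_ext L M N : mod_ses L M N -> finitely_generated L ->
  finitely_generated N -> finitely_generated M.
Proof.
case=> i [p [ii e ps]] [m [v vP]] [k [w wP]].
have [u uP] := choice ps.
exists (m + k)%N, (fun j => match fintype.split j with
   | inl a => i (v a) | inr b => u (w b) end) => x.
have [d dE] := wP (p x).
have /e [l lE] : p (x - \sum_j d j *: u (w j)) = 0.
  rewrite linearB linear_sum dE; apply/eqP; rewrite subr_eq0; apply/eqP.
  by apply: eq_bigr => j _; rewrite linearZ /= uP.
have [c cE] := vP l.
exists (fun j => match fintype.split j with inl a => c a | inr b => d b end).
rewrite big_split_ord /= -[LHS](subrK (\sum_j d j *: u (w j))) -lE cE.
rewrite linear_sum; congr (_ + _); apply: eq_bigr => j _.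
  by rewrite (unsplitK (inl j : 'I_m + 'I_k)) linearZ.
by rewrite (unsplitK (inr j : 'I_m + 'I_k)).
Qed.

Lemma fg_zero M : zero_module M -> finitely_generated M.
Proof.
by move=> M0; exists 0%N, (fun=> 0) => x; exists (fun=> 0); rewrite big_ord0 (M0 x).
Qed.

Lemma fg_free m : finitely_generated {ffun 'I_m -> B^o}.
Proof.
exists m, (fun j => pow_single j (1 : B^o)) => f; exists (fun j => f j).
rewrite {1}(pow_sum f); apply: eq_bigr => j _; apply/ffunP => k.
by rewrite !ffunE; case: ifP; rewrite ?scaler0 // /GRing.scale /= mulr1.
Qed.

Lemma fg_regular : @finitely_generated B B^o.
Proof.
by exists 1%N, (fun=> 1) => x; exists (fun=> x); rewrite big_ord1 /GRing.scale /= mulr1.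
Qed.

Lemma free_projective m : projective {ffun 'I_m -> B^o}.
Proof.
move=> X Y g f gs.
have [x xP] := choice (fun j : 'I_m => gs (f (pow_single j (1 : B^o)))).
have [|h hE] := @linear_exists _ _ _
    (fun c : {ffun 'I_m -> B^o} => \sum_j c j *: x j).
  move=> a c d; rewrite scaler_sumr -big_split /=; apply: eq_bigr => j _.
  by rewrite !ffunE scalerDl scalerA.
exists h => c; rewrite hE linear_sum {1}(pow_sum c) linear_sum.
apply: eq_bigr => j _; rewrite linearZ /= xP -linearZ; congr (f _).
apply/ffunP => k; rewrite !ffunE; case: ifP; rewrite ?scaler0 //.
by rewrite /GRing.scale /= mulr1.
Qed.

Lemma pow_injective_module m T :
  injective_module T -> injective_module {ffun 'I_m -> T}.
Proof.
move=> Ti X Y g f gi.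
have hP j : exists h : {linear Y -> T}, forall x, f x j = h (g x).
  have [p pE] := pow_proj T j; have [h hE] := Ti _ _ g (p \o f) gi.
  by exists h => x; rewrite -hE -pE.
have [h hE] := choice hP; have [k kE] := pow_out h.
by exists k => x; apply/ffunP => j; rewrite kE.
Qed.

Lemma retract_projective X P (s : {linear X -> P}) (r : {linear P -> X}) :
  (forall x, r (s x) = x) -> projective P -> projective X.
Proof.
move=> rs Pp M N g f gs; have [h hE] := Pp _ _ g (f \o r) gs.
by exists (h \o s) => x; rewrite /= -hE /= rs.
Qed.

Lemma retract_injective X I (s : {linear X -> I}) (r : {linear I -> X}) :
  (forall x, r (s x) = x) -> injective_module I -> injective_module X.
Proof.
move=> rs Ii M N g f gi; have [h hE] := Ii _ _ g (s \o f) gi.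
by exists (r \o h) => x; rewrite /= -hE /= rs.
Qed.

(** A left ideal is given as an embedding into the regular module. *)
Definition noetherian_ring := forall K (i : {linear K -> B^o}),
  injective i -> finitely_generated K.

(** Induction on the rank: the image under the first coordinate is a left ideal, and the kernel of
    that coordinate embeds into a free module of smaller rank. *)
Lemma fg_sub_free m K (i : {linear K -> {ffun 'I_m -> B^o}}) :
  noetherian_ring -> injective i -> finitely_generated K.
Proof.
move=> nB; elim: m K i => [|m IH] K i ii.
  by apply: fg_zero => x; apply: ii; apply/ffunP; case.
have [p pE] := pow_proj B^o (ord0 : 'I_m.+1).
have [I [_ [j [_ [[jj _ _] jU _]]]]] := sub_ses (submodule_im (p \o i)).
have [q qE] : exists q : {linear K -> I}, forall z, j (q z) = (p \o i) z.
  by apply: inj_lift => // z; apply/jU; exists z.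
have qs : surjective q.
  by move=> y; have /jU [x xE] : exists k, j k = j y by [exists y];
     exists x; apply: jj; rewrite qE.
have [L [l ls]] := ker_ses qs.
apply: (fg_ext (ex_intro _ l (ex_intro _ q ls))); last exact: nB jj.
have [r rE] : exists r : {linear {ffun 'I_m.+1 -> B^o} -> {ffun 'I_m -> B^o}},
    forall f k, r f k = f (lift ord0 k).
  have [|r rE] := @linear_exists _ _ _
    (fun f : {ffun 'I_m.+1 -> B^o} => [ffun k => f (lift ord0 k)] : {ffun 'I_m -> B^o}).
    by move=> a x y; apply/ffunP => k; rewrite !ffunE.
  by exists r => f k; rewrite rE ffunE.
apply: (IH _ (r \o (i \o l))); apply: linear_inj => x rx.
have [li _ _] := ls; apply: li; apply: ii; rewrite !linear0; apply/ffunP => k.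
rewrite ffunE; have [k' ->|->] := unliftP ord0 k.
  by rewrite -rE -[RHS](ffunE (fun=> 0) k'); move/ffunP: rx => /(_ k'); rewrite /= !ffunE.
by rewrite -pE -[LHS]/((p \o i) (l x)) -qE (ses_comp0 _ ls) linear0.
Qed.

(** The preimage of the submodule in a free cover of [M] is finitely generated and maps onto it. *)
Lemma fg_sub K M (i : {linear K -> M}) : noetherian_ring ->
  finitely_generated M -> injective i -> finitely_generated K.
Proof.
move=> nB Mfg ii; have [m [p ps]] := free_cover Mfg.
have HU := submodule_preim p (submodule_im i).
have [L [_ [l [_ [[ll _ _] lU _]]]]] := sub_ses HU.
have Lfg := fg_sub_free nB ll.
have [q qE] : exists q : {linear L -> K}, forall z, i (q z) = (p \o l) z.
  by apply: inj_lift => // z; have /lU [k kE] : exists k, l k = l z by [exists z]; exists k.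
apply: (fg_surj (p := q) Lfg) => y.
have [x xE] := ps (i y); have /lU [k kE] : exists k, i k = p x by exists y.
by exists k; apply: ii; rewrite qE /= kE.
Qed.

End Sequences.

(** * Vanishing of Ext^1 as a lifting or an extension property *)

Section LiftingAndExtending.
Context {B : nzRingType}.
Implicit Types I K L M N P Q S T X Y Z : lmodType B.

Definition hom0 X Y := forall (f : {linear X -> Y}) x, f x = 0.

(** If [i] is the kernel of a projective module mapping onto X, this says Ext^1(X, Y) = 0. *)
Definition extends K M (i : {linear K -> M}) Y :=
  forall f : {linear K -> Y}, exists h : {linear M -> Y}, forall k, h (i k) = f k.

(** If [p] is the cokernel of an embedding of Y into an injective module, this says Ext^1(X, Y) =
    0. *)
Definition lifts M N (p : {linear M -> N}) X :=
  forall f : {linear X -> N}, exists h : {linear X -> M}, forall x, p (h x) = f x.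

Lemma projective_lifts M N (p : {linear M -> N}) P :
  projective P -> surjective p -> lifts p P.
Proof. by move=> Pp ps f; have [h hE] := Pp _ _ p f ps; exists h => x; rewrite hE. Qed.

Lemma injective_extends K M (i : {linear K -> M}) I :
  injective_module I -> injective i -> extends i I.
Proof. by move=> Ii ii f; have [h hE] := Ii _ _ i f ii; exists h => x; rewrite hE. Qed.

Lemma hom0_lifts M N (p : {linear M -> N}) X : hom0 X N -> lifts p X.
Proof.
move=> h f; have [|z zE] := @linear_exists _ X M (fun=> 0).
  by move=> a x y; rewrite scaler0 addr0.
by exists z => x; rewrite h zE linear0.
Qed.

Lemma hom0_extends K M (i : {linear K -> M}) Y : hom0 K Y -> extends i Y.
Proof.
move=> h f; have [|z zE] := @linear_exists _ M Y (fun=> 0).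
  by move=> a x y; rewrite scaler0 addr0.
by exists z => x; rewrite h zE.
Qed.

(** One projective presentation of [X] decides every extension by [Y]: lift [f \o p] to the
    projective module; on the kernel the lift takes values in [Y], and subtracting an extension of
    that restriction lets it factor through [X]. *)
Lemma extends_lifts K P X (i : {linear K -> P}) (p : {linear P -> X})
    Y M N (a : {linear Y -> M}) (b : {linear M -> N}) :
  ses_maps i p -> projective P -> extends i Y -> ses_maps a b -> lifts b X.
Proof.
move=> sip Pp ext sab f; have [_ _ ps] := sip; have [_ _ bs] := sab.
have [phi phiE] := projective_lifts Pp bs (f \o p).
have [||g gE] := @inj_lift _ _ _ _ a (phi \o i); first by case: sab.
  by move=> k; apply: (ses_ker sab); rewrite phiE /= (ses_comp0 _ sip) linear0.
have [h hE] := ext g.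
have [psi psiE] := sub_linear_exists phi (a \o h).
have [|chi chiE] := surj_factor (f := psi) ps.
  move=> x /(ses_ker sip) [k <-].
  by rewrite psiE -[phi _]/((phi \o i) k) -gE /= hE subrr.
exists chi => x; have [y <-] := ps x.
by rewrite chiE psiE linearB phiE /= (ses_comp0 _ sab) subr0.
Qed.

(** Dual of [extends_lifts]: one injective copresentation of [Y] decides every extension problem
    with cokernel [X]. *)
Lemma lifts_extends Y I Q (a : {linear Y -> I}) (b : {linear I -> Q})
    K M X (i : {linear K -> M}) (p : {linear M -> X}) :
  ses_maps a b -> injective_module I -> lifts b X -> ses_maps i p -> extends i Y.
Proof.
move=> sab Ii lif sip f; have [ii _ ps] := sip; have [ai _ _] := sab.
have [phi phiE] := injective_extends Ii ii (a \o f).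
have [|g gE] := surj_factor (f := b \o phi) ps.
  by move=> x /(ses_ker sip) [k <-]; rewrite /= phiE (ses_comp0 _ sab).
have [h hE] := lif g.
have [psi psiE] := sub_linear_exists phi (h \o p).
have [|chi chiE] := @inj_lift _ _ _ _ a psi ai.
  by move=> x; apply: (ses_ker sab); rewrite psiE linearB /= hE gE /= subrr.
exists chi => k; apply: ai.
by rewrite chiE psiE phiE /= (ses_comp0 _ sip) linear0 subr0.
Qed.

(** * Long exact sequences in the second variable *)

Section Covariant.
Variables (Y' Y Y'' : lmodType B) (a : {linear Y' -> Y}) (b : {linear Y -> Y''}).
Hypothesis sab : ses_maps a b.

Lemma hom0_mid_r X : hom0 X Y' -> hom0 X Y'' -> hom0 X Y.
Proof.
move=> h' h'' f x; have [ai _ _] := sab.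
have [|g gE] := @inj_lift _ _ _ _ a f ai; last by rewrite -gE h' linear0.
by move=> z; apply: (ses_ker sab); rewrite -[LHS]/((b \o f) z) h''.
Qed.

Lemma hom0_sub_r X : hom0 X Y -> hom0 X Y'.
Proof.
by move=> h f x; have [ai _ _] := sab; apply: ai; rewrite linear0 -(h (a \o f) x).
Qed.

Variables (K P X : lmodType B) (i : {linear K -> P}) (p : {linear P -> X}).
Hypotheses (sip : ses_maps i p) (Pp : projective P).

Lemma extends_mid : extends i Y' -> extends i Y'' -> extends i Y.
Proof.
move=> e' e'' f; have [ai _ bs] := sab.
have [g gE] := e'' (b \o f); have [phi phiE] := projective_lifts Pp bs g.
have [d dE] := sub_linear_exists f (phi \o i).
have [|u uE] := @inj_lift _ _ _ _ a d ai.
  by move=> k; apply: (ses_ker sab); rewrite dE linearB /= phiE gE /= subrr.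
have [w wE] := e' u; have [h hE] := add_linear_exists phi (a \o w).
by exists h => k; rewrite hE /= wE uE dE addrC subrK.
Qed.

Lemma lifts_extends_sub : lifts b X -> extends i Y -> extends i Y'.
Proof.
move=> lif ext f; have [ai _ bs] := sab; have [_ _ ps] := sip.
have [g gE] := ext (a \o f).
have [|c cE] := surj_factor (f := b \o g) ps.
  by move=> x /(ses_ker sip) [k <-]; rewrite /= gE (ses_comp0 _ sab).
have [d dE] := lif c; have [e eE] := sub_linear_exists g (d \o p).
have [|h hE] := @inj_lift _ _ _ _ a e ai.
  by move=> x; apply: (ses_ker sab); rewrite eE linearB /= dE cE subrr.
exists h => k; apply: ai.
by rewrite hE eE gE /= (ses_comp0 _ sip) linear0 subr0.
Qed.

Lemma extends_lifts_syz : extends i Y'' -> lifts b K.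
Proof.
move=> ext f; have [_ _ bs] := sab; have [g gE] := ext f.
have [phi phiE] := projective_lifts Pp bs g.
by exists (phi \o i) => k; rewrite /= phiE gE.
Qed.

Lemma lifts_extends_quot : lifts b K -> extends i Y -> extends i Y''.
Proof.
move=> lif ext f; have [g gE] := lif f; have [h hE] := ext g.
by exists (b \o h) => k; rewrite /= hE gE.
Qed.
End Covariant.

Lemma lifts_hom0 Y' Y Y'' (b : {linear Y -> Y''}) X :
  lifts b X -> hom0 X Y -> hom0 X Y''.
Proof. by move=> lif h f x; have [g <-] := lif f; rewrite h linear0. Qed.

(** * Long exact sequences in the first variable *)

Section Contravariant.
Variables (X' X X'' : lmodType B) (a : {linear X' -> X}) (b : {linear X -> X''}).
Hypothesis sab : ses_maps a b.

Lemma hom0_mid_l Y : hom0 X' Y -> hom0 X'' Y -> hom0 X Y.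
Proof.
move=> h' h'' f x; have [_ _ bs] := sab.
have [|g <-] := surj_factor (f := f) bs; last exact: h''.
by move=> z /(ses_ker sab) [k <-]; rewrite -[LHS]/((f \o a) k) h'.
Qed.

Lemma hom0_quot_l Y : hom0 X Y -> hom0 X'' Y.
Proof.
by move=> h f x; have [_ _ bs] := sab; have [y <-] := bs x; apply: (h (f \o b)).
Qed.

Lemma extends_hom0 Y : extends a Y -> hom0 X Y -> hom0 X' Y.
Proof. by move=> ext h f x; have [g <-] := ext f; rewrite h. Qed.

Variables (Y I Q : lmodType B) (j : {linear Y -> I}) (q : {linear I -> Q}).
Hypotheses (sjq : ses_maps j q) (Ii : injective_module I).

Lemma lifts_mid : lifts q X' -> lifts q X'' -> lifts q X.
Proof.
move=> l' l'' f; have [ai _ bs] := sab.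
have [g gE] := l' (f \o a); have [phi phiE] := injective_extends Ii ai g.
have [d dE] := sub_linear_exists f (q \o phi).
have [|u uE] := surj_factor (f := d) bs.
  by move=> x /(ses_ker sab) [k <-]; rewrite dE /= phiE gE /= subrr.
have [w wE] := l'' u; have [h hE] := add_linear_exists phi (w \o b).
by exists h => x; rewrite hE linearD /= wE uE dE addrC subrK.
Qed.

Lemma extends_lifts_quot : extends a Y -> lifts q X -> lifts q X''.
Proof.
move=> ext lif f; have [ai _ bs] := sab; have [ji _ _] := sjq.
have [g gE] := lif (f \o b).
have [|c cE] := @inj_lift _ _ _ _ j (g \o a) ji.
  by move=> x; apply: (ses_ker sjq); rewrite /= gE /= (ses_comp0 _ sab) linear0.
have [d dE] := ext c; have [e eE] := sub_linear_exists g (j \o d).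
have [|h hE] := surj_factor (f := e) bs.
  by move=> x /(ses_ker sab) [k <-]; rewrite eE /= dE cE subrr.
exists h => x; have [y <-] := bs x.
by rewrite hE eE linearB gE /= (ses_comp0 _ sjq) subr0.
Qed.

Lemma lifts_extends_cosyz : lifts q X' -> extends a Q.
Proof.
move=> lif f; have [ai _ _] := sab; have [g gE] := lif f.
have [phi phiE] := injective_extends Ii ai g.
by exists (q \o phi) => x; rewrite /= phiE gE.
Qed.

Lemma extends_lifts_sub : extends a Q -> lifts q X -> lifts q X'.
Proof.
move=> ext lif f; have [g gE] := ext f; have [h hE] := lif g.
by exists (h \o a) => x; rewrite /= hE gE.
Qed.
End Contravariant.

End LiftingAndExtending.

(** Bundled, so that finitely generated modules can be the objects of an abstract category. *)
Record fgmod (B : nzRingType) := FgMod {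
  fgmod_sort :> lmodType B; fgmod_fg : finitely_generated fgmod_sort }.

Lemma fg_index (B : nzRingType) (M : lmodType B) (J : finType) (v : J -> M) :
  (forall x, exists c : J -> B, x = \sum_j c j *: v j) -> finitely_generated M.
Proof.
move=> vP; exists #|J|, (fun k => v (enum_val k)) => x; have [c ->] := vP x.
exists (fun k => c (enum_val k)).
by rewrite (reindex _ (onW_bij _ (@enum_val_bij J))).
Qed.

Lemma fg_pow (B : nzRingType) (M : lmodType B) m :
  finitely_generated M -> finitely_generated {ffun 'I_m -> M}.
Proof.
case=> k [v vP].
apply: (@fg_index _ _ ('I_m * 'I_k)%type (fun j => pow_single j.1 (v j.2))) => x.
have [c cE] := choice (fun j => vP (x j)); exists (fun j => c j.1 j.2).
rewrite -(pair_bigA _ (fun a b => c a b *: pow_single a (v b))) /=.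
rewrite {1}(pow_sum x); apply: eq_bigr => j _; rewrite {1}(cE j).
apply/ffunP => l; rewrite sum_ffunE ffunE; case: eqP => [->|jl].
  by apply: eq_bigr => b _; rewrite !ffunE eqxx.
by rewrite big1 // => b _; rewrite !ffunE; case: eqP => // _; rewrite scaler0.
Qed.

(** * Vanishing of Ext in all degrees, by syzygies and cosyzygies *)

Section Ext.
Context {B : nzRingType}.
Variables (D : lmodType B).
Hypotheses (nB : @noetherian_ring B) (D_fg : finitely_generated D)
  (D_inj : injective_module D)
  (D_cog : forall X : fgmod B, exists m (i : {linear X -> {ffun 'I_m -> D}}),
     injective i).

(** A presentation by a finitely generated projective module together with its kernel, not
    necessarily minimal; [injective_hull] is likewise an embedding into an injective module that
    need not be essential. *)
Record projective_cover (X : fgmod B) := ProjectiveCover {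
  pc_ker : fgmod B; pc_mod : fgmod B;
  pc_in : {linear pc_ker -> pc_mod}; pc_out : {linear pc_mod -> X};
  pc_ses : ses_maps pc_in pc_out; pc_proj : projective pc_mod }.

Record injective_hull (X : fgmod B) := InjectiveHull {
  ih_coker : fgmod B; ih_mod : fgmod B;
  ih_in : {linear X -> ih_mod}; ih_out : {linear ih_mod -> ih_coker};
  ih_ses : ses_maps ih_in ih_out; ih_inj : injective_module ih_mod }.

Arguments pc_proj {X} p _ _ _ _ _.
Arguments ih_inj {X} i _ _ _ _ _.

Lemma projective_cover_exists X : inhabited (projective_cover X).
Proof.
have [m [p ps]] := free_cover (fgmod_fg X); have [K [i sip]] := ker_ses ps.
have [ii _ _] := sip; have Kfg := fg_sub nB (@fg_free B m) ii.
exact: (inhabits (@ProjectiveCover X (FgMod Kfg) (FgMod (@fg_free B m))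
  i p sip (@free_projective B m))).
Qed.

Lemma injective_hull_exists X : inhabited (injective_hull X).
Proof.
have [m [i ii]] := D_cog X; have [Q [q sq]] := coker_ses ii.
have [_ _ qs] := sq; have Ifg := fg_pow m D_fg; have Qfg := fg_surj Ifg qs.
refine (inhabits _); exact (@InjectiveHull X (FgMod Qfg) (FgMod Ifg)
  i q sq (pow_injective_module D_inj)).
Qed.

Definition pc X := inhabited_witness (projective_cover_exists X).
Definition ih X := inhabited_witness (injective_hull_exists X).
Definition syz X := pc_ker (pc X).
Definition cosyz X := ih_coker (ih X).

(** Vanishing of Ext^k by dimension shift: in degree k' + 1 it is Ext^1 from the k'-th syzygy of
    [X]. The second argument is an arbitrary module, and in [extI] the first one is, so that
    injective or projective modules of any size can be inserted there. *)
Definition extP k (X : fgmod B) (Y : lmodType B) :=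
  if k is k'.+1 then extends (pc_in (pc (iter k' syz X))) Y else hom0 X Y.
Definition extI k (X : lmodType B) (Y : fgmod B) :=
  if k is k'.+1 then lifts (ih_out (ih (iter k' cosyz Y))) X else hom0 X Y.

Section ExtPRules.
Variables (X : fgmod B) (Y' Y Y'' : lmodType B).
Hypothesis sY : mod_ses Y' Y Y''.

Lemma extP_mid k : extP k X Y' -> extP k X Y'' -> extP k X Y.
Proof.
case: sY => a [b sab]; case: k => [|k]; first exact: hom0_mid_r sab X.
by move=> h h'; exact: (extends_mid sab (pc_proj _) h h').
Qed.

Lemma extP_sub k : extP k X Y'' -> extP k.+1 X Y -> extP k.+1 X Y'.
Proof.
case: sY => a [b sab] h.
apply: (lifts_extends_sub sab (pc_ses _)); case: k h => [|k] h.
  exact: hom0_lifts.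
exact: (extends_lifts_syz sab (pc_proj (pc (iter k syz X))) h).
Qed.

Lemma extP_quot k : extP k X Y -> extP k.+1 X Y' -> extP k X Y''.
Proof.
case: sY => a [b sab]; case: k => [|k] h h'.
  exact: lifts_hom0 (extends_lifts (pc_ses (pc X)) (pc_proj _) h' sab) h.
apply: lifts_extends_quot h.
exact: (extends_lifts (pc_ses (pc (iter k.+1 syz X))) (pc_proj _) h' sab).
Qed.
End ExtPRules.

Section ExtIRules.
Variables (Y : fgmod B) (X' X X'' : lmodType B).
Hypothesis sX : mod_ses X' X X''.

Lemma extI_mid k : extI k X' Y -> extI k X'' Y -> extI k X Y.
Proof.
case: sX => a [b sab]; case: k => [|k]; first exact: hom0_mid_l sab Y.
by move=> h h'; exact: (lifts_mid sab (ih_inj _) h h').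
Qed.

Lemma extI_quot k : extI k X' Y -> extI k.+1 X Y -> extI k.+1 X'' Y.
Proof.
case: sX => a [b sab] h.
apply: (extends_lifts_quot sab (ih_ses _)); case: k h => [|k] h.
  exact: hom0_extends.
exact: (lifts_extends_cosyz sab (ih_inj (ih (iter k cosyz Y))) h).
Qed.

Lemma extI_sub k : extI k X Y -> extI k.+1 X'' Y -> extI k X' Y.
Proof.
case: sX => a [b sab]; case: k => [|k] h h'.
  exact: extends_hom0 (lifts_extends (ih_ses (ih Y)) (ih_inj _) h' sab) h.
apply: extends_lifts_sub h.
exact: (lifts_extends (ih_ses (ih (iter k.+1 cosyz Y))) (ih_inj _) h' sab).
Qed.
End ExtIRules.

Lemma extP_injective k (X : fgmod B) (I : lmodType B) : injective_module I -> extP k.+1 X I.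
Proof. by move=> Ii; apply: (injective_extends Ii); case: (pc_ses (pc (iter k syz X))). Qed.

Lemma extI_projective k (P : lmodType B) (Y : fgmod B) : projective P -> extI k.+1 P Y.
Proof. by move=> Pp; apply: (projective_lifts Pp); case: (ih_ses (ih (iter k cosyz Y))). Qed.

Lemma extP1_extends (X Y : fgmod B) (K M : lmodType B) (i : {linear K -> M}) (p : {linear M -> X}) :
  extP 1 X Y -> ses_maps i p -> extends i Y.
Proof.
move=> h; apply: (lifts_extends (ih_ses (ih Y)) (ih_inj _)).
exact: (extends_lifts (pc_ses (pc X)) (pc_proj _) h (ih_ses _)).
Qed.

Lemma extP1_lifts (X : fgmod B) (Y M N : lmodType B) (a : {linear Y -> M}) (b : {linear M -> N}) :
  extP 1 X Y -> ses_maps a b -> lifts b X.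
Proof. exact: (extends_lifts (pc_ses (pc X)) (pc_proj _)). Qed.

(** Degree one is [extends_lifts] and [lifts_extends]. Above it both sides are shifted in [Y]: by
    definition for [extI], and for [extP] by the long exact sequence of the cosyzygy, whose middle
    term is injective. *)
Lemma ext_balance k (X Y : fgmod B) : extP k X Y <-> extI k X Y.
Proof.
case: k => // k; elim: k X Y => [|k IH] X Y.
  split=> h; first exact: extP1_lifts h (ih_ses _).
  exact: (lifts_extends (ih_ses (ih Y)) (ih_inj _) h (pc_ses (pc X))).
have s : mod_ses Y (ih_mod (ih Y)) (cosyz Y) by do 2 eexists; exact: ih_ses.
have Ii := ih_inj (ih Y).
have -> : extI k.+2 X Y = extI k.+1 X (cosyz Y) by rewrite /extI iterSr.
have e m : extP m.+1 X (ih_mod (ih Y)) by apply: extP_injective.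
split=> [h|/IH h]; last exact: (extP_sub (k := k.+1) s h (e k.+1)).
by apply/IH; exact: (extP_quot (k := k.+1) s (e k) h).
Qed.
End Ext.

(** * Retracts, pullbacks and pushouts of short exact sequences *)

Section SequenceSurgery.
Context {B : nzRingType}.
Implicit Types I K L M N P Q S T W X Y Z : lmodType B.

Definition mod_retract X Y := exists (s : {linear X -> Y}) (r : {linear Y -> X}),
  forall x, r (s x) = x.

Lemma retract_hom0_r X Y' Y : mod_retract Y' Y -> hom0 X Y -> hom0 X Y'.
Proof. by case=> s [r rs] h f x; rewrite -(rs (f x)) -[s _]/((s \o f) x) h linear0. Qed.

Lemma retract_hom0_l X' X Y : mod_retract X' X -> hom0 X Y -> hom0 X' Y.
Proof. by case=> s [r rs] h f x; rewrite -(rs x) -[f _]/((f \o r) (s x)) h. Qed.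

Lemma retract_extends K M (i : {linear K -> M}) Y' Y :
  mod_retract Y' Y -> extends i Y -> extends i Y'.
Proof.
case=> s [r rs] ext f; have [h hE] := ext (s \o f).
by exists (r \o h) => k; rewrite /= hE /= rs.
Qed.

Lemma retract_lifts M N (p : {linear M -> N}) X' X :
  mod_retract X' X -> lifts p X -> lifts p X'.
Proof.
case=> s [r rs] lif f; have [h hE] := lif (f \o r).
by exists (h \o s) => x; rewrite /= hE /= rs.
Qed.

(** [W] is the preimage in [X] of the submodule [Y] of [X2], obtained as the kernel of X -> X2 -> Z.
    Its embedding is returned too, since it makes [W] finitely generated over a noetherian ring. *)
Lemma ses_pull X1 X X2 Y Z : mod_ses X1 X X2 -> mod_ses Y X2 Z ->
  exists W (w : {linear W -> X}), [/\ injective w, mod_ses X1 W Y & mod_ses W X Z].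
Proof.
case=> a [b sab] [c [d scd]].
have [ai _ bs] := sab; have [ci _ ds] := scd.
have dbs : surjective (d \o b).
  by move=> z; have [y <-] := ds z; have [x <-] := bs y; exists x.
have [W [w sw]] := ker_ses dbs; have [wi _ _] := sw.
exists W, w; split=> //; last by exists w, (d \o b).
have [|a' a'E] := @inj_lift _ _ _ _ w a wi.
  by move=> x; apply: (ses_ker sw); rewrite /= (ses_comp0 _ sab) linear0.
have [|b' b'E] := @inj_lift _ _ _ _ c (b \o w) ci.
  by move=> x; apply: (ses_ker scd); rewrite -[LHS]/((d \o b) (w x)) (ses_comp0 _ sw).
exists a', b'; split.
- by move=> x y e; apply: ai; rewrite -!a'E e.
- move=> x; split=> [b'x|[y <-]].
    have [y yE] : exists y, a y = w x.
      by apply: (ses_ker sab); rewrite -[LHS]/((b \o w) x) -b'E b'x linear0.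
    by exists y; apply: wi; rewrite a'E.
  by apply: ci; rewrite b'E /= a'E (ses_comp0 _ sab) linear0.
- move=> y; have [x xE] := bs (c y).
  have [u uE] : exists u, w u = x.
    by apply: (ses_ker sw); rewrite /= xE (ses_comp0 _ scd).
  by exists u; apply: ci; rewrite b'E /= uE.
Qed.

(** [W] is [X] modulo the submodule [Y] of [X1]. *)
Lemma ses_push X1 X X2 Y Z : mod_ses X1 X X2 -> mod_ses Y X1 Z ->
  exists W (p : {linear X -> W}), [/\ surjective p, mod_ses Z W X2 & mod_ses Y X W].
Proof.
case=> a [b sab] [c [d scd]].
have [ai _ bs] := sab; have [ci _ ds] := scd.
have aci : injective (a \o c) by move=> x y /ai /ci.
have [W [p sp]] := coker_ses aci; have [_ _ ps] := sp.
exists W, p; split=> //; last by exists (a \o c), p.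
have [|b' b'E] := surj_factor (f := b) ps.
  by move=> x /(ses_ker sp) [y <-]; rewrite /= (ses_comp0 _ sab).
have [|a' a'E] := surj_factor (f := p \o a) ds.
  by move=> x /(ses_ker scd) [y <-]; rewrite -[LHS]/(p ((a \o c) y)) (ses_comp0 _ sp).
exists a', b'; split.
- apply: linear_inj => z; have [x <-] := ds z; rewrite a'E /=.
  by case/(ses_ker sp) => y /= /ai <-; rewrite (ses_comp0 _ scd).
- move=> w; split=> [|[z <-]]; last first.
    by have [x <-] := ds z; rewrite a'E /= b'E (ses_comp0 _ sab).
  have [x <-] := ps w; rewrite b'E => /(ses_ker sab) [y <-].
  by exists (d y); rewrite a'E.
- by move=> y; have [x <-] := bs y; exists (p x); rewrite b'E.
Qed.

Lemma ses_split L M N (i : {linear L -> M}) (p : {linear M -> N})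
    (s : {linear N -> M}) : ses_maps i p -> (forall x, p (s x) = x) ->
  exists r : {linear M -> L}, ses_maps s r /\ forall x, r (i x) = x.
Proof.
move=> sip ps; have [ii _ _] := sip.
have [d dE] : exists d : {linear M -> M}, forall x, d x = x - s (p x).
  apply: linear_exists => a x y.
  by rewrite (linearP p) (linearP s) scalerBr opprD addrACA.
have [|r rE] := @inj_lift _ _ _ _ i d ii.
  by move=> x; apply: (ses_ker sip); rewrite dE linearB ps subrr.
have ri x : r (i x) = x by apply: ii; rewrite rE dE (ses_comp0 _ sip) linear0 subr0.
exists r; split=> //; split.
- by move=> x y e; rewrite -(ps x) e ps.
- move=> x; split=> [rx|[y <-]].
    exists (p x); apply/eqP; rewrite eq_sym -subr_eq0 -dE -rE rx linear0 //.
  by apply: ii; rewrite rE dE ps subrr linear0.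
- by move=> x; exists (i x).
Qed.

Lemma zero_linear_exists M N : exists z : {linear M -> N}, forall x, z x = 0.
Proof. by apply: linear_exists => a x y; rewrite scaler0 addr0. Qed.

Lemma zero_ses_l Z X : zero_module Z -> mod_ses Z X X.
Proof.
move=> Z0; have [z zE] := zero_linear_exists Z X; exists z, idfun; split.
- by move=> x y _; rewrite (Z0 x) (Z0 y).
- by move=> x; split=> [/= ->|[y <-]]; [exists 0; rewrite linear0|rewrite /= zE].
- by move=> x; exists x.
Qed.

Lemma zero_ses_r Z X : zero_module Z -> mod_ses X X Z.
Proof.
move=> Z0; have [z zE] := zero_linear_exists X Z; exists idfun, z; split.
- by [].
- by move=> x; split=> _; [exists x|rewrite zE].
- by move=> x; exists 0; rewrite (Z0 x) (Z0 (z 0)).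
Qed.

Lemma zero_ffun0 : zero_module {ffun 'I_0 -> B^o}.
Proof. by move=> f; apply/ffunP; case. Qed.

End SequenceSurgery.

(* The self-dual fragment of the theory of Ext groups that the argument uses:
   only their vanishing matters, and [ext 0] stands for Hom. *)
Record extcat_laws (ob : Type) (ses : ob -> ob -> ob -> Prop)
    (ext : nat -> ob -> ob -> Prop) (retract : ob -> ob -> Prop) : Prop :=
  ExtCatLaws {
  ext0_quot_law : forall X' X X'' Y, ses X' X X'' -> ext 0 X Y -> ext 0 X'' Y;
  ext0_sub_law : forall X Y' Y Y'', ses Y' Y Y'' -> ext 0 X Y -> ext 0 X Y';
  ext_midl_law : forall X' X X'' Y k, ses X' X X'' ->
    ext k X' Y -> ext k X'' Y -> ext k X Y;
  ext_midr_law : forall X Y' Y Y'' k, ses Y' Y Y'' ->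
    ext k X Y' -> ext k X Y'' -> ext k X Y;
  ext_quotl_law : forall X' X X'' Y k, ses X' X X'' ->
    ext k X' Y -> ext k.+1 X Y -> ext k.+1 X'' Y;
  ext_subr_law : forall X Y' Y Y'' k, ses Y' Y Y'' ->
    ext k X Y'' -> ext k.+1 X Y -> ext k.+1 X Y';
  ext_subl_law : forall X' X X'' Y k, ses X' X X'' ->
    ext k X Y -> ext k.+1 X'' Y -> ext k X' Y;
  ext_quotr_law : forall X Y' Y Y'' k, ses Y' Y Y'' ->
    ext k X Y -> ext k.+1 X Y' -> ext k X Y'';
  ext_zerol_law : forall X Y k, ext 0 X X -> ext k X Y;
  ext_zeror_law : forall X Y k, ext 0 Y Y -> ext k X Y;
  ext_retractl_law : forall X' X Y k, retract X' X -> ext k X Y -> ext k X' Y;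
  ext_retractr_law : forall X Y' Y k, retract Y' Y -> ext k X Y -> ext k X Y';
  zero_ses_law : exists2 Z, ext 0 Z Z & forall X, ses Z X X /\ ses X X Z;
  pull_law : forall X1 X X2 Y Z, ses X1 X X2 -> ses Y X2 Z ->
    exists2 W, ses X1 W Y & ses W X Z;
  push_law : forall X1 X X2 Y Z, ses X1 X X2 -> ses Y X1 Z ->
    exists2 W, ses Z W X2 & ses Y X W;
  split_ses_law : forall X' X X'', ses X' X X'' -> ext 1 X'' X' ->
    [/\ ses X'' X X', retract X' X & retract X'' X];
  enough_proj_law : forall X, exists K P, ses K P X /\ forall k Y, ext k.+1 P Y;
  enough_inj_law : forall X, exists I Q, ses X I Q /\ forall k Y, ext k.+1 Y I }.

Record extcat := ExtCat {
  ob :> Type;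
  ses : ob -> ob -> ob -> Prop;
  ext : nat -> ob -> ob -> Prop;
  retract : ob -> ob -> Prop;
  laws : extcat_laws ses ext retract }.

Arguments ses {e}.
Arguments ext {e}.
Arguments retract {e}.

Definition ext0_quot C := @ext0_quot_law _ _ _ _ (laws C).
Definition ext0_sub C := @ext0_sub_law _ _ _ _ (laws C).
Definition ext_midl C := @ext_midl_law _ _ _ _ (laws C).
Definition ext_midr C := @ext_midr_law _ _ _ _ (laws C).
Definition ext_quotl C := @ext_quotl_law _ _ _ _ (laws C).
Definition ext_subr C := @ext_subr_law _ _ _ _ (laws C).
Definition ext_subl C := @ext_subl_law _ _ _ _ (laws C).
Definition ext_quotr C := @ext_quotr_law _ _ _ _ (laws C).
Definition ext_zerol C := @ext_zerol_law _ _ _ _ (laws C).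
Definition ext_zeror C := @ext_zeror_law _ _ _ _ (laws C).
Definition ext_retractl C := @ext_retractl_law _ _ _ _ (laws C).
Definition ext_retractr C := @ext_retractr_law _ _ _ _ (laws C).
Definition zero_ses C := @zero_ses_law _ _ _ _ (laws C).
Definition pull C := @pull_law _ _ _ _ (laws C).
Definition push C := @push_law _ _ _ _ (laws C).
Definition split_ses C := @split_ses_law _ _ _ _ (laws C).
Definition enough_proj C := @enough_proj_law _ _ _ _ (laws C).
Definition enough_inj C := @enough_inj_law _ _ _ _ (laws C).

(** The laws come in dual pairs, or are self-dual, so each follows from its partner. *)
Lemma op_laws (C : extcat) : @extcat_laws C (fun X Y Z => ses Z Y X)
  (fun k X Y => ext k Y X) retract.
Proof.
split.
- by move=> X' X X'' Y; apply: ext0_sub.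
- by move=> X Y' Y Y''; apply: ext0_quot.
- by move=> X' X X'' Y k s h h'; apply: (ext_midr s).
- by move=> X Y' Y Y'' k s h h'; apply: (ext_midl s).
- by move=> X' X X'' Y k; apply: ext_subr.
- by move=> X Y' Y Y'' k; apply: ext_quotl.
- by move=> X' X X'' Y k; apply: ext_quotr.
- by move=> X Y' Y Y'' k; apply: ext_subl.
- by move=> X Y k; apply: ext_zeror.
- by move=> X Y k; apply: ext_zerol.
- by move=> X' X Y k; apply: ext_retractr.
- by move=> X Y' Y k; apply: ext_retractl.
- by have [Z Z0 s] := zero_ses C; exists Z => // X; have [] := s X.
- by move=> X1 X X2 Y Z s t; have [W ? ?] := push s t; exists W.
- by move=> X1 X X2 Y Z s t; have [W ? ?] := pull s t; exists W.
- by move=> X' X X'' s h; have [? ? ?] := split_ses s h.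
- by move=> X; have [I [Q [s h]]] := enough_inj X; exists Q, I.
- by move=> X; have [K [P [s h]]] := enough_proj X; exists P, K.
Qed.

Definition op (C : extcat) : extcat := ExtCat (op_laws C).

(** * The category of finitely generated modules *)

Section ModuleExtCat.
Context {B : nzRingType}.
Variables (D : lmodType B).
Hypotheses (nB : @noetherian_ring B) (D_fg : finitely_generated D)
  (D_inj : injective_module D)
  (D_cog : forall X : fgmod B, exists m (i : {linear X -> {ffun 'I_m -> D}}),
     injective i).

Local Notation exP := (@extP B nB).
Local Notation exI := (@extI B D D_fg D_inj D_cog).
Local Notation balance := (@ext_balance B D nB D_fg D_inj D_cog).

Lemma hom0_zero (X : lmodType B) : hom0 X X -> zero_module X.
Proof. by move=> h x; apply: (h idfun). Qed.

(** Laws in the second variable are read off projective presentations, laws in the first variable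
    off injective ones, and [balance] translates between the two. *)
Lemma mod_extcat_laws : @extcat_laws (fgmod B) (fun X Y Z => mod_ses X Y Z)
  (fun k X Y => exP k X Y) (fun X Y => mod_retract X Y).
Proof.
split.
- by move=> X' X X'' Y [a [b s]]; apply: hom0_quot_l s Y.
- by move=> X Y' Y Y'' [a [b s]]; apply: hom0_sub_r s X.
- by move=> X' X X'' Y k s /balance h /balance h'; apply/balance/(extI_mid s).
- by move=> X Y' Y Y'' k s h h'; apply: (extP_mid s).
- by move=> X' X X'' Y k s /balance h /balance h'; apply/balance/(extI_quot s).
- by move=> X Y' Y Y'' k s h h'; apply: (extP_sub s).
- by move=> X' X X'' Y k s /balance h /balance h'; apply/balance/(extI_sub s).
- by move=> X Y' Y Y'' k s h h'; apply: (extP_quot s).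
- move=> X Y k X0; have z := hom0_zero X0; apply/balance.
  by case: k => [|k]; [|apply: hom0_lifts] => f x; rewrite (z x) linear0.
- move=> X Y k Y0; have z := hom0_zero Y0.
  by case: k => [|k]; [|apply: hom0_extends] => f x; exact: z.
- move=> X' X Y k r /balance h; apply/balance; case: k h => [|k].
    exact: retract_hom0_l r.
  exact: retract_lifts r.
- move=> X Y' Y k r; case: k => [|k].
    exact: retract_hom0_r r.
  exact: retract_extends r.
- exists (FgMod (fg_zero zero_ffun0)); first by move=> f x; apply: zero_ffun0.
  move=> X; split; [exact: zero_ses_l zero_ffun0|exact: zero_ses_r zero_ffun0].
- move=> X1 X X2 Y Z s t; have [W [w [wi s1 s2]]] := ses_pull s t.
  by exists (FgMod (fg_sub nB (fgmod_fg X) wi)).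
- move=> X1 X X2 Y Z s t; have [W [w [ws s1 s2]]] := ses_push s t.
  by exists (FgMod (fg_surj (fgmod_fg X) ws)).
- move=> X' X X'' [i [p sip]] h.
  have [s sE] := extP1_lifts h sip idfun.
  have [r [sr ri]] := ses_split sip sE; split; first by exists s, r.
    by exists i, r.
  by exists s, p.
- move=> X; exists (syz nB X), (pc_mod (pc nB X)); split.
    by do 2 eexists; apply: (pc_ses (pc nB X)).
  by move=> k Y; apply/balance/extI_projective/pc_proj.
- move=> X; exists (ih_mod (ih D_fg D_inj D_cog X)), (cosyz D_fg D_inj D_cog X).
  split; first by do 2 eexists; apply: (ih_ses (ih D_fg D_inj D_cog X)).
  by move=> k Y; apply/extP_injective/ih_inj.
Qed.

Definition mod_extcat : extcat := ExtCat mod_extcat_laws.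

End ModuleExtCat.

(** * Filtrations, coresolutions and projective dimension, abstractly *)

Section Filtrations.
Variable C : extcat.
Implicit Types (X Y Z W : C) (P Q : C -> Prop).

(** Closure under extensions rather than a list of factors, which makes the notion self-dual
    ([Fil_op]). The premise of [Fil_zero] says that [X] is a zero object, [ext 0] being the
    vanishing of Hom. *)
Inductive Fil P : C -> Prop :=
| Fil_zero X : ext 0 X X -> Fil P X
| Fil_in X : P X -> Fil P X
| Fil_ext X' X X'' : ses X' X X'' -> Fil P X' -> Fil P X'' -> Fil P X.

Lemma Fil_mono P Q X : (forall Z, P Z -> Q Z) -> Fil P X -> Fil Q X.
Proof.
move=> PQ; elim=> [Z|Z PZ|X' Z X'' s _ h' _ h'']; first exact: Fil_zero.
  exact/Fil_in/PQ.
exact: Fil_ext s h' h''.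
Qed.

Lemma Fil_extl P X Y k : (forall Z, P Z -> ext k Z Y) -> Fil P X -> ext k X Y.
Proof.
move=> PY; elim=> [Z Z0|Z PZ|X' Z X'' s _ h' _ h'']; first exact: ext_zerol.
  exact: PY.
exact: (ext_midl s).
Qed.

Lemma Fil_extr P X Y k : (forall Z, P Z -> ext k Y Z) -> Fil P X -> ext k Y X.
Proof.
move=> PY; elim=> [Z Z0|Z PZ|X' Z X'' s _ h' _ h'']; first exact: ext_zeror.
  exact: PY.
exact: (ext_midr s).
Qed.

(** A factor in [P] lying directly above one in [Q] forms a split extension with it, so the two can
    be exchanged; this is done for whole blocks at once. *)
Lemma Fil_reorder P Q X : (forall Y Z, P Y -> Q Z -> ext 1 Y Z) ->
  Fil (fun Z => P Z \/ Q Z) X ->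
  exists X' X'', [/\ ses X' X X'', Fil P X' & Fil Q X''].
Proof.
move=> PQ; have [O O0 sO] := zero_ses C.
elim=> [Z Z0|Z [PZ|QZ]|X1 Z X2 s _ [X1' [X1'' [s1 f1' f1'']]] _ [X2' [X2'' [s2 f2' f2'']]]].
- by exists O, Z; have [? _] := sO Z; split=> //; apply: Fil_zero.
- by exists Z, O; have [_ ?] := sO Z; split; [|apply: Fil_in|apply: Fil_zero].
- by exists O, Z; have [? _] := sO Z; split; [|apply: Fil_zero|apply: Fil_in].
(* [U] is the preimage of [X2'] in the given object, and [V] is [U] modulo [X1'], an extension of
   [X2'] by [X1'']. It splits, so [X2'] also embeds in [V], with cokernel [X1'']. *)
have [U sU1 sU2] := pull s s2; have [V sV1 sV2] := push sU1 s1.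
have [|sV _ _] := split_ses sV1.
  by apply: Fil_extl f2' => Y PY; apply: Fil_extr f1'' => W QW; apply: PQ.
(* [W] is the preimage in [U] of that copy of [X2']; it is built from [X1'] and [X2'], and the
   quotient by it from [X1''] and [X2'']. *)
have [W sW1 sW2] := pull sV2 sV.
have [S sS1 sS2] := push sU2 sW2.
exists W, S; split=> //; first exact: Fil_ext sW1 f1' f2'.
exact: Fil_ext sS1 f1'' f2''.
Qed.

(** The sequence 0 -> X -> M_0 -> ... -> M_d -> 0 cut into short exact ones. Read in [op C], it is a
    resolution. *)
Fixpoint cores P d X : Prop :=
  if d is d'.+1 then exists M X', [/\ ses X M X', P M & cores P d' X'] else P X.

Lemma cores_mono P Q d X : (forall Z, P Z -> Q Z) -> cores P d X -> cores Q d X.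
Proof.
move=> PQ; elim: d X => [|d IH] X /=; first exact: PQ.
by case=> M [X' [s PM c]]; exists M, X'; split=> //; [apply: PQ|apply: IH].
Qed.

Lemma cores_shift P T d X k : (forall M j, P M -> ext j.+1 T M) ->
  cores P d X -> (d <= k)%N -> ext k.+1 T X.
Proof.
move=> TP; elim: d X k => [|d IH] X k /=; first by move=> PX _; apply: TP.
case=> M [X' [s PM c]]; case: k => // k dk.
exact: (ext_subr s (IH _ _ c dk) (TP _ _ PM)).
Qed.

Lemma cores_perp P Y d X : (forall M j, P M -> ext j.+1 M Y) ->
  cores P d X -> forall j, ext j.+1 X Y.
Proof.
move=> PY; elim: d X => [|d IH] X /=; first by move=> PX j; apply: PY.
case=> M [X' [s PM c]] j; exact: (ext_subl s (PY _ _ PM) (IH _ c _)).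
Qed.

(** Shifting along the coresolution turns Ext^(d+1)(M, X) = 0 into the splitting of its last short
    exact sequence, so the last cosyzygy is already a retract of a term. *)
Lemma cores_shorten P d X : (forall M N j, P M -> P N -> ext j.+1 M N) ->
  (forall Y Z, retract Y Z -> P Z -> P Y) ->
  (forall M, P M -> ext d.+1 M X) -> cores P d.+1 X -> cores P d X.
Proof.
move=> PP PR; elim: d X => [|d IH] X PX /= [M [X' [s PM c]]].
  by have [_ r _] := split_ses s (PX _ c); apply: PR r PM.
exists M, X'; split=> //; apply: IH => // N PN.
exact: (ext_quotr s (PP _ _ _ PN PM) (PX _ PN)).
Qed.

(** A bound on the projective dimension; in [op C], on the injective dimension. *)
Definition pd_le X d := forall Y, ext d.+1 X Y.

Lemma pd_le_ext X d k Y : pd_le X d -> (d <= k)%N -> ext k.+1 X Y.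
Proof.
move=> h; elim: k Y => [|k IH] Y; first by case: d h.
rewrite leq_eqVlt => /predU1P [<-|dk]; first exact: h.
have [I [Q [s iI]]] := enough_inj Y.
exact: (ext_subr s (IH Q dk) (iI _ _)).
Qed.

End Filtrations.
Arguments pd_le_ext {C X d k Y}.

Lemma Fil_op (C : extcat) (P : C -> Prop) X : @Fil (op C) P X <-> @Fil C P X.
Proof.
split; elim=> [Z Z0|Z PZ|X' Z X'' s _ h' _ h'']; try exact: Fil_zero;
  try exact: Fil_in; [exact: (@Fil_ext C _ _ _ _ s)|exact: (@Fil_ext (op C) _ _ _ _ s)].
Qed.

(** * Filtering an object orthogonal to a family Theta by a family Omega *)

Section PerpendicularCategory.
Variables (C : extcat) (n : nat) (E : 'I_n -> C) (Theta Omega : 'I_n -> C -> Prop).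
(** [kr l j] allows [E l] as a factor of the kernel of Theta j -> E j, and [qr j i] stands for [E j]
    being allowed as a factor of Omega i modulo [E i]. [len m X] is to be read as: the length of [X]
    is at most [m]. *)
Variables (kr qr : rel nat) (len : nat -> C -> Prop).
Implicit Types (X Y Z W : C) (i j l : 'I_n).
Hypotheses (len0 : forall X, len 0 X -> ext 0 X X)
  (len_quot : forall X' X X'' m, ses X' X X'' -> ~ ext 0 X' X' ->
     len m.+1 X -> len m X'')
  (socle : forall Y, ~ ext 0 Y Y -> exists i, ~ ext 0 (E i) Y)
  (Theta_ex : forall j, exists X, Theta j X)
  (Theta_ker : forall j X, Theta j X ->
     exists2 K, ses K X (E j) & Fil (fun Z => exists2 l : 'I_n, kr l j & Z = E l) K)
  (embed : forall i Y, ~ ext 0 (E i) Y -> (forall j, qr j i -> ext 1 (E j) Y) ->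
     exists W Y', Omega i W /\ ses W Y Y')
  (Omega_soc : forall i j W, Omega i W -> j <> i -> ext 0 (E j) W)
  (Omega_nz : forall i W, Omega i W -> ~ ext 0 W W)
  (ext1 : forall i j X W, Theta j X -> Omega i W -> ext 1 X W)
  (ext2 : forall i j X W, Theta j X -> Omega i W -> ext 2 X W)
  (kr_qr : forall l j i, kr l j -> qr j i -> (l < i)%N)
  (kr_lt : forall l j i, kr l j -> (j < i)%N -> (l < i)%N).

(* Induction on the length: for the least [i] with Hom(E i, Y) <> 0 the map
   E i -> Y extends to a monomorphism from Omega i, whose cokernel satisfies the
   same hypotheses because the relevant Ext^2 and Hom(E j, Omega i) vanish. *)
Lemma perp_filtered Y m (t : nat) : len m Y ->
  (forall j X, Theta j X -> ext 1 X Y) ->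
  (forall j, (j < t)%N -> ext 0 (E j) Y) ->
  Fil (fun X => exists2 l : 'I_n, (t <= l)%N & Omega l X) Y.
Proof.
elim: m Y t => [|m IH] Y t lY TY EY; first exact/Fil_zero/len0.
have [Y0|Yn0] := pselect (ext 0 Y Y); first exact: Fil_zero.
have [i0 i0P] := socle Yn0.
have [k kP kmin] : exists2 k, (exists2 i : 'I_n, i = k :> nat & ~ ext 0 (E i) Y) &
    forall j, (j < k)%N -> ext 0 (E j) Y.
  have ex : exists k, `[< exists2 i : 'I_n, i = k :> nat & ~ ext 0 (E i) Y >].
    by exists i0; apply/asboolP; exists i0.
  case: (ex_minnP ex) => k /asboolP kP kmin; exists k => // j jk.
  apply: contrapT => h; suff: (k <= j)%N by rewrite leqNgt jk.
  by apply: kmin; apply/asboolP; exists j.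
case: kP => i ik iP; rewrite -ik in kmin.
(* In 0 -> K -> Theta j -> E j -> 0 the minimality of [i] gives Hom(K, Y) = 0, and Ext^1(Theta j, Y)
   = 0 by assumption. *)
have ext1E j : (forall l, kr l j -> (l < i)%N) -> ext 1 (E j) Y.
  move=> h; have [X Xj] := Theta_ex j; have [K s fK] := Theta_ker Xj.
  apply: (ext_quotl s) (TY _ _ Xj).
  by apply: Fil_extl fK => _ [l lj ->]; apply/kmin/h.
have [|W [Y' [Wi s]]] := embed iP.
  by move=> j ji; apply: ext1E => l lj; apply: kr_qr lj ji.
have ti : (t <= i)%N by rewrite leqNgt; apply/negP => /EY.
apply: (Fil_ext s); first by apply: Fil_in; exists i.
have lY' : len m Y' by apply: len_quot s (Omega_nz Wi) lY.
apply: (Fil_mono (P := fun X => exists2 l : 'I_n, (i <= l)%N & Omega l X)).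
  by move=> Z [l il lZ]; exists l => //; apply: leq_trans ti il.
apply: IH => // [j X Xj|j ji]; first exact: (ext_quotr s (TY _ _ Xj) (ext2 Xj Wi)).
(* For j < i, Hom(E j, Y') = 0 needs Ext^1(E j, W) = 0. This comes from the same sequence, since the
   factors [E l] of the kernel have l < i and hence admit no nonzero map to [W]. *)
apply: (ext_quotr s (kmin j ji)); have [X Xj] := Theta_ex j.
have [K sK fK] := Theta_ker Xj; apply: (ext_quotl sK) (ext1 Xj Wi).
apply: Fil_extl fK => _ [l lj ->]; apply: Omega_soc Wi _ => li.
by have := kr_lt lj ji; rewrite li ltnn.
Qed.

End PerpendicularCategory.

(** * Comparison of dimensions for an abstract tilting object *)

Section TiltingDimension.
Variables (C : extcat) (A T : C) (addT Om Th : C -> Prop).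
Implicit Types X Y Z : C.
Hypotheses
  (A_gen : forall Y, exists Y' F, ses Y' F Y /\ forall Z k, ext k Z A -> ext k Z F)
  (addT_extl : forall X, addT X -> forall k Y, ext k T Y -> ext k X Y)
  (addT_extr : forall X, addT X -> forall k Y, ext k Y T -> ext k Y X)
  (addT_zero : forall X, ext 0 X X -> addT X)
  (addT_retract : forall X Y, retract X Y -> addT Y -> addT X)
  (T_self : forall k, ext k.+1 T T)
  (T_pd : exists d, pd_le T d)
  (T_cores : exists s, cores addT s A)
  (approx : forall Y T0 K, (forall k, ext k.+1 T Y) -> addT T0 -> ses A T0 K ->
     ext 1 K Y -> exists Y1 T1, [/\ ses Y1 T1 Y, addT T1 & ext 1 T Y1])
  (T_Th : Fil Th T) (addT_Om : forall X, addT X -> Fil Om X)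
  (Th_Om : forall X Y k, Th X -> Om Y -> ext k.+1 X Y)
  (Th_pd : exists N, forall X, Th X -> pd_le X N)
  (perp : forall Y, (forall X, Th X -> ext 1 X Y) -> Fil Om Y).

Let addT_self M N k : addT M -> addT N -> ext k.+1 M N.
Proof. by move=> MT NT; apply/(addT_extl MT)/(addT_extr NT). Qed.

Let Th_Fil X Y k : Th X -> Fil Om Y -> ext k.+1 X Y.
Proof. by move=> XT; apply: Fil_extr => Z; apply: Th_Om. Qed.

(** Right exactness of the top Ext: every [Y] is a factor of some [F] that behaves like a power of
    [A]. In contrapositive form, Ext^r(T, A) is nonzero for r = proj.dim(T) > 0. *)
Lemma pd_le_pred d : pd_le T d.+1 -> ext d.+1 T A -> pd_le T d.
Proof.
move=> h hA Y; have [Y' [F [s F_ext]]] := A_gen Y.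
exact: (ext_quotr s (F_ext _ _ hA) (h Y')).
Qed.

(** The coresolution of [A] kills Ext^(k+1)(T, A) for all k >= d, so a finite bound on the
    projective dimension can be lowered step by step down to [d]. *)
Lemma cores_pd_le P d : (forall M j, P M -> ext j.+1 T M) ->
  cores P d A -> pd_le T d.
Proof.
move=> TP c; have [r rP] := T_pd.
have [rd Y|rd] := leqP r d; first exact: pd_le_ext rP rd.
elim: r rP rd => // r IH rP; rewrite ltnS leq_eqVlt => /predU1P [dr|].
  by subst d; exact: (pd_le_pred rP (cores_shift TP c (leqnn _))).
by move=> dr; apply: (IH _ dr); exact: (pd_le_pred rP (cores_shift TP c (ltnW dr))).
Qed.

Lemma cores_le P s d : (forall X, ext 0 X X -> P X) -> (s <= d)%N ->
  cores P s A -> cores P d A.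
Proof.
move=> P0 + c; elim: d => [|d IH]; first by rewrite leqn0 => /eqP <-.
rewrite leq_eqVlt => /predU1P [<- //|/IH {}c].
have [O O0 sO] := zero_ses C; move: (A) c; elim: d {IH} => [|d IH] X /=.
  by move=> PX; exists X, O; have [_ ?] := sO X; split=> //; apply: P0.
by case=> M [X' [t PM c]]; exists M, X'; split=> //; apply: IH.
Qed.

(** A coresolution of some length [s] exists by hypothesis; while it is longer than [d], the
    vanishing of Ext above [d] splits off its last term. *)
Lemma pd_le_cores d : pd_le T d -> cores addT d A.
Proof.
move=> h; have [s c] := T_cores; have [sd|/ltnW ds] := leqP s d.
  exact: cores_le addT_zero sd c.
elim: s ds c => [|s IH]; first by rewrite leqn0 => /eqP ->.
rewrite leq_eqVlt => /predU1P [-> //|ds] c; apply: IH => //.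
apply: (cores_shorten _ addT_retract) c => [M N j|M MT]; first exact: addT_self.
exact: (addT_extl MT (pd_le_ext h ds)).
Qed.

(** The cokernel [K] of [A] in the first term of its coresolution is itself coresolved by add(T), so
    it is orthogonal to [Y], as [approx] demands. The kernel of the approximation stays orthogonal
    to [T], and the construction can be iterated. *)
Lemma perp_approx Y : (forall k, ext k.+1 T Y) ->
  exists Y1 T1, [/\ ses Y1 T1 Y, addT T1 & forall k, ext k.+1 T Y1].
Proof.
move=> TY; have addTY M j : addT M -> ext j.+1 M Y by move=> MT; apply: addT_extl.
have [T0 [K [T0T sK KY]]] : exists T0 K, [/\ addT T0, ses A T0 K & ext 1 K Y].
  have [[|s] /= c] := T_cores.
    (* If [A] itself lies in add(T), its identity serves, with zero cokernel. *)
    have [O O0 sO] := zero_ses C; exists A, O; have [_ ?] := sO A.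
    by split=> //; apply: ext_zerol.
  have [M [X' [t MT c']]] := c; exists M, X'; split=> //.
  exact: (cores_perp addTY c').
have [Y1 [T1 [s1 T1T TY1]]] := approx TY T0T sK KY.
exists Y1, T1; split=> // -[//|k].
exact: (ext_subr s1 (TY _) (addT_extr T1T (T_self _))).
Qed.

(** Each approximation step trades Ext^(k+1)(X, Y) for Ext^(k+2)(X, Y1), because Ext from [X] to
    add(T) vanishes. After [N] steps the degree exceeds the projective dimension of [X]. *)
Lemma T_perp_Th_perp Y X : (forall k, ext k.+1 T Y) -> Th X -> ext 1 X Y.
Proof.
move=> TY XT; have [N /(_ _ XT) NP] := Th_pd.
suff h m k Z : (N <= m + k)%N -> (forall k, ext k.+1 T Z) -> ext k.+1 X Z.
  by apply: (h N 0%N) => //; rewrite addn0.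
elim: m k Z => [|m IH] k Z Nmk TZ; first exact: pd_le_ext NP Nmk.
have [Y1 [T1 [s T1T TY1]]] := perp_approx TZ.
apply: (ext_quotr s); first by apply: Th_Fil => //; apply: addT_Om.
by apply: IH => //; rewrite addnS -addSn.
Qed.

(** An injective coresolution cut off after [d] steps: its terms are orthogonal to everything, and
    the d-th cosyzygy is orthogonal to [T]. *)
Lemma perp_cores d X : (forall k, (d <= k)%N -> ext k.+1 T X) ->
  cores (Fil Om) d X.
Proof.
elim: d X => [|d IH] X TX /=.
  by apply: perp => Z ZT; apply: T_perp_Th_perp => // k; apply: TX.
have [I [Q [s iI]]] := enough_inj X; exists I, Q; split=> //.
  by apply: perp => Z ZT; apply: iI.
by apply: IH => k dk; apply: (ext_quotr s (iI _ _) (TX _ _)).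
Qed.

(** Stated for upper bounds: the dimensions are least values, so they agree as soon as they have the
    same bounds, and no attained value has to be computed. *)
Theorem tilting_dimension d :
  [/\ (forall X, cores (Fil Om) d X) <-> pd_le T d,
      cores addT d A <-> pd_le T d & cores (Fil Om) d A <-> pd_le T d].
Proof.
have T_Om M j : Fil Om M -> ext j.+1 T M.
  by move=> MO; apply: Fil_extl T_Th => Z ZT; apply: Th_Fil.
have Om_pd : cores (Fil Om) d A -> pd_le T d by apply: cores_pd_le.
have pd_Om : pd_le T d -> forall X, cores (Fil Om) d X.
  by move=> h X; apply: perp_cores => k; apply: pd_le_ext.
split; split=> //.
- by move=> h; apply: Om_pd.
- by apply: cores_pd_le => M j /addT_Om; apply: T_Om.
- exact: pd_le_cores.
- by move=> h; apply: pd_Om.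
Qed.

End TiltingDimension.

(** * Modules of finite length *)

Section FiniteLength.
Context {B : nzRingType}.
Implicit Types I K L M N P Q S T W X Y Z : lmodType B.

Lemma eq_set0 M (U : set M) x : U = [set 0] -> U x -> x = 0.
Proof. by move=> ->. Qed.

Lemma eq_setT M (U : set M) x : U = setT -> U x.
Proof. by move=> ->. Qed.

Lemma simple_map K N (c : {linear K -> N}) : simple N ->
  (forall x, c x = 0) \/ surjective c.
Proof.
case=> _ /(_ _ (submodule_im c)) [h|h]; [left=> x|right=> y].
  by apply: (eq_set0 h); exists x.
exact: (eq_setT y h).
Qed.

Lemma simple_quot N Q (g : {linear N -> Q}) : simple N -> surjective g ->
  ~ zero_module Q -> simple Q /\ injective g.
Proof.
move=> [Nnz Ns] gs Qnz.
have gi : injective g.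
  apply: linear_inj; case: (Ns _ (submodule_ker g)) => h x gx.
    exact: (eq_set0 h).
  case: Qnz => y; have [z <-] := gs y; exact: (eq_setT z h).
split=> //; split=> // U HU; case: (Ns _ (submodule_preim g HU)) => h; [left|right].
  apply: zero_submodule HU _ => y; have [z <-] := gs y => Uz.
  by rewrite (eq_set0 h Uz) linear0.
by apply: full_submodule => y; have [z <-] := gs y; exact: (eq_setT z h).
Qed.

Lemma simple_inj N M (g : {linear N -> M}) : simple N ->
  (exists x, g x <> 0) -> injective g.
Proof.
move=> [_ Ns] [x gx]; apply: linear_inj => y gy.
case: (Ns _ (submodule_ker g)) => h.
  exact: (eq_set0 h).
case: gx; exact: (eq_setT x h).
Qed.

(** Only an upper bound for the length, which avoids Jordan-Hoelder; the lemmas ending in [_strict]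
    supply the decrease that inductions use. *)
Fixpoint flen m M : Prop :=
  if m is m'.+1 then
    zero_module M \/ exists L N, [/\ mod_ses L M N, simple N & flen m' L]
  else zero_module M.

Lemma flen_succ m M : flen m M -> flen m.+1 M.
Proof.
elim: m M => [|m IH] M; first by left.
by case=> [?|[L [N [s Ns fL]]]]; [left|right; exists L, N; split=> //; apply: IH].
Qed.

Lemma flen_leq m k M : (m <= k)%N -> flen m M -> flen k M.
Proof.
move=> mk fM; rewrite -(subnK mk) addnC.
by elim: (k - m)%N => [|j IH]; rewrite ?addn0 // addnS; apply: flen_succ.
Qed.

Lemma zero_module_inj K M (i : {linear K -> M}) : injective i ->
  zero_module M -> zero_module K.
Proof. by move=> ii M0 x; apply: ii; rewrite !(M0 (i _)). Qed.

Lemma zero_module_surj M N (p : {linear M -> N}) : surjective p ->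
  zero_module M -> zero_module N.
Proof. by move=> ps M0 x; have [y <-] := ps x; rewrite (M0 y) linear0. Qed.

Lemma flen_ext a b L M N : mod_ses L M N -> flen a L -> flen b N -> flen (b + a) M.
Proof.
have qz L' M' N' : mod_ses L' M' N' -> zero_module N' -> flen a L' -> flen a M'.
  case=> i [p s] N0; have [ii _ _] := s.
  have [g gE] : exists g : {linear M' -> L'}, forall z, i (g z) = z.
    by apply: (inj_lift (f := idfun)) => // z; apply: (ses_ker s).
  case: a => [L0 x|a [L0|[X [S [[j [q t]] Ss fX]]]]].
  - by rewrite -(gE x) (L0 (g x)) linear0.
  - by left=> x; rewrite -(gE x) (L0 (g x)) linear0.
  right; exists X, S; split=> //; exists (i \o j), (q \o g).
  have gi x : g (i x) = x by apply: ii; rewrite gE.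
  have [ji _ qs] := t; split.
  - by move=> x y /ii /ji.
  - move=> x; split=> [/(ses_ker t) [y yE]|[y <-]]; first by exists y; rewrite /= yE gE.
    by rewrite /= gi (ses_comp0 _ t).
  - by move=> y; have [x <-] := qs y; exists (i x); rewrite /= gi.
elim: b M N => [|b IH] M N s fL.
  by move=> N0; exact: (qz _ _ _ s N0 fL).
case=> [N0|[N1 [S [t Ss fN1]]]].
  exact: (flen_leq (leq_addl _ _) (qz _ _ _ s N0 fL)).
have [W [w [_ s1 s2]]] := ses_pull s t.
by right; exists W, S; split=> //; apply: IH s1 fL fN1.
Qed.

Lemma flen_sub m K M (i : {linear K -> M}) : flen m M -> injective i -> flen m K.
Proof.
elim: m K M i => [|m IH] K M i; first by move=> M0 ii; apply: zero_module_inj ii M0.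
move=> [M0|[L [N [[l [p s]] Ns fL]]]] ii; first by left; apply: zero_module_inj ii M0.
have [li _ _] := s; have [c0|cs] := simple_map (p \o i) Ns.
  have [|g gE] := @inj_lift B _ _ _ l i li.
    by move=> z; apply: (ses_ker s); apply: c0.
  by apply/flen_succ/(IH _ _ g fL) => x y e; apply: ii; rewrite -!gE e.
have [K' [k t]] := ker_ses cs; right; exists K', N; split=> //; first by exists k, (p \o i).
have [ki _ _] := t; have [|g gE] := @inj_lift B _ _ _ l (i \o k) li.
  by move=> z; apply: (ses_ker s); apply: (ses_comp0 _ t).
apply: (IH _ _ g fL) => x y e; apply: ki; apply: ii.
by rewrite -[LHS]/((i \o k) x) -gE e gE.
Qed.

Lemma flen_quot m M Q (q : {linear M -> Q}) : flen m M -> surjective q -> flen m Q.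
Proof.
elim: m M Q q => [|m IH] M Q q; first by move=> M0 qs; apply: zero_module_surj qs M0.
move=> [M0|[L [N [[l [p s]] Ns fL]]]] qs; first by left; apply: zero_module_surj qs M0.
have [li _ ps] := s.
have [L' [R [j [r [t L'im L'r]]]]] := sub_ses (submodule_im (q \o l)).
have [ji _ rs] := t.
have [g gE] : exists g : {linear L -> L'}, forall z, j (g z) = (q \o l) z.
  by apply: inj_lift => // z; apply/L'im; exists z.
have gs : surjective g.
  move=> y; have /L'im [x xE] : exists k, j k = j y by exists y.
  by exists x; apply: ji; rewrite gE.
have fL' : flen m L' by apply: IH fL gs.
have [h hE] : exists h : {linear N -> R}, forall x, h (p x) = (r \o q) x.
  apply: surj_factor => // x /(ses_ker s) [y <-].
  by rewrite /= -[q (l y)]/((q \o l) y) -gE (ses_comp0 _ t).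
have hs : surjective h.
  by move=> y; have [z <-] := rs y; have [x <-] := qs z; exists (p x); rewrite hE.
have [R0|Rn0] := pselect (zero_module R).
  by apply: (flen_ext (b := 1) _ fL'); [exists j, r|left].
have [Rs _] := simple_quot Ns hs Rn0.
by right; exists L', R; split=> //; exists j, r.
Qed.

(** Compare [K] with a submodule [L] whose quotient [N] is simple. Either [K] lies in [L], or it
    maps onto [N] and meets [L] in a proper submodule of [L]. *)
Lemma flen_sub_strict m K M Q : mod_ses K M Q -> ~ zero_module Q ->
  flen m.+1 M -> flen m K.
Proof.
elim: m K M Q => [|m IH] K M Q [i [q t]] Qn0.
  case=> [M0|[L [N [[l [p s]] Ns L0]]]].
    by case: Qn0; case: t => _ _ qs; apply: zero_module_surj qs M0.
  have [li _ ps] := s; have [ii _ qs] := t; have [c0|cs] := simple_map (p \o i) Ns.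
    move=> x; apply: ii; have [y <-] := ses_ker s (c0 x).
    by rewrite (L0 y) !linear0.
  case: Qn0 => y; have [x <-] := qs y; have [k kE] := cs (p x).
  have [z zE] : exists z, l z = x - i k.
    by apply: (ses_ker s); rewrite linearB -kE subrr.
  by rewrite -(subrK (i k) x) -zE (L0 z) linear0 add0r (ses_comp0 _ t).
case=> [M0|[L [N [[l [p s]] Ns fL]]]].
  by case: Qn0; case: t => _ _ qs; apply: zero_module_surj qs M0.
have [li _ ps] := s; have [ii _ qs] := t; have [c0|cs] := simple_map (p \o i) Ns.
  have [|g gE] := @inj_lift B _ _ _ l i li.
    by move=> z; apply: (ses_ker s); apply: c0.
  have gi : injective g by move=> x y e; apply: ii; rewrite -!gE e.
  exact: (@flen_sub m.+1 K L g fL gi).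
have [K' [k u]] := ker_ses cs; have [ki _ _] := u.
have [|g gE] := @inj_lift B _ _ _ l (i \o k) li.
  by move=> z; apply: (ses_ker s); apply: (ses_comp0 _ u).
have gi : injective g.
  by move=> x y e; apply: ki; apply: ii; rewrite -[LHS]/((i \o k) x) -gE e gE.
have [R [r v]] := coker_ses gi.
right; exists K', N; split=> //; first by exists k, (p \o i).
apply: (IH _ L R) fL; first by exists g, r.
move=> R0; apply: Qn0 => y; have [x <-] := qs y; have [z zE] := cs (p x).
have [w wE] : exists w, l w = x - i z.
  by apply: (ses_ker s); rewrite linearB -zE subrr.
have [w' w'E] := ses_ker v (R0 (r w)).
rewrite -(subrK (i z) x) -wE -w'E gE linearD (ses_comp0 _ t) addr0.
by rewrite /= (ses_comp0 _ t).
Qed.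

(** With [L] and [N] as in [flen_sub_strict]: either [K] lies in [L], and [Q] is an extension of [N]
    by L/K, or [K] maps onto [N], and already [L] maps onto [Q]. *)
Lemma flen_quot_strict m K M Q : mod_ses K M Q -> ~ zero_module K ->
  flen m.+1 M -> flen m Q.
Proof.
elim: m K M Q => [|m IH] K M Q [i [q t]] Kn0.
  case=> [M0|[L [N [[l [p s]] Ns L0]]]].
    by case: Kn0; case: t => ii _ _; apply: zero_module_inj ii M0.
  have [li _ ps] := s; have [ii _ qs] := t; have [c0|cs] := simple_map (p \o i) Ns.
    case: Kn0 => x; apply: ii; have [y <-] := ses_ker s (c0 x).
    by rewrite (L0 y) !linear0.
  move=> y; have [x <-] := qs y; have [k kE] := cs (p x).
  have [z zE] : exists z, l z = x - i k.
    by apply: (ses_ker s); rewrite linearB -kE subrr.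
  by rewrite -(subrK (i k) x) -zE (L0 z) linear0 add0r (ses_comp0 _ t).
case=> [M0|[L [N [[l [p s]] Ns fL]]]].
  by case: Kn0; case: t => ii _ _; apply: zero_module_inj ii M0.
have [li _ ps] := s; have [ii _ qs] := t; have [c0|cs] := simple_map (p \o i) Ns.
  have [|g gE] := @inj_lift B _ _ _ l i li.
    by move=> z; apply: (ses_ker s); apply: c0.
  have gi : injective g by move=> x y e; apply: ii; rewrite -!gE e.
  have [L' [c u]] := coker_ses gi; have [_ _ cs] := u.
  have fL' : flen m L' by apply: (IH K L L' _ Kn0 fL); exists g, c.
  have [h hE] : exists h : {linear L' -> Q}, forall x, h (c x) = (q \o l) x.
    apply: surj_factor => // x /(ses_ker u) [y <-].
    by rewrite /= gE (ses_comp0 _ t).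
  have [r rE] : exists r : {linear Q -> N}, forall x, r (q x) = p x.
    by apply: surj_factor => // x /(ses_ker t) [y <-]; apply: c0.
  right; exists L', N; split=> //; exists h, r; split.
  - apply: linear_inj => y; have [x <-] := cs y; rewrite hE /=.
    case/(ses_ker t) => z; rewrite -gE => /li <-; exact: (ses_comp0 _ u).
  - move=> y; have [x <-] := qs y; rewrite rE; split=> [/(ses_ker s) [z <-]|[w]].
      by exists (c z); rewrite hE.
    have [z <-] := cs w; rewrite hE /= => qe.
    have [k kE] : exists k, i k = l z - x by apply: (ses_ker t); rewrite linearB qe subrr.
    have -> : x = l (z - g k) by rewrite linearB gE kE opprB addrC subrK.
    exact: (ses_comp0 _ s).
  - by move=> y; have [x <-] := ps y; exists (q x); rewrite rE.
apply: (@flen_quot m.+1 L Q (q \o l) fL) => y; have [x <-] := qs y.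
have [k kE] := cs (p x).
have [z zE] : exists z, l z = x - i k.
  by apply: (ses_ker s); rewrite linearB -kE subrr.
by exists z; rewrite /= zE linearB (ses_comp0 _ t) subr0.
Qed.

Lemma simple_sub m M : flen m M -> ~ zero_module M ->
  exists S (j : {linear S -> M}), simple S /\ injective j.
Proof.
elim: m M => [|m IH] M //= [//|[L [N [[l [p s]] Ns fL]]]] Mn0.
have [li _ ps] := s; have [L0|Ln0] := pselect (zero_module L); last first.
  by have [S [j [Ss ji]]] := IH _ fL Ln0; exists S, (l \o j); split=> // x y /li /ji.
have pi : injective p.
  by apply: linear_inj => x /(ses_ker s) [y <-]; rewrite (L0 y) linear0.
have [|g gE] := @inj_lift B _ _ _ p idfun pi; first by move=> z; apply: ps.
have gs : surjective g by move=> z; exists (p z); apply: pi; rewrite gE.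
by have [Ms _] := simple_quot Ns gs Mn0; exists M, idfun.
Qed.

Lemma simple_factor m M : flen m M -> ~ zero_module M ->
  exists S (p : {linear M -> S}), simple S /\ surjective p.
Proof.
case: m => //= m [//|[L [N [[l [p s]] Ns fL]]]] _.
by exists N, p; split=> //; case: s.
Qed.

(** A member of the family with the least length bound is minimal, as a properly smaller one would
    admit a smaller bound. *)
Lemma min_submodule m M (F : set M -> Prop) : flen m M ->
  (forall U, F U -> submodule U) -> (exists U, F U) ->
  exists2 U, F U & forall V, F V -> V `<=` U -> U `<=` V.
Proof.
move=> fM FS [U0 FU0].
pose small k := exists2 U, F U & exists K (i : {linear K -> M}),
  [/\ injective i, forall x, U x <-> exists y, i y = x & flen k K].
have ex : exists k, `[< small k >].
  exists m; apply/asboolP; exists U0 => //.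
  have [K [_ [i [_ [[ii _ _] iU _]]]]] := sub_ses (FS _ FU0).
  by exists K, i; split=> //; apply: flen_sub fM ii.
case: (ex_minnP ex) => k /asboolP [U FU [K [i [ii iU fK]]]] kmin.
exists U => // V FV VU x Ux; apply: contrapT => Vx.
have [K' [Q [j [q [t jV qV]]]]] := sub_ses (submodule_preim i (FS _ FV)).
have [ji _ _] := t; have [y yE] : exists y, i y = x by apply/iU.
have Qn0 : ~ zero_module Q.
  by move=> Q0; apply: Vx; rewrite -yE; apply/(qV y); apply: Q0.
case: k kmin fK => [|k] kmin fK; first by apply: Qn0 => z; have [_ _ qs] := t;
  apply: zero_module_surj qs fK z.
have: (k.+1 <= k)%N; last by rewrite ltnn.
apply: kmin; apply/asboolP; exists V => //; exists K', (i \o j); split.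
- by move=> a b /ii /ji.
- move=> z; split=> [Vz|[w <-]]; last by apply/(jV (j w)); exists w.
  have [z' z'E] : exists y, i y = z by apply/iU/VU.
  have /jV [w wE] : V (i z') by rewrite z'E.
  by exists w; rewrite /= wE.
- by apply: flen_sub_strict Qn0 fK; exists j, q.
Qed.

Lemma max_submodule m M (F : set M -> Prop) : flen m M ->
  (forall U, F U -> submodule U) -> (exists U, F U) ->
  exists2 U, F U & forall V, F V -> U `<=` V -> V `<=` U.
Proof.
move=> fM FS [U0 FU0].
pose small k := exists2 U, F U & exists Q (p : {linear M -> Q}),
  [/\ surjective p, forall x, U x <-> p x = 0 & flen k Q].
have ex : exists k, `[< small k >].
  exists m; apply/asboolP; exists U0 => //.
  have [_ [Q [_ [p [[_ _ ps] _ pU]]]]] := sub_ses (FS _ FU0).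
  by exists Q, p; split=> //; apply: flen_quot fM ps.
case: (ex_minnP ex) => k /asboolP [U FU [Q [p [ps pU fQ]]]] kmin.
exists U => // V FV UV x Vx; apply: contrapT => Ux.
have [K [Q' [i [q [t iV qV]]]]] := sub_ses (submodule_image p (FS _ FV)).
have [_ _ qs] := t.
have [y yE] : exists y, i y = p x by apply/iV; exists x.
have Kn0 : ~ zero_module K.
  by move=> K0; apply: Ux; apply/pU; rewrite -yE (K0 y) linear0.
case: k kmin fQ => [|k] kmin fQ.
  by apply: Ux; apply/pU; apply: fQ.
have: (k.+1 <= k)%N; last by rewrite ltnn.
apply: kmin; apply/asboolP; exists V => //; exists Q', (q \o p); split.
- by move=> z; have [w <-] := qs z; have [v <-] := ps w; exists v.
- move=> z; split=> [Vz|/(qV (p z)) [v Vv pv]]; first by apply/(qV (p z)); exists z.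
  rewrite -(subrK v z); have [_ VD _] := FS _ FV; apply: (VD) Vv.
  by apply/UV/pU; rewrite linearB pv subrr.
- by apply: flen_quot_strict Kn0 fQ; exists i, q.
Qed.

Lemma flen_pow m a X : flen a X -> exists b, flen b {ffun 'I_m -> X}.
Proof.
move=> fX; elim: m => [|m [b IH]].
  by exists 0%N => f; apply/ffunP; case.
exists (a + b)%N.
have [p pE] := pow_proj X (ord0 : 'I_m.+1).
have [|i iE] := @linear_exists _ {ffun 'I_m -> X} {ffun 'I_m.+1 -> X}
    (fun f => [ffun j => if unlift ord0 j is Some k then f k else 0]).
  move=> c f g; apply/ffunP => j; rewrite !ffunE.
  by case: unlift => [k|]; rewrite ?ffunE // scaler0 addr0.
apply: (@flen_ext b a _ _ X) IH fX; exists i, p; split.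
- apply: linear_inj => f /ffunP h; apply/ffunP => k.
  by have := h (lift ord0 k); rewrite iE !ffunE liftK.
- move=> f; rewrite pE; split=> [f0|[g <-]]; last by rewrite iE ffunE unlift_none.
  exists [ffun k => f (lift ord0 k)]; rewrite iE; apply/ffunP => j; rewrite ffunE.
  by case: unliftP => [k ->|->]; rewrite ?ffunE.
- by move=> x; exists [ffun=> x]; rewrite pE ffunE.
Qed.

Lemma flen_fg M : (exists a, flen a (B^o : lmodType B)) -> finitely_generated M ->
  exists m, flen m M.
Proof.
case=> a fB /free_cover [k [p ps]]; have [b fb] := flen_pow k fB.
by exists b; apply: flen_quot fb ps.
Qed.

Lemma fg_simple N : simple N -> finitely_generated N.
Proof.
case=> /existsNP [x xn0] /(_ _ (submodule_cyclic x)) [h|h].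
  by case: xn0; apply: (eq_set0 h); exists 1; rewrite scale1r.
exists 1%N, (fun=> x) => y; have [a <-] := eq_setT y h.
by exists (fun=> a); rewrite big_ord1.
Qed.

Lemma fg_flen m M : flen m M -> finitely_generated M.
Proof.
elim: m M => [|m IH] M; first exact: fg_zero.
case=> [|[L [N [s Ns fL]]]]; first exact: fg_zero.
exact: fg_ext s (IH _ fL) (fg_simple Ns).
Qed.

Lemma flen_noetherian : (exists a, flen a (B^o : lmodType B)) -> @noetherian_ring B.
Proof. by case=> a fB K i ii; apply: fg_flen (flen_sub fB ii). Qed.

Lemma composition_series_flen M s : composition_series M s -> flen (size s) M.
Proof.
case=> fs; elim: fs => [X X0 _|L X N t f g fi e gs _ IH /= [Ns ts]]; first exact: X0.
by right; exists L, N; split=> //; [exists f, g|apply: IH].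
Qed.

Lemma flen_composition_series m M : flen m M -> exists s, composition_series M s.
Proof.
elim: m M => [|m IH] M; first by exists [::]; split=> //; apply: filtration_nil.
case=> [M0|[L [N [[i [p [ii e ps]]] Ns fL]]]].
  by exists [::]; split=> //; apply: filtration_nil.
have [s [fs sP]] := IH _ fL; exists (N :: s); split=> //.
exact: filtration_cons ii e ps fs.
Qed.

End FiniteLength.

(** * Commutative artinian rings are noetherian *)

Section Artinian.
Context {R : comNzRingType}.
Implicit Types K L M N Q : lmodType R.

Lemma artinian_min M (F : set M -> Prop) : artinian_module M ->
  (forall U, F U -> submodule U) -> (exists U, F U) ->
  exists2 U, F U & forall V, F V -> V `<=` U -> U `<=` V.
Proof.
move=> aM FS [U0 FU0]; apply: contrapT => nomin.
have next (U : {U | F U}) : exists V : {V | F V}, sval V `<=` sval U /\ ~ sval U `<=` sval V.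
  case: U => U FU; apply: contrapT => h; apply: nomin; exists U => // V FV VU x Ux.
  by apply: contrapT => Vx; apply: h; exists (exist _ V FV); split=> // UV; apply/Vx/UV.
have [f fP] := choice next.
pose G k := sval (iter k f (exist _ U0 FU0)).
have [k|k|m mP] := aM G; first exact: FS (svalP (iter k f _)).
  by have [] := fP (iter k f (exist _ U0 FU0)).
have [_] := fP (iter m f (exist _ U0 FU0)); apply.
by have := mP m.+1 (leqnSn m); rewrite /G /= => ->.
Qed.

Lemma artinian_inj K M (i : {linear K -> M}) : injective i ->
  artinian_module M -> artinian_module K.
Proof.
move=> ii aM U US Ud.
have [k|k y [x Ux <-]|m mP] := aM (fun k => [set y | exists2 x, U k x & i x = y]).
- exact: submodule_image.
- by exists x => //; apply: Ud.
exists m => k mk; have e := mP k mk; apply/seteqP; split=> x Ux.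
  have : [set y | exists2 x, U k x & i x = y] (i x) by exists x.
  by rewrite e => -[y Uy /ii <-].
have : [set y | exists2 x, U m x & i x = y] (i x) by exists x.
by rewrite -e => -[y Uy /ii <-].
Qed.

Lemma artinian_surj M N (p : {linear M -> N}) : surjective p ->
  artinian_module M -> artinian_module N.
Proof.
move=> ps aM U US Ud.
have [k|k x /= Ux|m mP] := aM (fun k => [set x | U k (p x)]).
- exact: submodule_preim.
- exact: Ud.
exists m => k mk; have e := mP k mk; apply/seteqP; split=> x; have [y <-] := ps x => Ux.
  have : [set x | U k (p x)] y by [].
  by rewrite e.
have : [set x | U m (p x)] y by [].
by rewrite -e.
Qed.

(** For an ideal [m]: the ring [R] modulo [m] is a field, or zero. *)
Definition inverts_outside (m : set R) := forall r, ~ m r -> exists s, m (1 - s * r).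

Lemma sequence_outside_span N : ~ finitely_generated N ->
  exists x : nat -> N, forall k (c : nat -> R), x k <> \sum_(j < k) c j *: x j.
Proof.
move=> nfg.
have next (s : seq N) : exists y, forall c : nat -> R,
    y <> \sum_(j < size s) c j *: nth 0 s j.
  apply: contrapT => h; apply: nfg; exists (size s), (fun j => nth 0 s j) => y.
  apply: contrapT => hy; apply: h; exists y => c yE; apply: hy.
  by exists (fun j => c j).
have [f fP] := choice next.
pose xs k := iter k (fun s => rcons s (f s)) [::].
have size_xs k : size (xs k) = k by elim: k => //= k IH; rewrite size_rcons IH.
have nth_xs k j : (j < k)%N -> nth 0 (xs k) j = f (xs j).
  elim: k => // k IH; rewrite ltnS leq_eqVlt /= nth_rcons size_xs.
  by case/predU1P => [->|jk]; rewrite ?ltnn ?eqxx // jk IH.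
exists (fun k => f (xs k)) => k c h; apply: (fP (xs k) c); rewrite h size_xs.
by apply: eq_bigr => j _; rewrite nth_xs.
Qed.

(** The argument for artinian vector spaces over the residue field. Given a sequence with no term in
    the span of the earlier ones, the spans [U k] of its tails descend; once they are stationary, x
    k is a combination of later terms, and solving for the last of them is a contradiction. *)
Lemma artinian_fg_killed N (m : set R) : submodule (m : set R^o) ->
  inverts_outside m -> (forall r (x : N), m r -> r *: x = 0) ->
  artinian_module N -> finitely_generated N.
Proof.
move=> mS minv mN aN; apply: contrapT => /sequence_outside_span [x xP].
pose U k : set N := [set y | exists d (c : nat -> R), y = \sum_(j < d) c j *: x (k + j)%N].
have US k : submodule (U k).
  have UZ a y : U k y -> U k (a *: y).
    case=> d [c ->]; exists d, (fun j => a * c j); rewrite scaler_sumr.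
    by apply: eq_bigr => j _; rewrite scalerA.
  have pad d d' (c : nat -> R) : (d <= d')%N ->
    \sum_(j < d) c j *: x (k + j)%N
      = \sum_(j < d') (if (j < d)%N then c j else 0) *: x (k + j)%N.
    move=> dd; rewrite (big_ord_widen _ (fun j => c j *: x (k + j)%N) dd).
    by rewrite big_mkcond; apply: eq_bigr => j _; case: ifP; rewrite ?scale0r.
  split=> //; first by exists 0%N, (fun=> 0); rewrite big_ord0.
  move=> _ _ [d [c ->]] [d' [c' ->]].
  rewrite (pad d (maxn d d')) ?leq_maxl // (pad d' (maxn d d')) ?leq_maxr //.
  exists (maxn d d'), (fun j => (if (j < d)%N then c j else 0)
    + (if (j < d')%N then c' j else 0)).
  by rewrite -big_split; apply: eq_bigr => j _; rewrite scalerDl.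
have [|k _ [d [c ->]]|k kP] := aN U => //.
  exists d.+1, (fun j => if j is j'.+1 then c j' else 0).
  rewrite big_ord_recl /= scale0r add0r; apply: eq_bigr => j _.
  by rewrite /bump /= add1n addnS.
have : U k (x k) by exists 1%N, (fun=> 1); rewrite big_ord1 scale1r addn0.
rewrite -(kP k.+1 (leqnSn k)) => -[d [c]].
(* A last coefficient in [m] acts as zero and is dropped; one outside [m] has an inverse [s] modulo
   [m]. *)
elim: d c => [|d IH] c; first by rewrite big_ord0 => xk; apply: (xP k (fun=> 0));
  rewrite xk big1 // => j _; rewrite scale0r.
rewrite big_ord_recr /=; have [mc|/minv [s ms]] := pselect (m (c d)).
  by rewrite (mN _ _ mc) addr0; apply: IH.
(* Solved for the last term: x (k+1+d) = s x k - sum of s c_j x (k+1+j) over j < d; indices below k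
   get coefficient 0. *)
move=> xk; apply: (xP (k.+1 + d)%N (fun j => if (j == k)%N then s
   else if (k < j)%N then - (s * c (j - k.+1)%N) else 0)).
have -> : x (k.+1 + d)%N = s *: (c d *: x (k.+1 + d)%N).
  by apply/eqP; rewrite -subr_eq0 scalerA -[X in X - _]scale1r -scalerBl mN.
have -> : c d *: x (k.+1 + d)%N = x k - \sum_(j < d) c j *: x (k.+1 + j)%N.
  by rewrite xk [X in X - _]addrC addrK.
rewrite scalerBr scaler_sumr.
rewrite -(big_mkord xpredT (fun j => (if j == k then s
   else if (k < j)%N then - (s * c (j - k.+1)%N) else 0) *: x j)).
rewrite (big_cat_nat (n := k.+1)) ?leq_addr //= big_nat_recr //= eqxx.
rewrite big_nat_cond [X in _ = X + _ + _]big1 ?add0r; last first.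
  move=> j; rewrite andbT => /andP [_ jk]; by rewrite (ltn_eqF jk) ltnNge (ltnW jk) scale0r.
congr (_ + _).
rewrite -[X in \sum_(X <= _ < _) _]add0n big_addn addKn big_mkord -sumrN.
apply: eq_bigr => j _; rewrite -scaleNr; have kj : (k < j + k.+1)%N by rewrite addnS ltnS leq_addl.
by rewrite (gtn_eqF kj) kj addnK scalerA mulNr addnC.
Qed.

Section Ideals.
Definition ideal_prod (I J : set R) : set R :=
  [set r | forall V : set R^o, submodule V -> (forall a b, I a -> J b -> V (a * b)) -> V r].

Lemma submodule_ideal_prod I J : submodule (ideal_prod I J : set R^o).
Proof.
split=> [V [V0 _ _] _|x y Ix Iy V VS h|a x Ix V VS h] //.
  by case: (VS) => _ VD _; apply: VD; [apply: Ix|apply: Iy].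
by case: (VS) => _ _ VZ; apply: VZ; apply: Ix.
Qed.

Definition fg_if_killed (I : set R) := submodule (I : set R^o) /\
  forall N, artinian_module N -> (forall r (x : N), I r -> r *: x = 0) ->
    finitely_generated N.

(** [N] is an extension of N/JN, which [J] kills, by JN, which [I] kills; [U] below is JN. *)
Lemma fg_if_killed_prod I J : fg_if_killed I -> fg_if_killed J ->
  fg_if_killed (ideal_prod I J).
Proof.
move=> [IS Ifg] [JS Jfg]; split=> [|N aN kN]; first exact: submodule_ideal_prod.
pose U : set N := [set x | forall V : set N, submodule V ->
   (forall b y, J b -> V (b *: y)) -> V x].
have US : submodule U.
  split=> [V [V0 _ _] _|x y Ix Iy V VS h|a x Ix V VS h] //.
    by case: (VS) => _ VD _; apply: VD; [apply: Ix|apply: Iy].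
  by case: (VS) => _ _ VZ; apply: VZ; apply: Ix.
have [K [Q [i [q [s iU qU]]]]] := sub_ses US; have [ii _ qs] := s.
apply: (@fg_ext R K N Q); first by exists i, q.
  apply: Ifg => [|a k Ia]; first exact: artinian_inj ii aN.
  apply: ii; rewrite linear0 linearZ /=.
  have : U (i k) by apply/iU; exists k.
  apply: (_ : _ -> [set x | a *: x = 0] (i k)); apply.
    split=> [|x y /= ax ay|b x /= ax] /=; first by rewrite scaler0.
      by rewrite scalerDr ax ay addr0.
    by rewrite scalerA mulrC -scalerA ax scaler0.
  by move=> b y Jb /=; rewrite scalerA; apply: kN => V VS; apply.
apply: Jfg => [|b z Jb]; first exact: artinian_surj qs aN.
have [y <-] := qs z; rewrite -linearZ; apply/(qU (b *: y)) => V VS; exact.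
Qed.

End Ideals.

(** A nonzero element of a minimal nonzero submodule of R x spans a simple module, whose annihilator
    is a maximal ideal. *)
Lemma minimal_cyclic M (x : M) : artinian_module R^o -> x <> 0 ->
  exists2 r : R, r *: x <> 0 & inverts_outside [set s | s *: (r *: x) = 0].
Proof.
move=> aR xn0.
have [K [_ [i [_ [[ii _ _] iU _]]]]] := sub_ses (submodule_cyclic x).
have [g gE] : exists g : {linear R^o -> M}, forall r : R, g r = r *: x.
  by apply: linear_exists => a b c; rewrite scalerDl scalerA.
have [h hE] : exists h : {linear R^o -> K}, forall r, i (h r) = g r.
  by apply: inj_lift => // r; apply/iU; exists r; rewrite gE.
have hs : surjective h.
  move=> y; have /iU [r rE] : exists k, i k = i y by exists y.
  by exists r; apply: ii; rewrite hE gE.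
have aK := artinian_surj hs aR.
have [|U [US [v Uv vn0]] Umin] :=
  @artinian_min K (fun U => submodule U /\ exists2 v, U v & v <> 0) aK (fun _ => @proj1 _ _).
  exists setT; split; first exact: submodule_full.
  exists (h 1) => // h1; apply: xn0.
  by rewrite -[x]scale1r -gE -hE h1 linear0.
have [r rE] := hs v; have ivE : i v = r *: x by rewrite -rE hE gE.
exists r; first by rewrite -ivE => iv0; apply: vn0; apply: ii; rewrite linear0.
move=> s /=; rewrite -ivE -linearZ => sv0.
have [||t tE] := Umin [set y | exists a, a *: (s *: v) = y] _ _ v Uv.
- split; first exact: submodule_cyclic.
  exists (s *: v); first by exists 1; rewrite scale1r.
  by move=> e; apply: sv0; rewrite e linear0.
- by move=> y [a <-]; case: US => _ _ UZ; apply: (UZ); exact: UZ.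
by exists t; rewrite -linearZ scalerBl scale1r -scalerA tE subrr linear0.
Qed.

Lemma submodule_ann M (x : M) : submodule ([set s | s *: x = 0] : set R^o).
Proof.
split=> [|a b /= ax bx|a b /= bx] /=; first by rewrite scale0r.
  by rewrite scalerDl ax bx addr0.
by rewrite -scalerA bx scaler0.
Qed.

Lemma fg_if_killed_ann M (x : M) : inverts_outside [set s | s *: x = 0] ->
  fg_if_killed [set s | s *: x = 0].
Proof.
move=> inv; split=> [|N aN kN]; first exact: submodule_ann.
exact: artinian_fg_killed (submodule_ann x) inv kN aN.
Qed.

(* Hopkins' theorem: a minimal ideal [I] such that artinian modules killed by
   [I] are finitely generated is idempotent and contained in all annihilators of
   simple modules, which forces [I = 0]. *)
Theorem artinian_noetherian : artinian_module R^o -> @noetherian_ring R.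
Proof.
move=> aR K i ii.
have [||I FI Imin] := @artinian_min R^o fg_if_killed aR _ _.
- by move=> U [].
- exists setT; split=> [|N aN kN]; first exact: submodule_full.
  by apply: fg_zero => x; rewrite -[x]scale1r; apply: kN.
have [IS If] := FI; have [I0 _ IZ] := IS.
have Iprod J : fg_if_killed J -> I `<=` ideal_prod I J.
  move=> FJ; apply: Imin; first exact: fg_if_killed_prod.
  by move=> r; apply=> // a b Ia _; rewrite mulrC; apply: IZ.
apply: If => [|r x Ir]; first exact: artinian_inj ii aR.
suff -> : r = 0 by rewrite scale0r.
apply: contrapT => rn0.
have [||J [JS [u [a [Ju Ia uan0]]]] Jmin] := @artinian_min R^o
  (fun J => submodule J /\ exists u a : R, [/\ J u, I a & u * a <> 0]) aR _ _.
- by move=> U [].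
- exists setT; split; first exact: submodule_full.
  by exists 1, r; rewrite mul1r.
(* The ideal u I belongs to the family that [J] minimizes: u I I = 0 would give u I = 0, because [I]
   is contained in I I. Hence [J] is contained in u I, and u = u y. *)
have [y Iy uyE] : exists2 y, I y & u * y = u.
  have JI : J `<=` [set z | exists2 b, I b & u * b = z].
    apply: Jmin; last first.
      by move=> _ [b _ <-]; case: JS => _ _ JZ; rewrite mulrC; apply: JZ.
    split.
      split=> [|_ _ [b Ib <-] [c Ic <-]|d _ [b Ib <-]].
      - by exists 0; rewrite ?mulr0.
      - by exists (b + c); [case: IS => _ ID _; apply: ID|rewrite mulrDr].
      - by exists (d * b); [apply: IZ|rewrite mulrCA].
    apply: contrapT => h; apply: uan0.
    have := Iprod I FI a Ia [set c | c *: (u : R^o) = 0] (submodule_ann (u : R^o)).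
    rewrite /= mulrC; apply=> b c Ib Ic; apply: contrapT => hbc.
    apply: h; exists (u * b), c; split=> //; first by exists b.
    rewrite -mulrA mulrC; exact: hbc.
  by have [y Iy uyE] := JI u Ju; exists y.
have un0 : (u : R^o) <> 0 by move=> e; apply: uan0; rewrite e mul0r.
(* As s u spans a simple module, [y] lies in [I] times the annihilator of s u and kills s u; but u y
   = u. *)
have [s su inv] := minimal_cyclic aR un0.
have : ideal_prod I [set t | t *: (s *: (u : R^o)) = 0] y.
  by apply: (Iprod _ (fg_if_killed_ann inv)).
move=> /(_ [set t | t *: (s *: (u : R^o)) = 0] (submodule_ann _)) h.
have : y *: (s *: (u : R^o)) = 0.
  by apply: h => b c Ib /= hc; rewrite -scalerA hc scaler0.
move=> h0; apply: su; rewrite -h0 scalerA mulrC -scalerA; congr (_ *: _).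
by rewrite /GRing.scale /= mulrC uyE.
Qed.

End Artinian.

(** * Restriction of scalars and the dual Hom_R(A, J) *)

Section RestrictionOfScalars.
Context {R : comNzRingType} {A : algType R}.

Section Restrict.
Variable X : lmodType A.
(** An alias, so that the R-structure can be attached beside the A-structure. *)
Definition restrict : Type := X.
HB.instance Definition _ := GRing.Zmodule.on restrict.
Definition restrict_scale (r : R) (x : restrict) : restrict := (r%:A : A) *: (x : X).
Fact restrict_scaleA r s x :
  restrict_scale r (restrict_scale s x) = restrict_scale (r * s) x.
Proof. by rewrite /restrict_scale scalerA -scalerAl mul1r scalerA. Qed.
Fact restrict_scale1 : left_id 1 restrict_scale.
Proof. by move=> x; rewrite /restrict_scale scale1r scale1r. Qed.
Fact restrict_scaleDr : right_distributive restrict_scale +%R.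
Proof. by move=> r x y; rewrite /restrict_scale scalerDr. Qed.
Fact restrict_scaleDl x : {morph restrict_scale^~ x : r s / r + s}.
Proof. by move=> r s; rewrite /restrict_scale !scalerDl. Qed.
HB.instance Definition _ := GRing.Zmodule_isLmodule.Build R restrict
  restrict_scaleA restrict_scale1 restrict_scaleDr restrict_scaleDl.
End Restrict.

Lemma restrict_scaleE (X : lmodType A) (r : R) (x : restrict X) :
  r *: x = (r%:A : A) *: (x : X) :> X.
Proof. by []. Qed.

Lemma restrict_linear (X Y : lmodType A) (f : {linear X -> Y}) :
  exists g : {linear restrict X -> restrict Y}, forall x, g x = f x.
Proof.
by apply: linear_exists => r x y; rewrite restrict_scaleE linearP.
Qed.

Lemma restrict_fg (X : lmodType A) : @finitely_generated R A ->
  finitely_generated X -> finitely_generated (restrict X).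
Proof.
case=> k [v vP] [m [w wP]].
apply: (@fg_index _ _ ('I_m * 'I_k)%type (fun j => v j.2 *: w j.1 : restrict X)) => x.
have [c cE] := wP x; have [d dE] := choice (fun j => vP (c j)).
exists (fun j => d j.1 j.2).
rewrite -(pair_bigA _ (fun a b => d a b *: (v b *: w a : restrict X))) /=.
rewrite [LHS]cE; apply: eq_bigr => j _; rewrite {1}dE scaler_suml.
by apply: eq_bigr => l _; rewrite restrict_scaleE scalerA -scalerAl mul1r.
Qed.

Section Dual.
Variable J : lmodType R.
Local Notation D := (dual_module A J).

Lemma dual_fun_linear (f : D) (r : R) (a b : A) :
  dual_fun f (r *: a + b) = r *: dual_fun f a + dual_fun f b.
Proof. by have /asboolP := dual_linear f; apply. Qed.

Lemma dual_funZ (f : D) (r : R) (a : A) : dual_fun f (r *: a) = r *: dual_fun f a.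
Proof.
have f0 : dual_fun f 0 = 0.
  by apply: (addrI (dual_fun f 0)); rewrite -{1}[dual_fun f 0]scale1r -dual_fun_linear scaler0 !addr0.
by rewrite -[r *: a]addr0 dual_fun_linear f0 addr0.
Qed.

Lemma dual_funE (a : A) (f : D) x : dual_fun (a *: f) x = dual_fun f (x * a).
Proof. by []. Qed.

Lemma dual_funD (f g : D) x : dual_fun (f + g) x = dual_fun f x + dual_fun g x.
Proof. by []. Qed.

Lemma dual_ext (f g : D) : (forall x, dual_fun f x = dual_fun g x) -> f = g.
Proof. by move=> h; apply/val_inj/funext. Qed.

(** One direction of the adjunction Hom_A(X, Hom_R(A, J)) = Hom_R(X, J); the other,
    [linear_of_dual], is evaluation at 1. *)
Lemma dual_of_linear (X : lmodType A) (phi : {linear restrict X -> J}) :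
  exists h : {linear X -> D}, forall x a, dual_fun (h x) a = phi (a *: x).
Proof.
have lin x : (fun a : A => phi (a *: (x : X))) \in linear_pred (J := J).
  apply/asboolP => r a b; rewrite -linearP; congr (phi _).
  by rewrite restrict_scaleE scalerDl scalerA -scalerAl mul1r.
have [|h hE] := @linear_exists _ X D (fun x => DualModule (lin x)).
  move=> a x y; apply: dual_ext => b; rewrite dual_funD dual_funE /=.
  by rewrite scalerDr linearD scalerA.
by exists h => x a; rewrite hE.
Qed.

Lemma linear_of_dual (X : lmodType A) (h : {linear X -> D}) :
  exists phi : {linear restrict X -> J}, forall x, phi x = dual_fun (h x) 1.
Proof.
apply: linear_exists => r x y.
rewrite restrict_scaleE linearP dual_funD dual_funE mul1r.
by rewrite dual_funZ.
Qed.

Lemma dual_injective : injective_module J -> injective_module D.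
Proof.
move=> Ji X Y g f gi.
have [phi phiE] := linear_of_dual f; have [g' g'E] := restrict_linear g.
have g'i : injective g' by move=> x y; rewrite !g'E; apply: gi.
have [psi psiE] := Ji _ _ g' phi g'i; have [h hE] := dual_of_linear psi.
exists h => x; apply: dual_ext => a.
by rewrite hE -linearZ -g'E -psiE phiE linearZ dual_funE mul1r.
Qed.

(** [J] is known only as an envelope of R / rad R, so a copy of the simple module R z must be found
    inside R / rad R; injectivity of [J] then extends the embedding to [M]. *)
Lemma injective_hits_minimal_cyclic (M : lmodType R) (z : M) :
  artinian_module R^o -> dualizing_module J -> z <> 0 ->
  inverts_outside [set s | s *: z = 0] ->
  exists phi : {linear M -> J}, phi z <> 0.
Proof.
move=> aR [K [[p [ps pker]] [Ji [j [jinj _]]]]] zn0 inv.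
pose m : set R^o := [set s | s *: z = 0]; have mS : submodule m := submodule_ann z.
have m1 : ~ m 1 by rewrite /m /= scale1r.
have mM : maximal_submodule m.
  split=> // [mT|V VS mV]; first by apply: m1; rewrite mT.
  have [Vm|/existsNP [r /not_implyP [Vr mr]]] := pselect (V `<=` m).
    by left; apply/seteqP.
  right; apply: full_submodule => x; have [s ms] := inv _ mr.
  case: (VS) => _ VD VZ.
  have V1 : V 1 by rewrite -(subrK (s * r) 1); apply: VD; [apply: mV|apply: VZ].
  by rewrite -[x]mulr1; apply: VZ.
have mprime a b : m (a * b) -> m a \/ m b.
  move=> mab; have [ma|/inv [s ms]] := pselect (m a); [by left|right].
  have e : b = b * (1 - s * a) + s * (a * b).
    by rewrite mulrBr mulr1 [b * (s * a)]mulrC -mulrA subrK.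
  by rewrite /m /= e scalerDl -(scalerA b) -(scalerA s) ms mab !scaler0 addr0.
(* For [I] minimal among the ideals not contained in [m], every maximal ideal other than [m]
   contains [I]: its intersection with [I] is not inside the prime ideal [m]. So m w lies in the
   radical, although [w] does not. *)
have [|I [IS /existsNP [w /not_implyP [Iw mw]]] Imin] :=
  @artinian_min R R^o (fun I => submodule I /\ ~ I `<=` m) aR (fun _ => @proj1 _ _).
  exists setT; split; first exact: submodule_full.
  by move=> h; apply/m1/h.
have rad_w : ~ radical (w : R^o) by move=> /(_ m mM).
have rad_mw r : m r -> radical (r * w : R^o).
  move=> mr U UM; have [US _ Umax] := UM; case: (US) => _ _ UZ.
  have [Um|/existsNP [b /not_implyP [Ub mb]]] := pselect (U `<=` m).
    have [<-|mT] := Umax m mS Um; last by case: m1; rewrite mT.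
    by rewrite mulrC; case: mS => _ _; apply.
  apply: (UZ r w); have : I `<=` [set x | I x /\ U x].
    apply: Imin; last by move=> x [].
    split; first exact: submodule_setI.
    move=> /(_ (w * b)) h; have /h : I (w * b) /\ U (w * b).
      by split; [case: IS => _ _ IZ; rewrite mulrC; apply: IZ|apply: UZ].
    by case/mprime.
  by move=> /(_ w Iw) [].
have [L [_ [i [_ [[ii _ _] iU _]]]]] := sub_ses (submodule_cyclic z).
have [q0 q0E] : exists q0 : {linear R^o -> M}, forall r : R, q0 r = r *: z.
  by apply: linear_exists => a b c; rewrite scalerDl scalerA.
have [q qE] : exists q : {linear R^o -> L}, forall r, i (q r) = q0 r.
  by apply: inj_lift => // r; apply/iU; exists r; rewrite q0E.
have qs : surjective q.
  move=> y; have /iU [r rE] : exists k, i k = i y by exists y.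
  by exists r; apply: ii; rewrite qE q0E.
(* The class of r w in R / rad R vanishes for r in [m] but not for r = 1, so this map factors
   through R z. *)
have [f fE] : exists f : {linear R^o -> J}, forall r : R, f r = j (p (r * w)).
  by apply: linear_exists => a b c; rewrite mulrDl -mulrA !linearD -!linearZ.
have [|g gE] := surj_factor (f := f) qs.
  move=> r qr; rewrite fE; have mr : m r by rewrite /m /= -q0E -qE qr linear0.
  by rewrite (iffRL (pker _) (rad_mw _ mr)) linear0.
have [phi phiE] := Ji _ _ i g ii; exists phi.
have -> : z = i (q 1) by rewrite qE q0E scale1r.
rewrite -phiE gE fE mul1r -(linear0 j) => /jinj /pker; exact: rad_w.
Qed.

Lemma dual_cogenerates (X : lmodType A) (x : X) :
  artinian_module R^o -> dualizing_module J -> x <> 0 ->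
  exists h : {linear X -> D}, h x <> 0.
Proof.
move=> aR dJ xn0; have [r rx inv] := minimal_cyclic (M := restrict X) aR xn0.
have [phi phiE] := injective_hits_minimal_cyclic aR dJ rx inv.
have [h hE] := dual_of_linear phi; exists h => hx0; apply: phiE.
by rewrite -[RHS]/(dual_fun (0 : D) r%:A) -hx0 hE.
Qed.

(** A map to a power of D with minimal kernel is injective: a nonzero element of the kernel is
    detected by one more coordinate. *)
Lemma dual_embedding (X : lmodType A) l : artinian_module R^o ->
  dualizing_module J -> flen l X ->
  exists m (i : {linear X -> {ffun 'I_m -> D}}), injective i.
Proof.
move=> aR dJ fX.
have [||U [m [i iU]] Umin] := @min_submodule A l X
  (fun U => exists m (i : {linear X -> {ffun 'I_m -> D}}), U = [set x | i x = 0]) fX.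
- by move=> _ [m [i ->]]; apply: submodule_ker.
  have [z _] := @zero_linear_exists A X {ffun 'I_0 -> D}.
  by exists [set x | z x = 0], 0%N, z.
exists m, i; apply: linear_inj => x ix; apply: contrapT => xn0.
have [h hx] := dual_cogenerates aR dJ xn0.
have [k kE] : exists k : {linear X -> {ffun 'I_m.+1 -> D}}, forall x j,
    k x j = if unlift ord0 j is Some l then i x l else h x.
  have [|k kE] := @linear_exists _ X {ffun 'I_m.+1 -> D}
    (fun x => [ffun j => if unlift ord0 j is Some l then i x l else h x]).
    move=> a y z; apply/ffunP => j; rewrite !ffunE.
    by case: unlift => [q|]; rewrite linearP // !ffunE.
  by exists k => y j; rewrite kE ffunE.
have kx : k x = 0.
  apply: (Umin [set x | k x = 0]); first by exists m.+1, k.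
    move=> y /= ky; rewrite iU; apply/ffunP => j.
    by have := kE y (lift ord0 j); rewrite liftK ky !ffunE.
  by rewrite iU.
by apply: hx; have := kE x ord0; rewrite unlift_none kx ffunE.
Qed.

End Dual.

(** Evaluation on generators of [X] embeds Hom_A(X, Y) into a power of [Y], a finitely generated
    module over the noetherian ring [R]. *)
Lemma Hom_fg (X Y : lmodType A) : artin_algebra A ->
  finitely_generated X -> finitely_generated Y ->
  exists p (g : 'I_p -> {linear X -> Y}), forall h : {linear X -> Y},
    exists c : 'I_p -> R, forall x, h x = \sum_j (c j)%:A *: g j x.
Proof.
move=> [aR Afg] [m [v vP]] Yfg; have nR := artinian_noetherian aR.
have Yr := fg_pow m (restrict_fg Afg Yfg).
pose H : set {ffun 'I_m -> restrict Y} :=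
  [set f | exists h : {linear X -> Y}, forall j, f j = h (v j)].
have HS : submodule H.
  split=> [|f g [h hE] [k kE]|r f [h hE]].
  - have [z zE] := zero_linear_exists X Y; exists z => j.
    by rewrite zE ffunE.
  - by have [l lE] := add_linear_exists h k; exists l => j; rewrite ffunE lE hE kE.
  - have [|l lE] := @linear_exists _ X Y (fun x => r%:A *: h x).
      move=> a x y; rewrite linearP scalerDr !scalerA; congr (_ *: _ + _).
      by rewrite -scalerAl mul1r -scalerAr mulr1.
    by exists l => j; rewrite ffunE lE hE.
have [K [_ [i [_ [[ii _ _] iU _]]]]] := sub_ses HS.
have [p [w wP]] := fg_sub nR Yr ii.
have gP j : exists g : {linear X -> Y}, forall l, i (w j) l = g (v l).
  by have : H (i (w j)) by apply/iU; exists (w j).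
have [g gE] := choice gP; exists p, g => h.
have [k kE] : exists k, i k = [ffun l => h (v l) : restrict Y].
  by apply/iU; exists h => l; rewrite ffunE.
have [c cE] := wP k; exists c => x; have [d ->] := vP x.
rewrite linear_sum.
have hv l : h (v l) = \sum_j (c j)%:A *: g j (v l).
  have -> : h (v l) = i k l by rewrite kE ffunE.
  rewrite cE linear_sum sum_ffunE; apply: eq_bigr => j _.
  by rewrite linearZ ffunE -gE.
under eq_bigr => l _ do rewrite linearZ /= hv scaler_sumr.
rewrite exchange_big; apply: eq_bigr => j _ /=.
rewrite linear_sum scaler_sumr; apply: eq_bigr => l _.
by rewrite linearZ /= !scalerA -scalerAl mul1r -scalerAr mulr1.
Qed.

End RestrictionOfScalars.

Lemma linZ (B : nzRingType) (M N : lmodType B) (f : {linear M -> N}) a x :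
  f (a *: x) = a *: f x.
Proof. exact: linearZ. Qed.

Lemma flen_surj_inj (B : nzRingType) (M : lmodType B) (f : {linear M -> M}) a :
  flen a M -> surjective f -> injective f.
Proof.
move=> fM fs; have [K [k s]] := ker_ses fs.
suff K0 : zero_module K.
  by apply: linear_inj => x /(ses_ker s) [y <-]; rewrite (K0 y) linear0.
apply: contrapT => Kn0; elim: a fM => [M0|a IH fM].
  by apply: Kn0; case: s => ki _ _; apply: zero_module_inj ki M0.
by apply: IH; apply: flen_quot_strict Kn0 fM; exists k, f.
Qed.

Lemma linear_bijective (B : nzRingType) (M N : lmodType B) (f : {linear M -> N}) :
  injective f -> surjective f -> bijective f.
Proof.
move=> fi fs; have [g gE] := choice fs; exists g => x; last exact: gE.
by apply: fi; rewrite gE.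
Qed.

(** * Primitive idempotents and Fitting's lemma *)

Section PrimitiveIdempotent.
Context {B : nzRingType}.
Hypothesis fB : exists a, flen a (B^o : lmodType B).

Lemma submodule_annr (c : B) : submodule ([set x | x * c = 0] : set B^o).
Proof.
split=> [|x y /= xc yc|a x /= xc] /=; first by rewrite mul0r.
  by rewrite mulrDl xc yc addr0.
by rewrite -mulrA xc mulr0.
Qed.

Lemma submodule_mulr (c : B) : submodule ([set x | exists y, y * c = x] : set B^o).
Proof.
split=> [|_ _ [y <-] [z <-]|a _ [y <-]] /=; first by exists 0; rewrite mul0r.
  by exists (y + z); rewrite mulrDl.
by exists (a * y); rewrite -mulrA.
Qed.

(** Fitting's lemma for right multiplication by [w]: the annihilators of the powers increase, the
    left ideals B w^k decrease, and [M] exceeds the exponents [k] and [l] from which the two chains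
    are stationary. *)
Lemma power_stabilizes (w : B) : exists M, [/\ (0 < M)%N,
  exists y, w ^+ M = y * (w ^+ M * w ^+ M) &
  forall x, x * (w ^+ M * w ^+ M) = 0 -> x * w ^+ M = 0].
Proof.
have [a fa] := fB.
have [||_ [k ->] kmax] := @max_submodule B a B^o
  (fun U => exists k, U = [set x | x * w ^+ k = 0]) fa.
- by move=> _ [k ->]; apply: submodule_annr.
- by exists [set x | x * w ^+ 0 = 0], 0%N.
have [||_ [l ->] lmin] := @min_submodule B a B^o
  (fun U => exists k, U = [set x | exists y, y * w ^+ k = x]) fa.
- by move=> _ [l ->]; apply: submodule_mulr.
- by exists [set x | exists y, y * w ^+ 0 = x], 0%N.
pose M := (k + l).+1; exists M; rewrite -exprD; split=> // [|x xM].
  have [|||y yE] := lmin [set x | exists y, y * w ^+ (M + M) = x] _ _ (w ^+ M).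
  - by exists (M + M)%N.
  - move=> _ [y <-]; exists (y * w ^+ (M + M - l)).
    by rewrite -mulrA -exprD subnK // /M; lia.
  - exists (w ^+ (M - l)); rewrite -exprD subnK // /M; lia.
  by exists y.
have : x * w ^+ k = 0.
  apply: (kmax [set x | x * w ^+ (M + M) = 0]) => //; first by exists (M + M)%N.
  move=> z /= zk; have -> : (M + M = k + (M + M - k))%N by rewrite subnKC // /M; lia.
  by rewrite exprD mulrA zk mul0r.
have -> : M = (k + (M - k))%N by rewrite subnKC // /M; lia.
by move=> xk; rewrite exprD mulrA xk mul0r.
Qed.

(** With c = w^M and c = y c c, the elements b = u y c and u - b are orthogonal idempotents with sum
    [u]. If u = b, then [u] lies in B w; if b = 0, then c = b c = 0. *)
Lemma primitive_nilpotent (u w : B) : primitive_idempotent u ->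
  u * w = w -> w * u = w -> (forall y, y * w <> u) -> exists M, w ^+ M = 0.
Proof.
move=> [_ uu uprim] uw wu nw; have [M [M0 [y yE] Minj]] := power_stabilizes w.
set c := w ^+ M in yE Minj; exists M; rewrite -/c.
have uc : u * c = c by rewrite /c -(prednK M0) exprS mulrA uw.
have cu : c * u = c by rewrite /c -(prednK M0) exprSr -mulrA wu.
pose b := u * y * c; pose a := u - b.
have bc : b * c = c by rewrite /b -!mulrA -yE uc.
have ac : a * c = 0 by rewrite /a mulrBl uc bc subrr.
have bu : b * u = b by rewrite /b -mulrA cu.
have au : a * u = a by rewrite /a mulrBl uu bu.
have kill x : x * c * c = 0 -> x * c = 0 by rewrite -mulrA; apply: Minj.
have ab : a * b = 0.
  have e1 : a * (u * y) * c * c = a * (b * c) by rewrite /b !mulrA.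
  by rewrite /b mulrA; apply: kill; rewrite e1 bc ac.
have aa : a * a = a by rewrite {2}/a mulrBr au ab subr0.
have ba : b * a = 0.
  have -> : b * a = (u * y - b * (u * y)) * c.
    by rewrite /a mulrBr bu mulrBl /b !mulrA.
  have e2 : (u * y - b * (u * y)) * c * c = b * c - b * (b * c).
    by rewrite !mulrBl /b !mulrA.
  by apply: kill; rewrite e2 !bc subrr.
have bb : b * b = b by rewrite -[LHS]addr0 -ba -mulrDr /a addrC subrK bu.
have [|a0|b0] := uprim a b aa bb ab ba; first by rewrite /a subrK.
  case: (nw (u * y * w ^+ M.-1)); rewrite -mulrA -exprSr (prednK M0) -/c -/b.
  by apply/esym/eqP; rewrite -subr_eq0 -/a a0.
by rewrite -uc -[u](subrK b) -/a b0 addr0 ac.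
Qed.

End PrimitiveIdempotent.

(** * Indecomposable projectives, their tops and multiplicities *)

Section Stratification.
Context {A : nzRingType} {n : nat} (e : 'I_n -> A).
Hypotheses (fA : exists a, flen a (A^o : lmodType A))
  (e_cpoi : complete_primitive_orthogonal_idempotents e) (e_basic : basic_algebra e).
Implicit Types (i j l : 'I_n) (X Y Z M N L S K Q W : lmodType A).

Lemma e_idem i : e i * e i = e i.
Proof. by have [/(_ i) []] := e_cpoi. Qed.

Lemma e_decomp X (x : X) : x = \sum_i e i *: x.
Proof. by have [_ _ h] := e_cpoi; rewrite -scaler_suml h scale1r. Qed.

Lemma e_idemZ i X (x : X) : e i *: (e i *: x) = e i *: x.
Proof. by rewrite scalerA e_idem. Qed.

(** For finite length this says that E(j) is no composition factor ([filtration_count0]);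
    idempotents replace composition series from here on. *)
Definition killed j X := forall x : X, e j *: x = 0.

Lemma killed_zero X : (forall j, killed j X) -> zero_module X.
Proof. by move=> h x; rewrite (e_decomp x) big1 // => i _; apply: h. Qed.

Lemma killed_sub j X Y (f : {linear X -> Y}) : injective f -> killed j Y -> killed j X.
Proof. by move=> fi h x; apply: fi; rewrite linZ h linear0. Qed.

Lemma killed_quot j X Y (f : {linear X -> Y}) : surjective f -> killed j X -> killed j Y.
Proof. by move=> fs h y; have [x <-] := fs y; rewrite -linZ h linear0. Qed.

Lemma killed_ext j L M N : mod_ses L M N -> killed j L -> killed j N -> killed j M.
Proof.
case=> f [g s] hL hN x.
have [y yE] : exists y, f y = e j *: x by apply: (ses_ker s); rewrite linZ hN.
by rewrite -e_idemZ -yE -linZ hL linear0.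
Qed.

Local Notation P := (indec_proj e).

Lemma proj_hom i X (x : X) : exists f : {linear P i -> X},
  forall p, f p = (principal_val p : A) *: x.
Proof.
have [|f fE] := @linear_exists _ (P i) X (fun p => (principal_val p : A) *: x).
  move=> a p q.
  have -> : principal_val (a *: p + q) = a * principal_val p + principal_val q :> A by [].
  by rewrite scalerDl scalerA.
by exists f.
Qed.

Fact gen_subproof i : (e i : A^o) \in principal_pred (e i).
Proof. by apply/asboolP; exists 1; rewrite mul1r. Qed.

Definition gen i : P i := PrincipalLeftIdeal (gen_subproof i).

Lemma principal_val_e i (p : P i) : principal_val p * e i = principal_val p :> A.
Proof.
by case: p => v /= /asboolP [a ->]; rewrite -mulrA e_idem.
Qed.

Lemma gen_span i (p : P i) : p = (principal_val p : A) *: gen i.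
Proof. by apply: val_inj; rewrite /= -[RHS]/(principal_val p * e i) principal_val_e. Qed.

Lemma e_gen i : e i *: gen i = gen i.
Proof. by rewrite [RHS]gen_span. Qed.

Lemma proj_hom_gen i X (x : X) : exists f : {linear P i -> X}, f (gen i) = e i *: x.
Proof. by have [f fE] := proj_hom i x; exists f; rewrite fE. Qed.

Lemma proj_retract i : exists (s : {linear P i -> A^o}) (r : {linear A^o -> P i}),
  (forall p, r (s p) = p) /\ r 1 = gen i.
Proof.
have [s sE] := proj_hom i (1 : A^o).
have [r rE] : exists r : {linear A^o -> P i}, forall a : A, r a = a *: gen i.
  by apply: linear_exists => a b c; rewrite scalerDl scalerA.
exists s, r; split=> [p|]; last by rewrite rE scale1r.
by rewrite rE sE [RHS]gen_span; congr (_ *: _); rewrite /GRing.scale /= mulr1.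
Qed.

Lemma regular_projective : projective (A^o : lmodType A).
Proof.
move=> X Y g f gs; have [x xE] := gs (f 1).
have [h hE] : exists h : {linear A^o -> X}, forall a : A, h a = a *: x.
  by apply: linear_exists => a b c; rewrite scalerDl scalerA.
exists h => a; rewrite hE linZ xE -linZ; congr (f _).
by rewrite /GRing.scale /= mulr1.
Qed.

Lemma indec_proj_projective i : projective (P i).
Proof.
by have [s [r [rs _]]] := proj_retract i; apply: retract_projective rs regular_projective.
Qed.

Lemma indec_proj_fg i : finitely_generated (P i).
Proof.
by exists 1%N, (fun=> gen i) => p; exists (fun=> principal_val p); rewrite big_ord1 -gen_span.
Qed.

Lemma fg_has_flen X : finitely_generated X -> exists m, flen m X.
Proof. exact: flen_fg. Qed.

(** The elements that do not generate P(i); that they form a submodule expresses that P(i) is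
    local. *)
Definition Rad i : set (P i) := [set p | forall a, a *: p <> gen i].
Arguments Rad : clear implicits.

(** If a (p + q) were the generator, the elements [v p] and [v q] of e_i A e_i would have sum e_i.
    As [p] is no generator, [v p] is nilpotent, so [v q] has a left inverse and [q] would be a
    generator. *)
Lemma submodule_Rad i : submodule (Rad i).
Proof.
have [/(_ i) prim _ _] := e_cpoi.
split=> [a|p q Rp Rq a|a p Rp b]; last by rewrite scalerA; apply: Rp.
  rewrite scaler0 => /(congr1 (@principal_val _ _)) /= e0.
  by case: prim => /eqP []; rewrite -e0.
rewrite scalerDr => h.
pose v (q : P i) := e i * (a * principal_val q).
have ev q' : e i * v q' = v q' by rewrite /v mulrA e_idem.
have ve q' : v q' * e i = v q' by rewrite /v -!mulrA principal_val_e.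
have vpq : v p + v q = e i.
  rewrite /v -mulrDr -[RHS]e_idem; congr (_ * _).
  exact: (congr1 (@principal_val _ _) h).
have vgen y q' : y * v q' = e i -> (y * e i * a) *: q' = gen i.
  move=> yE; rewrite [q']gen_span scalerA [RHS]gen_span; congr (_ *: _).
  by transitivity (y * v q'); [rewrite /v !mulrA|].
have [|M wM] := primitive_nilpotent fA prim (ev p) (ve p).
  by move=> y /vgen; apply: Rp.
(* The geometric sum s of the powers of [v p] satisfies s (e i - v p) = e i, since v p ^+ M = 0. *)
apply: (Rq (\sum_(k < M) v p ^+ k * e i * a)).
pose s := \sum_(k < M) v p ^+ k.
suff /vgen : s * v q = e i.
  by rewrite /s mulr_suml mulr_suml.
have sc : GRing.comm s (v p).
  by apply/commr_sym/commr_sum => k _; apply: commrX.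
have -> : v q = e i - v p by rewrite -vpq addrC addKr.
rewrite -{1}(mul1r (e i)) -{1}(ve p) -mulrBl mulrA mulrBr mulr1 sc -[s in s - _]mul1r -mulrBl.
have := subrX1 (v p) M; rewrite wM sub0r -/s => /(congr1 -%R).
by rewrite opprK -mulNr opprB => <-; rewrite mul1r.
Qed.

Lemma gen_notin_Rad i : ~ Rad i (gen i).
Proof. by move/(_ 1); rewrite scale1r; apply. Qed.

Lemma proper_sub_Rad i (U : set (P i)) : submodule U -> ~ U (gen i) -> U `<=` Rad i.
Proof. by case=> _ _ UZ Ug p Up a h; apply: Ug; rewrite -h; apply: UZ. Qed.

Lemma sub_full i (U : set (P i)) : submodule U -> U (gen i) -> forall p, U p.
Proof. by case=> _ _ UZ Ug p; rewrite (gen_span p); apply: UZ. Qed.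

Lemma radical_Rad i p : radical p <-> Rad i p.
Proof.
have RM : maximal_submodule (Rad i).
  split; [exact: submodule_Rad|by move=> h; apply: (@gen_notin_Rad i); rewrite h|].
  move=> V VS RV; have [Vg|Vg] := pselect (V (gen i)).
    by right; apply: full_submodule; apply: sub_full.
  by left; apply/seteqP; split=> //; apply: proper_sub_Rad.
split=> [/(_ _ RM)//|Rp U UM]; have [US UT Umax] := UM.
have [Ug|Ug] := pselect (U (gen i)).
  by case: UT; apply: full_submodule; apply: sub_full.
have [<- //|RT] := Umax _ (submodule_Rad i) (proper_sub_Rad US Ug).
by case: (@gen_notin_Rad i); rewrite RT.
Qed.

Lemma top_exists i : exists (S : lmodType A) (p : {linear P i -> S}),
  surjective p /\ forall x, p x = 0 <-> Rad i x.
Proof. exact: quot_exists (submodule_Rad i). Qed.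

Lemma simple_of_top i S (p : {linear P i -> S}) :
  surjective p -> (forall x, p x = 0 <-> Rad i x) -> simple_top e i S.
Proof.
move=> ps pR; split; last by exists p; split=> // x; rewrite pR -radical_Rad.
split=> [S0|U US]; first by apply: (@gen_notin_Rad i); apply/pR.
have US' := submodule_preim p US.
have [Ug|Ug] := pselect (U (p (gen i))).
  right; apply: full_submodule => y; have [x <-] := ps y; exact: (sub_full US' Ug x).
left; apply: zero_submodule US _ => y; have [x <-] := ps y => Ux.
exact/pR/(proper_sub_Rad US' Ug).
Qed.

Lemma simple_top_map i N (f : {linear P i -> N}) : simple N -> f (gen i) <> 0 ->
  surjective f /\ forall x, f x = 0 <-> Rad i x.
Proof.
move=> Ns fg; have [f0|fs] := simple_map f Ns; first by case: fg.
split=> // x; split; first exact: (proper_sub_Rad (submodule_ker f)).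
move=> Rx; apply: contrapT => fx.
have [_ /(_ _ (submodule_image f (submodule_Rad i))) [h|h]] := Ns.
  by apply: fx; apply: (eq_set0 h); exists x.
have [y Ry yE] := eq_setT (f (gen i)) h.
have Rg : Rad i (gen i - y).
  by apply: (proper_sub_Rad (submodule_ker f) fg); rewrite /= linearB yE subrr.
apply: (@gen_notin_Rad i); rewrite -(subrK y (gen i)).
by have [_ RD _] := submodule_Rad i; apply: RD.
Qed.

Lemma simple_topP i N : simple N ->
  simple_top e i N <-> exists x : N, e i *: x <> 0.
Proof.
move=> Ns; split=> [[_ [p [ps pR]]]|[x xn0]].
  exists (p (gen i)); rewrite -linZ e_gen => /pR /radical_Rad.
  exact: gen_notin_Rad.
have [f fE] := proj_hom_gen i x; rewrite -fE in xn0.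
by have [fs fR] := simple_top_map Ns xn0; apply: simple_of_top fs fR.
Qed.

(** Over a common top, projectivity gives maps between P(i) and P(j) in both directions, onto by
    locality and hence bijective by finite length; [A] is basic. *)
Lemma simple_top_inj i j N : simple_top e i N -> simple_top e j N -> i = j.
Proof.
move=> Ni Nj; have [Ns _] := Ni.
have /(simple_topP _ Ns) [x xn0] := Ni; have /(simple_topP _ Ns) [y yn0] := Nj.
have [f fE] := proj_hom_gen i x; have [g gE] := proj_hom_gen j y.
rewrite -fE in xn0; rewrite -gE in yn0.
have [fs fR] := simple_top_map Ns xn0; have [gs gR] := simple_top_map Ns yn0.
have [h hE] := indec_proj_projective f gs.
have [k kE] := indec_proj_projective g fs.
have onto a b (p : {linear P a -> P b}) : ~ Rad b (p (gen a)) -> surjective p.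
  move=> Rp z; apply: (sub_full (submodule_im p)); apply: contrapT => hp; apply: Rp.
  apply: (proper_sub_Rad (submodule_im p) hp); by exists (gen a).
have hs : surjective h by apply: onto => /gR; rewrite -hE.
have ks : surjective k by apply: onto => /fR; rewrite -kE.
apply: e_basic; exists h; apply: (linear_bijective _ hs).
have [a fa] := fg_has_flen (indec_proj_fg i).
have khs : surjective (k \o h).
  by move=> z; have [w <-] := ks z; have [v <-] := hs w; exists v.
have khi := flen_surj_inj fa khs.
by move=> z w zw; apply: khi; rewrite /= zw.
Qed.

Lemma simple_has_top N : simple N -> exists i, simple_top e i N.
Proof.
move=> Ns; have [Nn0 _] := Ns; apply: contrapT => h; apply: Nn0.
apply: killed_zero => j x; apply: contrapT => xn0; apply: h.
by exists j; apply/simple_topP => //; exists x.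
Qed.

Lemma simple_top_killed i j N : simple_top e i N -> j <> i -> killed j N.
Proof.
move=> Ni ji x; apply: contrapT => xn0; apply: ji.
by apply: (simple_top_inj _ Ni); apply/simple_topP; [case: Ni|exists x].
Qed.

Lemma simple_top_iso i N N' : simple_top e i N -> simple_top e i N' ->
  exists f : {linear N -> N'}, injective f /\ surjective f.
Proof.
move=> [_ [p [ps pR]]] [_ [q [qs qR]]].
have [|f fE] := surj_factor (f := q) ps; first by move=> x /pR /qR.
exists f; split; last by move=> y; have [x <-] := qs y; exists (p x).
by apply: linear_inj => y; have [x <-] := ps y; rewrite fE => /qR /pR.
Qed.

Lemma filtration_count0 j M s : filtration M s -> all_in simple s ->
  (count (fun N => `[< simple_top e j N >]) s = 0)%N <-> killed j M.
Proof.
elim=> [X X0 _|L X N t f g fi ex gs _ IH /= [Ns ts]].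
  by split=> // _ x; rewrite (X0 x) scaler0.
have sf : mod_ses L X N by exists f, g.
split=> [|kX].
  case: asboolP => //= nN /IH -/(_ ts) kL; apply: killed_ext sf kL _ => x.
  by apply: contrapT => xn0; apply/nN/simple_topP => //; exists x.
rewrite (iffRL (IH ts) (killed_sub fi kX)).
case: asboolP => // /(simple_topP _ Ns) [x xn0].
by case: xn0; apply: killed_quot gs kX x.
Qed.

(** The module e_i M over e_i A e_i is simple. By [filtration_count1] this is multiplicity one of
    E(i). *)
Definition simple_part i M := (exists x : M, e i *: x <> 0) /\
  forall x y : M, e i *: x <> 0 -> exists a, a *: (e i *: x) = e i *: y.

Lemma filtration_count1 i M s : filtration M s -> all_in simple s ->
  (count (fun N => `[< simple_top e i N >]) s = 1)%N <-> simple_part i M.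
Proof.
elim=> [X X0 _|L X N t f g fi ex gs ft IH /= [Ns ts]].
  by split=> // -[[x]]; rewrite (X0 x) scaler0.
have sf : ses_maps f g by [].
case: asboolP => [Ni|nN] /=.
  have [z zn0] := iffLR (simple_topP i Ns) Ni; have [x0 x0E] := gs z.
  rewrite add1n; split=> [[/(filtration_count0 i ft ts) kL]|[_ h]].
    have ge x : e i *: x <> 0 -> g (e i *: x) <> 0.
      move=> xn0 /(ses_ker sf) [y yE]; apply: xn0.
      by rewrite -e_idemZ -yE -linZ kL linear0.
    split; first by exists x0 => x00; apply: zn0; rewrite -x0E -linZ x00 linear0.
    move=> x y /ge gx; have [_ /(_ _ (submodule_cyclic (g (e i *: x)))) [h|h]] := Ns.
      by case: gx; apply: (eq_set0 h); exists 1; rewrite scale1r.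
    have [a aE] := eq_setT (g (e i *: y)) h; exists (e i * a).
    have [w wE] : exists w, f w = e i *: y - a *: (e i *: x).
      by apply: (ses_ker sf); rewrite linearB [g (a *: _)]linZ /= aE subrr.
    have := congr1 (fun v => e i *: v) wE.
    rewrite -linZ kL linear0 scalerBr e_idemZ scalerA => /eqP.
    by rewrite eq_sym subr_eq0 => /eqP.
  congr S; apply/(filtration_count0 i ft ts) => y; apply: contrapT => yn0.
  have fyn0 : e i *: f y <> 0.
    by rewrite -linZ => h0; apply: yn0; apply: fi; rewrite linear0.
  have [a aE] := h (f y) x0 fyn0; apply: zn0.
  by rewrite -x0E -linZ -aE -!linZ (ses_comp0 _ sf).
have kN : killed i N.
  by move=> x; apply: contrapT => xn0; apply/nN/simple_topP => //; exists x.
have fL x : exists y, f y = e i *: x by apply: (ses_ker sf); rewrite linZ; apply: kN.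
rewrite add0n; split=> [/(IH ts) [[y yn0] h]|[[x xn0] h]].
  split; first by exists (f y); rewrite -linZ => h0; apply: yn0; apply: fi; rewrite linear0.
  move=> x z; have [x' x'E] := fL x; have [z' z'E] := fL z.
  rewrite -(e_idemZ i x) -(e_idemZ i z) -x'E -z'E -!linZ => xn0.
  have [|a aE] := h x' z'; first by move=> h0; apply: xn0; rewrite h0 linear0.
  by exists a; rewrite -linZ aE.
apply/(IH ts); split.
  have [y yE] := fL x; exists y => y0; apply: xn0.
  by rewrite -e_idemZ -yE -linZ y0 linear0.
move=> y z yn0; have [|a aE] := h (f y) (f z).
  by rewrite -linZ => h0; apply: yn0; apply: fi; rewrite linear0.
by exists a; apply: fi; rewrite !linZ.
Qed.

Lemma multiplicity0_killed j M : multiplicity (simple_top e j) M 0 -> killed j M.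
Proof. by case=> s [fs ss] /(filtration_count0 j fs ss). Qed.

Lemma killed_multiplicity0 j M : finitely_generated M -> killed j M ->
  multiplicity (simple_top e j) M 0.
Proof.
case/fg_has_flen => m /flen_composition_series [s [fs ss]] kM.
by exists s => //; apply/(filtration_count0 j fs ss).
Qed.

Lemma multiplicity1_part i M : multiplicity (simple_top e i) M 1 -> simple_part i M.
Proof. by case=> s [fs ss] /(filtration_count1 i fs ss). Qed.

Lemma part_multiplicity1 i M : finitely_generated M -> simple_part i M ->
  multiplicity (simple_top e i) M 1.
Proof.
case/fg_has_flen => m /flen_composition_series [s [fs ss]] kM.
by exists s => //; apply/(filtration_count1 i fs ss).
Qed.

End Stratification.

(** * Injective envelopes *)

Section InjectiveEnvelope.
Context {B : nzRingType}.
Implicit Types I K L M N P Q S T W X Y Z D : lmodType B.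

Definition essential N M (j : {linear N -> M}) := forall U : set M, submodule U ->
  (exists2 y, U y & y <> 0) -> exists x, j x <> 0 /\ U (j x).

Lemma essential_inj N M Y (j : {linear N -> M}) (f : {linear M -> Y}) :
  essential j -> (forall x, f (j x) = 0 -> j x = 0) -> injective f.
Proof.
move=> ess h; apply: linear_inj => y fy; apply: contrapT => yn0.
have [|x [jx fx]] := ess _ (submodule_ker f); first by exists y.
exact/jx/h.
Qed.

Lemma envelope_essential N M : injective_envelope N M ->
  injective_module M /\ exists j : {linear N -> M}, injective j /\ essential j.
Proof.
case=> Mi [j [ji je]]; split=> //; exists j; split=> // U US [y Uy yn0].
by apply: je => // U0; apply: yn0; rewrite U0 in Uy.
Qed.

Lemma envelope_fg N M D m (i : {linear N -> {ffun 'I_m -> D}}) :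
  @noetherian_ring B -> finitely_generated D -> injective_module D ->
  injective i -> injective_envelope N M -> finitely_generated M.
Proof.
move=> nB Dfg Di ii /envelope_essential [_ [j [ji je]]].
have [f fE] := pow_injective_module Di i ji.
apply: (fg_sub (i := f) nB (fg_pow m Dfg)); apply: essential_inj je _ => x.
by rewrite -fE => ix; rewrite (ii x 0) ?linear0 // ix linear0.
Qed.

(* A maximal essential extension of [N] inside an injective module is a direct
   summand, a complement being any submodule maximal among those meeting it
   trivially. *)
Lemma envelope_exists N I a (j : {linear N -> I}) :
  injective_module I -> flen a I -> injective j ->
  exists2 M, injective_envelope N M & finitely_generated M.
Proof.
move=> Ii fI ji.
pose F (V : set I) := [/\ submodule V, forall x, V (j x) & forall U : set I,
  submodule U -> U `<=` V -> (exists2 y, U y & y <> 0) -> exists x, j x <> 0 /\ U (j x)].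
have [V||V [VS Vj Vess] Vmax] := @max_submodule B a I F fI; first by case.
  exists [set y | exists x, j x = y]; split; [exact: submodule_im|by move=> x; exists x|].
  by move=> U US UI [y Uy yn0]; have [x xE] := UI y Uy; exists x; rewrite xE.
pose G (W : set I) := submodule W /\ forall x, W x -> V x -> x = 0.
have [W||W [WS WV] Wmax] := @max_submodule B a I G fI; first by case.
  by exists [set 0]; split; [exact: submodule_zero|move=> x ->].
have meets (W' : set I) : submodule W' -> W `<=` W' -> (exists2 x, W' x & ~ W x) ->
    exists v, [/\ W' v, V v & v <> 0].
  move=> W'S WW' [x W'x Wx]; apply: contrapT => h; apply: Wx.
  apply: (Wmax W') => //; split=> // y W'y Vy.
  by apply: contrapT => yn0; apply: h; exists y.
have [M [_ [i [_ [[ii _ _] iV _]]]]] := sub_ses VS.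
have [_ [Q [_ [p [[_ _ ps] _ pW]]]]] := sub_ses WS.
have pii : injective (p \o i).
  apply: linear_inj => x /pW Wix; apply: ii; rewrite linear0; apply: WV => //.
  by apply/iV; exists x.
(* [V] embeds into I/W, and [h] extends its inclusion into [I]. By maximality of [W] this [h] is
   injective, and its image is again an essential extension containing [V], hence inside [V]; so h
   \o p projects [I] onto [V]. *)
have [h hE] := Ii _ _ (p \o i) i pii.
have hi : injective h.
  apply: linear_inj => y hy; apply: contrapT => yn0.
  have [|w Ww||v [hpv /iV [k kE]]] := meets [set x | h (p x) = 0].
  - exact: (submodule_preim p (submodule_ker h)).
  - by move/pW: Ww => /= ->; rewrite linear0.
  - have [x xE] := ps y; exists x; first by rewrite /= xE.
    by move/pW; rewrite xE.
  by apply; rewrite -kE hE /= kE.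
have V'V : [set z | exists y, h y = z] `<=` V.
  apply: Vmax; last by move=> _ /iV [k <-]; exists ((p \o i) k); rewrite -hE.
  split=> [|x|U US UV' [y Uy yn0]]; first exact: submodule_im.
    by have /iV [k kE] := Vj x; exists ((p \o i) k); rewrite -hE.
  have [|w Ww||x [Ux Vx xn0]] := meets [set x | U (h (p x))].
  - exact: (submodule_preim p (submodule_preim h US)).
  - by move/pW: Ww => /= ->; rewrite linear0; case: US.
  - have [z zE] := UV' y Uy; have [x xE] := ps z; exists x.
      by rewrite /= xE zE.
    by move/pW => px; apply: yn0; rewrite -zE -xE px linear0.
  have hx : h (p x) = x by have /iV [k kE] := Vx; rewrite -kE [RHS]hE.
  have [||z [zn0 [Uz _]]] := Vess [set x | U x /\ V x] (submodule_setI US VS).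
  - by move=> z [].
  - by exists x => //; split=> //; rewrite -hx.
  by exists z.
have [r rE] : exists r : {linear I -> M}, forall x, i (r x) = (h \o p) x.
  by apply: inj_lift => // x; apply/iV; apply: V'V; exists (p x).
exists M; last by apply: fg_flen (flen_sub fI ii).
split.
  by apply: (retract_injective (s := i) (r := r)) Ii => x; apply: ii; rewrite rE [RHS]hE.
have [j' j'E] : exists j' : {linear N -> M}, forall x, i (j' x) = j x.
  by apply: inj_lift => // x; apply/iV.
exists j'; split; first by move=> x y e; apply: ji; rewrite -!j'E e.
move=> U US Un0.
have [y Uy yn0] : exists2 y, U y & y <> 0.
  apply: contrapT => hU; apply: Un0; apply: zero_submodule US _ => y Uy.
  by apply: contrapT => yn0; apply: hU; exists y.
have [||x [xn0 [z Uz zE]]] := Vess _ (submodule_image i US).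
- by move=> _ [z _ <-]; apply/iV; exists z.
- by exists (i y); [exists y|move=> iy0; apply: yn0; apply: ii; rewrite linear0].
exists x; split; first by move=> h0; apply: xn0; rewrite -j'E h0 linear0.
by rewrite -(ii z (j' x)) // zE j'E.
Qed.

End InjectiveEnvelope.

(** * Standard and costandard modules through idempotents *)

Section StandardModules.
Context {A : nzRingType} {n : nat} (e : 'I_n -> A).
Hypotheses (fA : exists a, flen a (A^o : lmodType A))
  (e_cpoi : complete_primitive_orthogonal_idempotents e) (e_basic : basic_algebra e).
Variable D : lmodType A.
Hypotheses (D_fg : finitely_generated D) (D_inj : injective_module D)
  (D_cog : forall X : fgmod A, exists m (i : {linear X -> {ffun 'I_m -> D}}),
     injective i).
Implicit Types (i j l : 'I_n) (I X Y Z M N L S K Q W : lmodType A) (b : bool).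
Local Notation P := (indec_proj e).
Local Notation killed := (killed e).
Local Notation simple_part := (simple_part e).
Let nA : @noetherian_ring A := flen_noetherian fA.

(* [b = false] is the case of standard and costandard modules, [b = true] that
   of the proper ones; [below b l i] tells that E(l) may be a composition factor
   of the radical of the standard module of index [i], or of the quotient of the
   costandard one by its socle. *)
Definition below b (l i : nat) := if b then (l < i)%N else (l <= i)%N.

Definition admissible b i X :=
  (forall l, (i < l)%N -> killed l X) /\ (b -> simple_part i X).

(** For [b = true] the proper standard module is described directly as a factor of P(i), bypassing
    Delta(i), so that both cases share their proofs. Maximality is an inclusion of kernels; in
    [std_sub] it is an inclusion of images. *)
Definition std_quot b i X := exists q : {linear P i -> X},
  [/\ surjective q, admissible b i X & forall Z (r : {linear P i -> Z}),
    surjective r -> admissible b i Z -> forall x, q x = 0 -> r x = 0].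

Definition std_sub b i X := exists S I (s : {linear S -> I}) (j : {linear X -> I}),
  [/\ simple_top e i S, [/\ injective_module I, finitely_generated I, injective s & essential s],
      injective j, admissible b i X & forall Z (r : {linear Z -> I}),
        injective r -> admissible b i Z -> forall z, exists x, j x = r z].

Lemma admissible_no_factor i X : finitely_generated X ->
  no_factor_above e i X <-> admissible false i X.
Proof.
move=> Xfg; split=> [h|[h _] l il].
  by split=> // l il; apply: (multiplicity0_killed fA e_cpoi (h l il)).
exact: (killed_multiplicity0 fA e_cpoi Xfg (h l il)).
Qed.

Lemma fg_quot_proj i X (q : {linear P i -> X}) : surjective q -> finitely_generated X.
Proof. exact: fg_surj (indec_proj_fg e_cpoi i). Qed.

Lemma simple_part_simple i S : simple_top e i S -> simple_part i S.
Proof.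
move=> Si; have [Ss _] := Si.
split; first exact/(simple_topP fA e_cpoi).
move=> x y xn0; have [_ /(_ _ (submodule_cyclic (e i *: x))) [h|h]] := Ss.
  by case: xn0; apply: (eq_set0 h); exists 1; rewrite scale1r.
by have [a aE] := eq_setT (e i *: y) h; exists a.
Qed.

Lemma admissible_simple b i S : simple_top e i S -> admissible b i S.
Proof.
move=> Si; split=> [l il|_]; last exact: simple_part_simple.
apply: (simple_top_killed fA e_cpoi e_basic Si) => li.
by rewrite li ltnn in il.
Qed.

Lemma Delta_std_quot i X : Delta e i X -> std_quot false i X.
Proof.
case=> hX [q [qs qu]]; exists q; split=> //.
  exact/(admissible_no_factor i (fg_quot_proj qs)).
move=> Z r rs /(admissible_no_factor i (fg_quot_proj rs)) hZ x qx.
by have [h ->] := qu Z r rs hZ; rewrite qx linear0.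
Qed.

Lemma proper_Delta_std_quot i X : proper_Delta e i X -> std_quot true i X.
Proof.
case=> Y [/Delta_std_quot [q [qs [kY _] qu]] [mX [p [ps pu]]]].
have pqs : surjective (p \o q).
  by move=> x; have [y <-] := ps x; have [z <-] := qs y; exists z.
exists (p \o q); split=> //.
  split=> [l il|_]; first exact: killed_quot ps (kY l il).
  exact: (multiplicity1_part fA e_cpoi mX).
move=> Z r rs [kZ /(_ isT) mZ] x pqx.
have [|r' r'E] := surj_factor (f := r) qs; first by move=> y; apply: qu.
have r's : surjective r' by move=> z; have [y <-] := rs z; exists (q y).
have [h hE] := pu Z r' r's
  (part_multiplicity1 fA e_cpoi (fg_quot_proj rs) mZ).
by rewrite -r'E hE -[p _]/((p \o q) x) pqx linear0.
Qed.

Lemma std_quot_unique b i X X' : std_quot b i X -> std_quot b i X' ->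
  exists f : {linear X -> X'}, injective f /\ surjective f.
Proof.
move=> [q [qs aX qu]] [q' [qs' aX' qu']].
have [|f fE] := surj_factor (f := q') qs; first exact: qu.
exists f; split; last by move=> y; have [x <-] := qs' y; exists (q x).
by apply: linear_inj => y; have [x <-] := qs y; rewrite fE; apply: qu'.
Qed.

(** The kernel of [X] onto its top has no factor above [i]; for [b = true] it also lacks E(i), the
    single copy being the top. The last clause is the locality of P(i), inherited by [X]. *)
Lemma std_quot_top b i X S : std_quot b i X -> simple_top e i S ->
  exists K (k : {linear K -> X}) (t : {linear X -> S}),
    [/\ ses_maps k t, forall l, ~~ below b l i -> killed l K
      & forall U, submodule U -> (exists2 x, U x & t x <> 0) -> forall x, U x].
Proof.
move=> [q [qs aX qu]] Si; have [Ss [p [ps pR]]] := Si.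
have pR' x : p x = 0 <-> Rad x by rewrite pR (radical_Rad fA e_cpoi).
have [|t tE] := surj_factor (f := p) qs; first exact: qu ps (admissible_simple b Si).
have ts : surjective t by move=> y; have [x <-] := ps y; exists (q x).
have tcyc y : t y <> 0 -> exists a, a *: y = q (gen e i).
  have [x <-] := qs y; rewrite tE => /pR' h; apply: contrapT => hn; apply: h => a ax.
  by apply: hn; exists a; rewrite -linZ ax.
have tg : t (q (gen e i)) <> 0 by rewrite tE => /pR'; apply: gen_notin_Rad.
have [K [k kt]] := ker_ses ts; have [ki _ _] := kt; exists K, k, t; split=> //.
  move=> l lb; have [il|li] := ltnP i l.
    by case: aX => /(_ l il) kX _; apply: killed_sub ki kX.
  have [bT li'] : b /\ l = i.
    by move: lb; rewrite /below; case: b {aX qu} => lb; split=> //; try (apply: val_inj => /=); lia.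
  rewrite {l}li' in lb li *; have [_ /(_ bT) [_ mX]] := aX.
  move=> x; apply: ki; rewrite linear0 linZ; apply: contrapT => xn0.
  have [a aE] := mX (k x) (q (gen e i)) xn0.
  apply: tg; have -> : q (gen e i) = a *: (e i *: k x) by rewrite aE -linZ (e_gen e_cpoi).
  by rewrite !linZ (ses_comp0 _ kt) !scaler0.
move=> U US [x Ux tx] y; have [a aE] := tcyc x tx.
have [z <-] := qs y; case: (US) => _ _ UZ.
by rewrite (gen_span e_cpoi z) linZ -aE; apply: (UZ); apply: UZ.
Qed.

Lemma std_quot_nonzero b i X : std_quot b i X -> exists x : X, e i *: x <> 0.
Proof.
move=> [q [qs aX qu]].
have [S [p [ps pR]]] := top_exists fA e_cpoi i.
have Si := simple_of_top fA e_cpoi ps pR.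
exists (q (gen e i)); rewrite -linZ (e_gen e_cpoi).
move=> /(qu S p ps (admissible_simple b Si)) /pR; exact: gen_notin_Rad.
Qed.

(** A nonzero map from [K] to E(l) would yield the larger factor of P(i) by the kernel of that map,
    still admissible because only E(l) is added. *)
Lemma std_quot_ker b i X : std_quot b i X ->
  exists K, mod_ses K (P i) X /\
    forall l N, simple_top e l N -> below b l i -> hom0 K N.
Proof.
move=> [q [qs aX qu]]; have [K [k kq]] := ker_ses qs; have [ki _ _] := kq.
exists K; split=> [|l N Nl li g y]; first by exists k, q.
have [_ [Z [_ [r [[_ _ rs] _ rU]]]]] := sub_ses (submodule_image k (submodule_ker g)).
have lift m p : q (e m *: p) = 0 -> m <> l -> r (e m *: p) = 0.
  move=> qp ml; have [x xE] := ses_ker kq qp; apply/rU; exists x => //=.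
  have ex : e m *: x = x by apply: ki; rewrite linZ xE (e_idemZ e_cpoi).
  by rewrite -ex linZ (simple_top_killed fA e_cpoi e_basic Nl ml).
suff aZ : admissible b i Z.
  have /rU [x gx /ki <-] : r (k y) = 0 by apply: qu aZ _ (ses_comp0 _ kq).
  exact: gx.
case: aX => kX mX; split=> [m im z|bT].
  have [p <-] := rs z; rewrite -linZ; apply: lift; first by rewrite linZ kX.
  by move=> ml; move: li; rewrite -ml /below; case: (b) => /=; lia.
have il : i <> l by move=> e0; move: li; rewrite e0 /below bT ltnn.
have [[x xn0] h] := mX bT.
have qr p : q (e i *: p) = 0 <-> r (e i *: p) = 0.
  split=> [qp|/rU [w _ <-]]; [exact: lift|exact: (ses_comp0 _ kq)].
split.
  have [p pE] := qs x; exists (r p); rewrite -linZ => /qr.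
  by rewrite linZ pE.
move=> z w; have [p <-] := rs z; have [p' <-] := rs w; rewrite -!linZ => pn0.
have [|a aE] := h (q p) (q p'); first by rewrite -linZ => /qr.
exists (e i * a); apply/eqP; rewrite -subr_eq0 -linZ -linearB; apply/eqP.
have -> : (e i * a) *: (e i *: p) - e i *: p' = e i *: (a *: (e i *: p) - p').
  by rewrite scalerBr (scalerA (e i) a).
by apply/qr; rewrite linZ linearB !linZ aE scalerBr (e_idemZ e_cpoi) subrr.
Qed.

(** P(i) modulo the trace of the P(l) with l > i. The families are isomorphism-closed predicates, so
    existence requires an argument. *)
Lemma Delta_exists i : exists X, Delta e i X.
Proof.
pose W : set (P i) := [set x | forall V : set (P i), submodule V ->
  (forall l y, (i < l)%N -> V (e l *: y)) -> V x].
have WS : submodule W.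
  split=> [V [V0 _ _] _|x y Ix Iy V VS h|a x Ix V VS h] //.
    by case: (VS) => _ VD _; apply: VD; [apply: Ix|apply: Iy].
  by case: (VS) => _ _ VZ; apply: VZ; apply: Ix.
have [_ [X [_ [q [[_ _ qs] _ qW]]]]] := sub_ses WS.
exists X; split.
  apply/(admissible_no_factor i (fg_quot_proj qs)); split=> // l il x.
  by have [p <-] := qs x; rewrite -linZ; apply/qW => V VS; apply.
exists q; split=> // Z r rs /(admissible_no_factor i (fg_quot_proj rs)) [kZ _].
have [|h hE] := surj_factor (f := r) qs; last by exists h => x; rewrite hE.
move=> x /qW /(_ _ (submodule_ker r)); apply=> l y il /=.
by rewrite linZ kZ.
Qed.

Lemma proper_Delta_exists i : exists X, proper_Delta e i X.
Proof.
have [Y dY] := Delta_exists i; have sY := Delta_std_quot dY.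
have [S [p [ps pR]]] := top_exists fA e_cpoi i.
have Si := simple_of_top fA e_cpoi ps pR.
have [K [k [t [kt _ tloc]]]] := std_quot_top sY Si; have [ki _ ts] := kt.
have Yfg : finitely_generated Y by have [q [qs _ _]] := sY; apply: fg_quot_proj qs.
(* The submodule generated by the e_i-part of the radical [K] of [Y]; factoring it out leaves only
   the copy of E(i) at the top. *)
pose W : set Y := [set x | forall V : set Y, submodule V ->
  (forall y, V (e i *: k y)) -> V x].
have WS : submodule W.
  split=> [V [V0 _ _] _|x y Ix Iy V VS h|a x Ix V VS h] //.
    by case: (VS) => _ VD _; apply: VD; [apply: Ix|apply: Iy].
  by case: (VS) => _ _ VZ; apply: VZ; apply: Ix.
have Wt x : W x -> t x = 0.
  by move/(_ _ (submodule_ker t)); apply=> y /=; rewrite linZ (ses_comp0 _ kt) scaler0.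
have [_ [X [_ [q [[_ _ qs] _ qW]]]]] := sub_ses WS.
have gen_all x y : t (e i *: x) <> 0 -> exists a, a *: (e i *: x) = e i *: y.
  move=> tx; apply: (tloc _ (submodule_cyclic (e i *: x))).
  by exists (e i *: x) => //; exists 1; rewrite scale1r.
have t0_ker x : t (e i *: x) = 0 -> exists y, e i *: k y = e i *: x.
  by case/(ses_ker kt) => y yE; exists y; rewrite yE (e_idemZ e_cpoi).
exists X; exists Y; split=> //; split.
  apply: (part_multiplicity1 fA e_cpoi (fg_surj Yfg qs)); split.
    have [z zn0] := iffLR (simple_topP fA e_cpoi i (proj1 Si)) Si.
    have [y yE] := ts z; exists (q y); rewrite -linZ => /qW /Wt.
    by rewrite linZ yE.
  move=> x y; have [x' <-] := qs x; have [y' <-] := qs y; rewrite -!linZ => xn0.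
  have [|a aE] := gen_all x' y'; last by exists a; rewrite -linZ aE.
  by move/t0_ker => [w wE]; apply: xn0; rewrite -wE; apply/qW => V VS; apply.
exists q; split=> // Z r rs /(multiplicity1_part fA e_cpoi) [[z0 z0n0] h].
have [|f fE] := surj_factor (f := r) qs; last by exists f => x; rewrite fE.
have [z z_n0] := iffLR (simple_topP fA e_cpoi i (proj1 Si)) Si.
have [y1 y1E] := ts z.
have kerr x : r x = 0 -> t x = 0.
  move=> rx; apply: contrapT => tx; apply: z0n0; have [y0 <-] := rs z0.
  have /= -> := tloc _ (submodule_ker r) (ex_intro2 _ _ x rx tx) y0.
  by rewrite scaler0.
move=> x /qW /(_ _ (submodule_ker r)); apply=> y /=; apply: contrapT.
rewrite linZ => ryn0; have [a] := h _ (r y1) ryn0; rewrite -!linZ => /eqP; rewrite -subr_eq0 -linearB.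
move=> /eqP /kerr; rewrite linearB !(linZ t) (ses_comp0 _ kt) sub0r y1E => /eqP.
by rewrite oppr_eq0 => /eqP.
Qed.

Lemma simple_embeds S : simple S ->
  exists m (i : {linear S -> {ffun 'I_m -> D}}), injective i.
Proof. by move=> Ss; apply: (D_cog (FgMod (fg_simple Ss))). Qed.

Lemma Nabla_std_sub i X : Nabla e i X -> std_sub false i X.
Proof.
case=> S [I [Si env [hX [j [ji ju]]]]].
have [m [k ki]] := simple_embeds (proj1 Si).
have Ifg := envelope_fg nA D_fg D_inj ki env.
have [Ii [s [si ess]]] := envelope_essential env.
exists S, I, s, j; split=> //.
  exact/(admissible_no_factor i (fg_sub nA Ifg ji)).
move=> Z r ri /(admissible_no_factor i (fg_sub nA Ifg ri)) hZ z.
by have [h hE] := ju Z r ri hZ; exists (h z); rewrite hE.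
Qed.

Lemma proper_Nabla_std_sub i X : proper_Nabla e i X -> std_sub true i X.
Proof.
case=> Y [/Nabla_std_sub [S [I [s [jY [Si [Ii Ifg si ess] jYi [kY _] jYu]]]]]].
case=> mX [j [ji ju]]; have jji : injective (jY \o j) by move=> x y /jYi /ji.
exists S, I, s, (jY \o j); split=> //.
  split=> [l il|_]; first exact: killed_sub ji (kY l il).
  exact: (multiplicity1_part fA e_cpoi mX).
move=> Z r ri [kZ /(_ isT) mZ] z.
have [|r' r'E] := inj_lift (f := r) jYi; first by apply: jYu.
have r'i : injective r' by move=> x y xy; apply: ri; rewrite -!r'E xy.
have [h hE] := ju Z r' r'i
  (part_multiplicity1 fA e_cpoi (fg_sub nA Ifg ri) mZ).
by exists (h z); rewrite /= -hE r'E.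
Qed.

Lemma std_sub_soc b i X S : std_sub b i X -> simple_top e i S ->
  exists Q (t : {linear S -> X}) (p : {linear X -> Q}),
    [/\ ses_maps t p, forall l, ~~ below b l i -> killed l Q & essential t].
Proof.
move=> [S' [I [s [j [S'i [Ii Ifg si ess] ji aX ju]]]]] Si.
have [f [fi fs]] := simple_top_iso Si S'i.
have sfi : injective (s \o f) by move=> x y /si /fi.
have [|t tE] := inj_lift (f := s \o f) ji.
  exact: ju sfi (admissible_simple b Si).
have ti : injective t by move=> x y xy; apply: sfi; rewrite -!tE xy.
have [Q [p tp]] := coker_ses ti; have [_ _ ps] := tp; exists Q, t, p; split=> //.
  move=> l lb; have [il|li] := ltnP i l.
    by case: aX => /(_ l il) kX _; apply: killed_quot ps kX.
  have [bT li'] : b /\ l = i.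
    by move: lb; rewrite /below; case: b {aX ju} => lb; split=> //; try (apply: val_inj => /=); lia.
  rewrite {l}li' in lb li *; have [_ /(_ bT) [_ mX]] := aX.
  move=> y; have [x <-] := ps y; rewrite -linZ.
  have [w wn0] := iffLR (simple_topP fA e_cpoi i (proj1 Si)) Si.
  have [|a aE] := mX (t w) x.
    by rewrite -linZ => tw; apply: wn0; apply: ti; rewrite linear0.
  by rewrite -aE -!linZ (ses_comp0 _ tp).
move=> U US [y Uy yn0].
have [|x [sx [u Uu uE]]] := ess _ (submodule_image j US).
  exists (j y); first by exists y.
  by move=> jy; apply: yn0; apply: ji; rewrite linear0.
have [x0 x0E] := fs x; have tu : t x0 = u by apply: ji; rewrite tE /= x0E.
exists x0; rewrite tu; split=> // u0.
by apply: sx; rewrite -uE u0 linear0.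
Qed.

(** Dual of [std_quot_ker]: the preimage in [I] of a copy of E(l) in the cokernel would be a larger
    admissible submodule. *)
Lemma std_sub_coker b i X : std_sub b i X ->
  exists I Q, [/\ mod_ses X I Q, injective_module I, finitely_generated I
    & forall l N, simple_top e l N -> below b l i -> hom0 N Q].
Proof.
move=> [S [I [s [j [Si [Ii Ifg si ess] ji aX ju]]]]].
have [Q [p jp]] := coker_ses ji; have [_ _ ps] := jp.
exists I, Q; split=> // [|l N Nl li g y]; first by exists j, p.
have VS := submodule_preim p (submodule_im g).
have [Z [_ [r [_ [[ri _ _] rV _]]]]] := sub_ses VS.
have lift m (v : Z) : m <> l -> exists x, j x = e m *: r v.
  move=> ml; have /rV /= [w wE] : exists k, r k = r v by exists v.
  apply: (ses_ker jp); rewrite linZ -wE -linZ.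
  by rewrite (simple_top_killed fA e_cpoi e_basic Nl ml) linear0.
have lift_e m (v : Z) x : j x = e m *: r v -> e m *: x = x.
  by move=> h; apply: ji; rewrite linZ h (e_idemZ e_cpoi).
suff aZ : admissible b i Z.
  have [v vE] := ps (g y); have /rV [z zE] : [set v | exists x, g x = p v] v by exists y.
  by have [x xE] := ju Z r ri aZ z; rewrite -vE -zE -xE (ses_comp0 _ jp).
case: aX => kX mX; split=> [m im v|bT].
  have ml : m <> l by move=> ml; move: li; rewrite -ml /below; case: (b) => /=; lia.
  have [x xE] := lift m v ml; apply: ri; rewrite linear0 linZ -xE.
  by rewrite -(lift_e _ _ _ xE) kX // linear0.
have il : i <> l by move=> e0; move: li; rewrite e0 /below bT ltnn.
have [[x xn0] h] := mX bT; split.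
  have /rV [z zE] : [set v | exists x, g x = p v] (j x).
    by exists 0; rewrite linear0 (ses_comp0 _ jp).
  exists z => z0; apply: xn0; apply: ji; rewrite linear0 linZ -zE -linZ z0 linear0 //.
move=> v w vn0; have [x' x'E] := lift i v il; have [y' y'E] := lift i w il.
have [|a aE] := h x' y'.
  rewrite (lift_e _ _ _ x'E) => x'0; apply: vn0; apply: ri.
  by rewrite linear0 linZ -x'E x'0 linear0.
exists a; apply: ri; rewrite !linZ -x'E -y'E -(lift_e _ _ _ x'E) -(lift_e _ _ _ y'E) -aE.
by rewrite (linZ j a).
Qed.

Lemma Nabla_exists i : exists X, Nabla e i X.
Proof.
have [S [p [ps pR]]] := top_exists fA e_cpoi i.
have Si := simple_of_top fA e_cpoi ps pR.
have [m [k ki]] := simple_embeds (proj1 Si).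
have Di := @pow_injective_module A m D D_inj.
have [a fD] := fg_has_flen fA (fg_pow m D_fg).
have [I env Ifg] := envelope_exists Di fD ki.
pose U : set I := [set x | forall (a : A) l, (i < l)%N -> e l *: (a *: x) = 0].
have US : submodule U.
  split=> [b l il|x y Ux Uy b l il|c x Ux b l il].
  - by rewrite !scaler0.
  - by rewrite !scalerDr Ux // Uy // addr0.
  - by rewrite (scalerA b) Ux.
have [X [_ [j [_ [[ji _ _] jU _]]]]] := sub_ses US.
exists X, S, I; split=> //; split.
  apply/(admissible_no_factor i (fg_sub nA Ifg ji)); split=> // l il x.
  have /(_ 1 l il) : U (j x) by apply/jU; exists x.
  by rewrite scale1r -linZ => h; apply: ji; rewrite linear0.
exists j; split=> // Z r ri /(admissible_no_factor i (fg_sub nA Ifg ri)) [kZ _].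
have [|h hE] := inj_lift (f := r) ji; last by exists h => z; rewrite hE.
by move=> z; apply/jU => b l il; rewrite -!linZ kZ // linear0.
Qed.

Lemma proper_Nabla_exists i : exists X, proper_Nabla e i X.
Proof.
have [Y dY] := Nabla_exists i; have sY := Nabla_std_sub dY.
have [S [p [ps pR]]] := top_exists fA e_cpoi i.
have Si := simple_of_top fA e_cpoi ps pR; have [Ss _] := Si.
have [Q0 [t [p0 [tp _ ess]]]] := std_sub_soc sY Si; have [ti _ _] := tp.
have Yfg : finitely_generated Y.
  have [S' [I [s [j [_ [_ Ifg _ _] ji _ _]]]]] := sY; exact: fg_sub nA Ifg ji.
have Scyc (x y : S) : x <> 0 -> exists a, a *: x = y.
  move=> xn0; have [_ /(_ _ (submodule_cyclic x)) [h|h]] := Ss; last exact: eq_setT h.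
  by case: xn0; apply: (eq_set0 h); exists 1; rewrite scale1r.
(* The elements generating a submodule whose e_i-part lies in the socle of [Y], the image of [t]. *)
pose U : set Y := [set x | forall a : A, exists w, t w = e i *: (a *: x)].
have US : submodule U.
  split=> [b|x y Ux Uy b|c x Ux b].
  - by exists 0; rewrite linear0 !scaler0.
  - have [w wE] := Ux b; have [w' w'E] := Uy b; exists (w + w').
    by rewrite linearD wE w'E !scalerDr.
  - by rewrite (scalerA b); apply: Ux.
have [X [_ [j [_ [[ji _ _] jU _]]]]] := sub_ses US.
have [w0 w0n0] := iffLR (simple_topP fA e_cpoi i Ss) Si.
exists X, Y; split=> //; split.
  apply: (part_multiplicity1 fA e_cpoi (fg_sub nA Yfg ji)); split.
    have /jU [x xE] : U (t w0) by move=> a; exists (e i *: (a *: w0)); rewrite !linZ.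
    exists x => x0; apply: w0n0; apply: ti.
    by rewrite linear0 linZ -xE -linZ x0 linear0.
  have inS x : exists w, t w = j (e i *: x).
    have /(_ 1) [w wE] : U (j x) by apply/jU; exists x.
    by exists w; rewrite wE scale1r linZ.
  move=> x y xn0; have [w wE] := inS x; have [w' w'E] := inS y.
  have [|a aE] := Scyc w w'.
    by move=> w00; apply: xn0; apply: ji; rewrite -wE w00 !linear0.
  by exists a; apply: ji; rewrite linZ -wE -w'E -aE linZ.
exists j; split=> // Z r ri /(multiplicity1_part fA e_cpoi) [[z0 z0n0] h].
have [|k kE] := inj_lift (f := r) ji; last by exists k => z; rewrite kE.
move=> z; apply/jU => a.
have [|x [tx [z1 z1E]]] := ess _ (submodule_im r).
  exists (r (e i *: z0)); first by exists (e i *: z0).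
  by move=> rz; apply: z0n0; apply: ri; rewrite linear0.
have [c cE] : exists c, c *: x = w0 by apply: Scyc => x0; apply: tx; rewrite x0 linear0.
have z1n0 : e i *: (c *: z1) <> 0.
  move=> z10; apply: w0n0; apply: ti; rewrite linear0 -cE !linZ -z1E -!linZ.
  by rewrite z10 linear0.
have [d dE] := h _ (a *: z) z1n0.
by exists (d *: (e i *: w0)); rewrite -!linZ -dE -cE !linZ z1E.
Qed.

End StandardModules.

(** * Resolutions and coresolutions cut into short exact sequences *)

Section Resolutions.
Context {B : nzRingType}.
Implicit Types I K L M N Q S T W X Y Z D : lmodType B.
Implicit Types P : lmodType B -> Prop.

Definition iso_closed P := forall M N (f : {linear N -> M}),
  injective f -> surjective f -> P M -> P N.

Lemma coresolution0 P X : iso_closed P -> coresolution P X 0 <-> P X.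
Proof.
move=> Piso; split=> [[M [eps [f [ie ee ef PM M0]]]]|PX].
  apply: (Piso _ _ eps ie) (PM 0%N (leqnn _)) => y; apply/ee.
  exact: (M0 1%N (ltnSn _)).
have [z _] := zero_linear_exists X X.
(* The family is indexed by all natural numbers; positive degrees receive a zero module. *)
pose M k := if k is _.+1 then {ffun 'I_0 -> B^o} : lmodType B else X.
pose f k : {linear M k -> M k.+1} := projT1 (cid (zero_linear_exists (M k) (M k.+1))).
have M0 k : (0 < k)%N -> zero_module (M k) by case: k => // k _; exact: zero_ffun0.
have f0 k (x : M k) : f k x = 0 by exact: (M0 k.+1).
exists M, idfun, f; split=> //.
- by move=> y; split=> _; [exists y|exact: f0].
- move=> k y; split=> _; last exact: f0.
  by exists 0; rewrite linear0 [RHS](M0 k.+1).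
- by case.
Qed.

Lemma coresolution_cons P X M X' d : mod_ses X M X' -> P M ->
  coresolution P X' d -> coresolution P X d.+1.
Proof.
move=> [i [p s]] PM [M' [eps [f [ie ee ef PM' M'0]]]]; have [ii _ ps] := s.
pose N k := if k is k'.+1 then M' k' else M.
pose g k : {linear N k -> N k.+1} :=
  match k with 0 => eps \o p | k'.+1 => f k' end.
exists N, i, g; split=> //.
- move=> y; split=> [/= epy|[x <-]]; last by rewrite /= (ses_comp0 _ s) linear0.
  by apply: (ses_ker s); apply: ie; rewrite linear0.
- case=> [|k] y; last exact: ef.
  split=> [/ee [x <-]|[x <-] /=]; last by apply/ee; exists (p x).
  by have [z <-] := ps x; exists z.
- by case=> [|k] //; apply: PM'.
- by case=> // k; apply: M'0.
Qed.

Lemma coresolution_succ P X d : coresolution P X d.+1 ->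
  exists M X', [/\ mod_ses X M X', P M & coresolution P X' d].
Proof.
move=> [M [eps [f [ie ee ef PM M0]]]]; have [Q [p s]] := coker_ses ie.
have [_ _ ps] := s; exists (M 0%N), Q; split; [by exists eps, p|exact: PM|].
have [|eps' eps'E] := surj_factor (f := f 0%N) ps.
  by move=> x /(ses_ker s) [y <-]; apply/ee; exists y.
exists (fun k => M k.+1), eps', (fun k => f k.+1); split.
- apply: linear_inj => q; have [x <-] := ps q; rewrite eps'E.
  by case/ee => y <-; rewrite (ses_comp0 _ s).
- move=> y; split=> [/ef [x <-]|[q <-]]; first by exists (p x); rewrite eps'E.
  by have [x <-] := ps q; rewrite eps'E; apply/ef; exists x.
- by move=> k; apply: ef.
- by move=> k kd; apply: PM.
- by move=> k kd; apply: M0.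
Qed.

Lemma resolution0 P X : iso_closed P -> resolution P X 0 <-> P X.
Proof.
move=> Piso; split=> [[M [eps [f [ie ee ef PM M0]]]]|PX].
  have epsi : injective eps.
    apply: linear_inj => x /ee [y <-].
    by rewrite (M0 1%N (ltnSn _) y) linear0.
  have [g gE] : exists g : {linear X -> M 0%N}, forall x, g (eps x) = x.
    have [|g gE] := surj_factor (f := idfun : {linear M 0%N -> M 0%N}) ie.
      by move=> x e0; apply: epsi; rewrite linear0.
    by exists g.
  apply: (Piso _ _ g) (PM 0%N (leqnn _)) => [x y|y]; last by exists (eps y).
  by have [u <-] := ie x; have [v <-] := ie y; rewrite !gE => ->.
pose M k := if k is _.+1 then {ffun 'I_0 -> B^o} : lmodType B else X.
pose f k : {linear M k.+1 -> M k} := projT1 (cid (zero_linear_exists (M k.+1) (M k))).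
have M0 k : (0 < k)%N -> zero_module (M k) by case: k => // k _; exact: zero_ffun0.
exists M, idfun, f; split=> //.
- by move=> y; exists y.
- move=> y; split=> [/= ->|[x <-]]; first by exists 0; rewrite linear0.
  by rewrite (M0 1%N _ x) ?linear0.
- move=> k y; split=> _; last by rewrite (M0 k.+1 _ y) // linear0.
  by exists 0; rewrite linear0 [RHS](M0 k.+1).
- by case.
Qed.

Lemma resolution_cons P K M X d : mod_ses K M X -> P M ->
  resolution P K d -> resolution P X d.+1.
Proof.
move=> [i [p s]] PM [M' [eps [f [ie ee ef PM' M'0]]]]; have [ii _ ps] := s.
pose N k := if k is k'.+1 then M' k' else M.
pose g k : {linear N k.+1 -> N k} :=
  match k with 0 => i \o eps | k'.+1 => f k' end.
exists N, p, g; split=> //.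
- move=> y; split=> [/(ses_ker s) [x <-]|[x <-] /=]; last exact: (ses_comp0 _ s).
  by have [z <-] := ie x; exists z.
- case=> [|k] y; last exact: ef.
  split=> [/= epy|[x <-] /=]; first by apply/ee; apply: ii; rewrite linear0.
  by apply/eqP; rewrite (iffRL (ee _)) ?linear0 //; exists x.
- by case=> [|k] //; apply: PM'.
- by case=> // k; apply: M'0.
Qed.

Lemma resolution_succ P X d : resolution P X d.+1 ->
  exists K M, [/\ mod_ses K M X, P M & resolution P K d].
Proof.
move=> [M [eps [f [ie ee ef PM M0]]]]; have [K [i s]] := ker_ses ie.
have [ii _ ps] := s; exists K, (M 0%N); split; [by exists i, eps|exact: PM|].
have [|eps' eps'E] := inj_lift (f := f 0%N) ii.
  by move=> x; apply: (ses_ker s); apply/ee; exists x.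
exists (fun k => M k.+1), eps', (fun k => f k.+1); split.
- move=> y; have /ee [x xE] := ses_comp0 y s.
  by exists x; apply: ii; rewrite eps'E.
- move=> y; split=> [e0|/ef h].
    by apply/ef; rewrite -eps'E e0 linear0.
  by apply: ii; rewrite eps'E linear0.
- by move=> k; apply: ef.
- by move=> k kd; apply: PM.
- by move=> k kd; apply: M0.
Qed.

End Resolutions.

(** * Homological dimensions in the abstract category *)

Section DimensionTransfer.
Context {B : nzRingType}.
Variables (D : lmodType B).
Hypotheses (nB : @noetherian_ring B) (D_fg : finitely_generated D)
  (D_inj : injective_module D)
  (D_cog : forall X : fgmod B, exists m (i : {linear X -> {ffun 'I_m -> D}}),
     injective i).
Local Notation C := (mod_extcat nB D_fg D_inj D_cog).
Local Notation exP := (@extP B nB).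
Local Notation exI := (@extI B D D_fg D_inj D_cog).
Local Notation balance := (@ext_balance B D nB D_fg D_inj D_cog).

Lemma coresolution_cores (P : lmodType B -> Prop) (X : C) d : iso_closed P ->
  (forall M, P M -> finitely_generated M) ->
  coresolution P X d <-> @cores C (fun M => P (fgmod_sort M)) d X.
Proof.
move=> Piso Pfg; elim: d X => [|d IH] X; first exact: coresolution0.
split=> [/coresolution_succ [M [X' [s PM c]]]|[M [X' [s PM /IH c]]]].
  have [i [p [_ _ ps]]] := s.
  exists (FgMod (Pfg _ PM)), (FgMod (fg_surj (Pfg _ PM) ps)); split=> //.
  exact/IH.
exact: coresolution_cons s PM c.
Qed.

Lemma resolution_cores (P : lmodType B -> Prop) (X : C) d : iso_closed P ->
  (forall M, P M -> finitely_generated M) ->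
  resolution P X d <-> @cores (op C) (fun M => P (fgmod_sort M)) d X.
Proof.
move=> Piso Pfg; elim: d X => [|d IH] X; first exact: resolution0.
split=> [/resolution_succ [K [M [s PM c]]]|[M [K [s PM /IH c]]]].
  have [i [p [ii _ _]]] := s.
  exists (FgMod (Pfg _ PM)), (FgMod (fg_sub nB (Pfg _ PM) ii)); split=> //.
  exact/IH.
exact: resolution_cons s PM c.
Qed.

Lemma projective_iso_closed : iso_closed (@projective B).
Proof.
move=> M N f fi fs.
have [g gE] : exists g : {linear M -> N}, forall x, f (g x) = x.
  by have [g gE] := inj_lift (f := idfun : {linear M -> M}) fi fs; exists g.
by apply: (retract_projective (s := f) (r := g)) => x; apply: fi.
Qed.

Lemma injective_iso_closed : iso_closed (@injective_module B).
Proof.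
move=> M N f fi fs.
have [g gE] : exists g : {linear M -> N}, forall x, f (g x) = x.
  by have [g gE] := inj_lift (f := idfun : {linear M -> M}) fi fs; exists g.
by apply: (retract_injective (s := f) (r := g)) => x; apply: fi.
Qed.

Lemma projective_ext (X Y : C) k : projective X -> @ext C k.+1 X Y.
Proof. by move=> Xp; apply/balance/extI_projective. Qed.

Lemma injective_ext (X Y : C) k : injective_module Y -> @ext C k.+1 X Y.
Proof. by move=> Yi; apply: extP_injective. Qed.

(** The terms of a given projective resolution may fail to be finitely generated, so one direction
    runs through [extI], whose first argument is arbitrary. Conversely, the presentation of the d-th
    syzygy splits. *)
Lemma resolution_pd_le (X : C) d : resolution projective X d <-> pd_le X d.
Proof.
split=> [r Y|].
  apply/balance; move: (fgmod_sort X) r => {}X; elim: d X => [|d IH] X.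
    move=> /resolution0 h; apply: extI_projective; apply: h.
    exact: projective_iso_closed.
  move=> /resolution_succ [K [M [s PM c]]].
  by apply: (extI_quot s (IH _ c)); apply: extI_projective.
elim: d X => [|d IH] X h.
  apply/resolution0; first exact: projective_iso_closed.
  have s : @ses C (syz nB X) (pc_mod (pc nB X)) X.
    by do 2 eexists; apply: (pc_ses (pc nB X)).
  have [_ _ [i [r ri]]] := split_ses s (h _).
  by apply: (retract_projective ri); apply: pc_proj.
apply: (resolution_cons (K := syz nB X) (M := pc_mod (pc nB X))).
- by do 2 eexists; apply: (pc_ses (pc nB X)).
- exact: pc_proj.
- apply: IH => Y; apply: (@ext_subl C _ (pc_mod (pc nB X)) X) (h Y).
    by do 2 eexists; apply: (pc_ses (pc nB X)).
  by apply: projective_ext; apply: pc_proj.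
Qed.

Lemma coresolution_id_le (X : C) d : coresolution injective_module X d <->
  @pd_le (op C) X d.
Proof.
split=> [r Y|].
  change (exP d.+1 Y X); move: (fgmod_sort X) r => {}X.
  elim: d X => [|d IH] X.
    move=> /coresolution0 h; apply: extP_injective; apply: h.
    exact: injective_iso_closed.
  move=> /coresolution_succ [M [X' [s PM c]]].
  by apply: (extP_sub s (IH _ c)); apply: extP_injective.
have s (Y : C) : @ses C Y (ih_mod (ih D_fg D_inj D_cog Y)) (cosyz D_fg D_inj D_cog Y).
  by do 2 eexists; apply: (ih_ses (ih D_fg D_inj D_cog Y)).
elim: d X => [|d IH] X h.
  apply/coresolution0; first exact: injective_iso_closed.
  have [_ [i [r ri]] _] := split_ses (s X) (h _).
  by apply: (retract_injective ri); apply: ih_inj.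
apply: (coresolution_cons (s X)); first exact: ih_inj.
apply: IH => Y; apply: (@ext_quotr C _ _ _ _ _ (s X)) (h Y).
by apply: injective_ext; apply: ih_inj.
Qed.

(** [Ext_succ_vanishes] speaks of all projective resolutions; the one spliced from the chosen
    presentations gives [extP]. *)
Lemma Ext_succ_vanishes_ext k (X : C) (Y : C) :
  Ext_succ_vanishes k X Y -> @ext C k.+1 X Y.
Proof.
move=> h; change (exP k.+1 X Y) => f.
pose Pr i := pc_mod (pc nB (iter i (syz nB) X)) : lmodType B.
pose o i : {linear Pr i.+1 -> pc_ker (pc nB (iter i (syz nB) X))} :=
  pc_out (pc nB (iter i.+1 (syz nB) X)).
pose d i : {linear Pr i.+1 -> Pr i} := pc_in (pc nB (iter i (syz nB) X)) \o o i.
have os i : surjective (o i) by have [] := pc_ses (pc nB (iter i.+1 (syz nB) X)).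
have so i : ses_maps (pc_in (pc nB (iter i.+1 (syz nB) X))) (o i).
  exact: (pc_ses (pc nB (iter i.+1 (syz nB) X))).
have si i := pc_ses (pc nB (iter i (syz nB) X)).
have [||||x|g gE] := h Pr (pc_out (pc nB X)) d _ _ _ _ (f \o o k).
- by move=> i; apply: pc_proj.
- by have [] := pc_ses (pc nB X).
- move=> y; split=> [/(ses_ker (si 0%N)) [x <-]|[x <-]]; last exact: (ses_comp0 _ (si 0%N)).
  by have [z <-] := os 0%N x; exists z.
- move=> i y; split=> [|[x <-]]; last first.
    by rewrite /d /= (ses_comp0 _ (so i)) linear0.
  have [ii _ _] := si i; rewrite -(linear0 (pc_in (pc nB (iter i (syz nB) X)))) => /ii.
  move=> /(ses_ker (so i)) [x <-]; have [z <-] := os i.+1 x; by exists z.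
- by rewrite /d /= (ses_comp0 _ (so k)) linear0.
by exists g => y; have [x <-] := os k y; rewrite -[RHS]/((f \o o k) x) gE.
Qed.

Lemma extP_pow k (X : fgmod B) (Y : lmodType B) m :
  exP k X Y -> exP k X {ffun 'I_m -> Y}.
Proof.
case: k => [|k] h f.
  move=> x; apply/ffunP => j; have [p pE] := pow_proj Y j.
  by rewrite -pE -[LHS]/((p \o f) x) h ffunE.
have gP j : exists g : {linear pc_mod (pc nB (iter k (syz nB) X)) -> Y},
    forall x, g (pc_in _ x) = f x j.
  by have [p pE] := pow_proj Y j; have [g gE] := h (p \o f); exists g => x;
    rewrite gE -pE.
have [g gE] := choice gP; have [G GE] := pow_out g.
by exists G => x; apply/ffunP => j; rewrite GE gE.
Qed.

Lemma extI_pow k (X : lmodType B) (Y : fgmod B) m :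
  exI k X Y -> exI k {ffun 'I_m -> X} Y.
Proof.
case: k => [|k] h f.
  move=> x; rewrite (pow_sum x) linear_sum big1 // => j _.
  by have [q qE] := pow_inj X j; rewrite -qE -[LHS]/((f \o q) (x j)) h.
have gP j : exists g : {linear X -> ih_mod (ih D_fg D_inj D_cog (iter k (cosyz D_fg D_inj D_cog) Y))},
    forall x, ih_out _ (g x) = f (pow_single j x).
  by have [q qE] := pow_inj X j; have [g gE] := h (f \o q); exists g => x;
    rewrite gE -qE.
have [g gE] := choice gP; have [G GE] := pow_in g.
exists G => x; rewrite GE linear_sum [in RHS](pow_sum x) linear_sum.
by apply: eq_bigr => j _; rewrite gE.
Qed.

Lemma add_closure_extl (T X Y : C) k : add_closure T X ->
  @ext C k T Y -> @ext C k X Y.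
Proof.
move=> [m [f [g gf]]] /balance h.
pose Tm := FgMod (fg_pow m (fgmod_fg T)).
apply: (@ext_retractl C X Tm); first by exists f, g.
exact/balance/extI_pow.
Qed.

Lemma add_closure_extr (T X Y : C) k : add_closure T X ->
  @ext C k Y T -> @ext C k Y X.
Proof.
move=> [m [f [g gf]]] h.
pose Tm := FgMod (fg_pow m (fgmod_fg T)).
apply: (@ext_retractr C Y X Tm); first by exists f, g.
exact: extP_pow.
Qed.

Lemma add_closure_retract (T X Y : lmodType B) : mod_retract X Y ->
  add_closure T Y -> add_closure T X.
Proof.
move=> [s [r rs]] [m [f [g gf]]]; exists m, (f \o s), (r \o g) => x.
by rewrite /= gf rs.
Qed.

Lemma add_closure_zero (T X : lmodType B) : zero_module X -> add_closure T X.
Proof.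
move=> X0; have [f _] := zero_linear_exists X {ffun 'I_0 -> T}.
have [g _] := zero_linear_exists {ffun 'I_0 -> T} X.
by exists 0%N, f, g => x; rewrite (X0 (g _)) (X0 x).
Qed.

Lemma add_closure_self (T : lmodType B) m : add_closure T {ffun 'I_m -> T}.
Proof. by exists m, idfun, idfun. Qed.

Lemma add_closure_refl (T : lmodType B) : add_closure T T.
Proof.
have [p pE] := pow_proj T (ord0 : 'I_1); have [q qE] := pow_inj T (ord0 : 'I_1).
by exists 1%N, q, p => x; rewrite pE qE ffunE eqxx.
Qed.

Lemma add_closure_fg (T X : lmodType B) : finitely_generated T ->
  add_closure T X -> finitely_generated X.
Proof.
move=> Tfg [m [f [g gf]]]; apply: (fg_surj (p := g) (fg_pow m Tfg)) => x.
by exists (f x).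
Qed.

Lemma add_closure_iso (T : lmodType B) : iso_closed (add_closure T).
Proof.
move=> M N f fi fs; apply: add_closure_retract.
have [g gE] := inj_lift (f := idfun : {linear M -> M}) fi fs.
by exists f, g => x; apply: fi; rewrite gE.
Qed.

End DimensionTransfer.

(** * Vanishing of Ext between standard and costandard modules *)

Section StratifiedExt.
Context {A : nzRingType} {n : nat} (e : 'I_n -> A).
Hypotheses (fA : exists a, flen a (A^o : lmodType A))
  (e_cpoi : complete_primitive_orthogonal_idempotents e) (e_basic : basic_algebra e).
Variable D : lmodType A.
Hypotheses (D_fg : finitely_generated D) (D_inj : injective_module D)
  (D_cog : forall X : fgmod A, exists m (i : {linear X -> {ffun 'I_m -> D}}),
     injective i).
Local Notation nA := (flen_noetherian fA).
Local Notation C := (mod_extcat nA D_fg D_inj D_cog).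
Local Notation P := (indec_proj e).
Local Notation killed := (killed e).
Local Notation std_quot := (std_quot e).
Local Notation std_sub := (std_sub e).
Implicit Types (X Y Z W : C) (i j l : 'I_n) (b : bool) (M N : lmodType A).

Lemma top_fg i : exists S : fgmod A, simple_top e i S.
Proof.
have [S [p [ps pR]]] := top_exists fA e_cpoi i.
have Si := simple_of_top fA e_cpoi ps pR.
by exists (FgMod (fg_simple (proj1 Si))).
Qed.

Definition E i : C := projT1 (cid (top_fg i)).

Lemma simple_top_E i : simple_top e i (E i).
Proof. exact: projT2 (cid (top_fg i)). Qed.

Lemma ext0_zero X : @ext C 0 X X <-> zero_module X.
Proof.
split=> [/hom0_zero //|X0 f x]; exact: X0.
Qed.

Lemma Fil_E (S : 'I_n -> Prop) X : (forall l, ~ S l -> killed l X) ->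
  @Fil C (fun Z => exists2 l, S l & Z = E l) X.
Proof.
have [m] := fg_has_flen fA (fgmod_fg X).
elim: m X => [|m IH] X fX kX; first exact/Fil_zero/ext0_zero.
case: fX => [X0|[L [N [s Ns fL]]]]; first exact/Fil_zero/ext0_zero.
have [f [g sfg]] := s; have [fi _ gs] := sfg.
have [l Nl] := simple_has_top fA e_cpoi Ns.
have [h [hi hs]] := simple_top_iso Nl (simple_top_E l).
have Sl : S l.
  apply: contrapT => /kX kl; have [x xn0] := iffLR (simple_topP fA e_cpoi l Ns) Nl.
  by apply: xn0; apply: killed_quot gs kl x.
have sE : @ses C (FgMod (fg_flen fL)) X (E l).
  exists f, (h \o g); split=> //.
  - move=> y; split=> [/= hgy|[x <-] /=]; last by rewrite (ses_comp0 _ sfg) linear0.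
    by apply: (ses_ker sfg); apply: hi; rewrite linear0.
  - by move=> y; have [z <-] := hs y; have [x <-] := gs z; exists x.
apply: (Fil_ext sE); last by apply: Fil_in; exists l.
by apply: IH => // k Sk; apply: killed_sub fi (kX k Sk).
Qed.

Lemma Fil_killed (Q : C -> Prop) l X : (forall Z, Q Z -> killed l Z) ->
  @Fil C Q X -> killed l X.
Proof.
move=> QZ; elim=> [Z /ext0_zero Z0 x|Z|X' Z X'' s _ k' _ k'']; last 2 first.
- exact: QZ.
- exact: (killed_ext e_cpoi s k' k'').
by rewrite (Z0 x) scaler0.
Qed.

Lemma Fil_iso (Q : C -> Prop) X Y (f : {linear X -> Y}) : injective f ->
  surjective f -> @Fil C Q X -> @Fil C Q Y.
Proof.
move=> fi fs FX; have z := @zero_ffun0 A; pose O : C := FgMod (fg_zero z).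
apply: (@Fil_ext C Q X Y O) => //; last exact/Fil_zero/ext0_zero.
have [g g0] := zero_linear_exists Y O; exists f, g; split=> //.
by move=> y; exists 0; rewrite (z y) (z (g 0)).
Qed.

Lemma filtered_Fil (Q : lmodType A -> Prop) X : filtered Q X ->
  @Fil C (fun Z => Q (fgmod_sort Z)) X.
Proof.
case: X => M Mfg [s [/= fs]]; elim: fs Mfg => [X X0|L X N t f g fi ex gs _ IH] Xfg /=.
  by move=> _; apply/Fil_zero/ext0_zero.
case=> QN Qt; have Lfg := fg_sub nA Xfg fi; have Nfg := fg_surj Xfg gs.
apply: (@Fil_ext C _ (FgMod Lfg) (FgMod Xfg) (FgMod Nfg)).
- by exists f, g.
- exact: IH.
- exact: Fil_in.
Qed.

Lemma filtered_zero (Q : lmodType A -> Prop) M : zero_module M -> filtered Q M.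
Proof. by exists [::]; split=> //; apply: filtration_nil. Qed.

Lemma filtration_iso M s : filtration M s -> forall N (f : {linear N -> M}),
  injective f -> surjective f -> filtration N s.
Proof.
case=> [X X0|L X Z t f g fi ex gs ft] N h hi hs.
  by apply: filtration_nil => x; apply: hi; rewrite linear0.
have [h' h'E] : exists h' : {linear X -> N}, forall x, h (h' x) = x.
  exact: (inj_lift (f := idfun : {linear X -> X})).
have h'K x : h' (h x) = x by apply: hi; rewrite h'E.
apply: (filtration_cons (f := h' \o f) (g := g \o h)) ft.
- by move=> x y xy; apply: fi; rewrite -[LHS]h'E -[RHS]h'E; congr (h _).
- move=> y; split=> [/ex [x xE]|[x <-]]; first by exists x; rewrite /= xE h'K.
  by rewrite /= h'E; apply/ex; exists x.
- by move=> z; have [y <-] := gs z; exists (h' y); rewrite /= h'E.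
Qed.

Lemma filtered_iso (Q : lmodType A -> Prop) : iso_closed (filtered Q).
Proof.
by move=> M N f fi fs [s [Fs Qs]]; exists s; split=> //; apply: filtration_iso Fs _ f fi fs.
Qed.

Lemma filtered_ext (Q : lmodType A -> Prop) L M N : mod_ses L M N ->
  filtered Q L -> filtered Q N -> filtered Q M.
Proof.
move=> s FL [t [ft Qt]]; elim: ft M s Qt => [X X0|K X Z u f g fi ex gs _ IH] M s /=.
  move=> _; have [i [p ip]] := s; have [ii _ _] := ip.
  have [i' i'E] : exists i' : {linear M -> L}, forall x, i (i' x) = x.
    by apply: (inj_lift (f := idfun : {linear M -> M})) => // x; apply: (ses_ker ip); apply: X0.
  have [v [fv Qv]] := FL; exists v; split=> //.
  apply: (filtration_iso fv (f := i')) => [x y xy|y].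
    by rewrite -(i'E x) xy.
  by exists (i y); apply: ii; rewrite i'E.
case=> QZ Qu; have t0 : mod_ses K X Z by exists f, g.
have [W [w [_ s1 [a [c [ai ec cs]]]]]] := ses_pull s t0.
have [v [fv Qv]] := IH _ s1 Qu; exists (Z :: v); split=> //.
exact: filtration_cons ai ec cs fv.
Qed.

Lemma filtered_single (Q : lmodType A -> Prop) M : Q M -> filtered Q M.
Proof.
move=> QM; exists [:: M]; split=> //; have z := @zero_ffun0 A.
have [f [g [fi ex gs]]] := zero_ses_l M z.
by apply: filtration_cons fi ex gs _; apply: filtration_nil.
Qed.

Lemma Fil_filtered (Q : lmodType A -> Prop) X :
  @Fil C (fun Z => Q (fgmod_sort Z)) X -> filtered Q X.
Proof.
elim=> [Z /ext0_zero|Z|X' Z X'' s _ F' _ F'']; first exact: filtered_zero.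
  exact: filtered_single.
exact: filtered_ext s F' F''.
Qed.

Lemma filtered_fg (Q : lmodType A -> Prop) M :
  (forall N, Q N -> finitely_generated N) -> filtered Q M -> finitely_generated M.
Proof.
move=> Qfg [s [fs]]; elim: fs => [X X0 _|L X N t f g fi ex gs _ IH /= [QN Qt]].
  exact: fg_zero.
by apply: (@fg_ext _ L X N); [exists f, g|apply: IH|apply: Qfg].
Qed.

Lemma std_quot_factors b i X l : std_quot b i X -> ~ (l <= i)%N -> killed l X.
Proof. by move=> [q [_ [kX _] _]] /negP; rewrite -ltnNge; apply: kX. Qed.

Lemma std_sub_factors b i X l : std_sub b i X -> ~ (l <= i)%N -> killed l X.
Proof. by move=> [S [I [s [j [_ _ _ [kX _] _]]]]] /negP; rewrite -ltnNge; apply: kX. Qed.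

Lemma ext_regular k Y : @ext C k.+1 (FgMod (@fg_regular A)) Y.
Proof. exact/projective_ext/regular_projective. Qed.

Lemma std_quot_presentation b i X : std_quot b i X -> exists K Pi : C,
  [/\ ses K Pi X, forall k Y, ext k.+1 Pi Y
    & forall l, below b l i -> ext 0 K (E l)].
Proof.
move=> sX; have [K [s h]] := std_quot_ker fA e_cpoi e_basic sX.
have Pfg := indec_proj_fg e_cpoi i; have [k [p [ki _ _]]] := s.
exists (FgMod (fg_sub nA Pfg ki)), (FgMod Pfg); split=> //.
  by move=> m Y; apply/projective_ext/indec_proj_projective.
by move=> l li; apply: h li; apply: simple_top_E.
Qed.

Lemma std_sub_copresentation b i X : std_sub b i X -> exists I Q : C,
  [/\ ses X I Q, forall k Y, ext k.+1 Y I
    & forall l, below b l i -> ext 0 (E l) Q].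
Proof.
move=> sX; have [I [Q [s Ii Ifg h]]] := std_sub_coker fA e_cpoi e_basic sX.
have [j [p [_ _ ps]]] := s.
exists (FgMod Ifg), (FgMod (fg_surj Ifg ps)); split=> //.
  by move=> m Y; apply: injective_ext.
by move=> l li; apply: h li; apply: simple_top_E.
Qed.

(** The kernel of P(i) -> X has no nonzero map to E(l) with [below b l i], hence none to a module
    with only such factors. *)
Lemma ext1_below b i X Y : std_quot b i X ->
  (forall l, ~~ below b l i -> killed l Y) -> ext 1 X Y.
Proof.
move=> /std_quot_presentation [K [Pi [s pP h]]] kY.
apply: (ext_quotl s) (pP _ _).
apply: (@Fil_extr C (fun Z => exists2 l : 'I_n, below b l i & Z = E l)).
  by move=> _ [l li ->]; apply: h.
by apply: Fil_E => l /negP; apply: kY.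
Qed.

(** Depending on the order of [i] and [j], either the factors of [Y] are small enough for the
    presentation of [X], or those of [X] are small enough for the copresentation of [Y]. One of the
    two strata being proper, the cases are exhaustive. *)
Lemma ext1_std b i j X Y : std_quot b i X -> std_sub (~~ b) j Y -> ext 1 X Y.
Proof.
move=> sX sY; have [ji|ij] := boolP (below b j i).
  apply: (ext1_below sX) => l li; apply: (std_sub_factors sY) => lj.
  by move: ji li lj; rewrite /below; case: (b); lia.
have [I [Q [s iI h]]] := std_sub_copresentation sY.
apply: (ext_subr s) (iI _ _).
apply: (@Fil_extl C (fun Z => exists2 l : 'I_n, (l <= i)%N & Z = E l)).
  by move=> _ [l li ->]; apply: h; move: ij li; rewrite /below; case: (b) => /=; lia.
by apply: Fil_E => l; apply: std_quot_factors sX.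
Qed.

Section FilteredAlgebra.
Variable b : bool.
Hypothesis A_Fil : @Fil C (fun X => exists l, std_quot b l X) (FgMod (@fg_regular A)).

(** Ext^1 from a standard module to one of smaller index vanishes, so the larger indices can be
    moved to the bottom of the filtration. *)
Lemma regular_reorder i : exists A' A'' : C, [/\ ses A' (FgMod (@fg_regular A)) A'',
  Fil (fun X => exists2 l : 'I_n, (i < l)%N & std_quot b l X) A' &
  Fil (fun X => exists2 l : 'I_n, (l <= i)%N & std_quot b l X) A''].
Proof.
apply: Fil_reorder => [X Y [l il sX] [m mi sY]|].
  apply: (ext1_below sX) => k kl; apply: (std_quot_factors sY) => km.
  by move: kl; rewrite /below; case: (b); lia.
apply: Fil_mono A_Fil => X [l sX]; have [il|li] := ltnP i l; [left|right]; by exists l.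
Qed.
End FilteredAlgebra.

Lemma hom0_std_quot b l X Y : std_quot b l X -> killed l Y -> ext 0 X Y.
Proof.
move=> [q [qs _ _]] kY f x; have [p <-] := qs x; rewrite (gen_span e_cpoi p).
by rewrite -(e_gen e_cpoi) !linZ kY scaler0.
Qed.

(** The retraction of [A] onto P(i) descends: P(i) -> A'' factors through Delta(i), as A'' has no
    factors above [i], and A -> Delta(i) factors through A'', as A' has no nonzero map to
    Delta(i). *)
Lemma std_quot_retract i X (A' A'' : C) : std_quot false i X ->
  @ses C A' (FgMod (@fg_regular A)) A'' ->
  Fil (fun Z => exists b, exists2 l : 'I_n, (i < l)%N & std_quot b l Z) A' ->
  (forall l, (i < l)%N -> killed l A'') -> retract X A''.
Proof.
move=> sX [a [p ap]] FA' kA''; have [q [qs [kX _] qu]] := sX.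
have [s [r [rs _]]] := proj_retract e_cpoi i; have [_ _ ps] := ap.
have [Z [_ [z [_ [[zi _ _] zU _]]]]] := sub_ses (submodule_im (p \o s)).
have [t tE] : exists t : {linear P i -> Z}, forall x, z (t x) = (p \o s) x.
  by apply: inj_lift => // x; apply/zU; exists x.
have ts : surjective t.
  move=> y; have /zU [x xE] : exists k, z k = z y by exists y.
  by exists x; apply: zi; rewrite tE.
have aZ : admissible e false i Z.
  by split=> // l il; apply: killed_sub zi (kA'' l il).
have [|sg sgE] := surj_factor (f := p \o s) qs.
  move=> x qx; transitivity (z (t x)); first by rewrite tE.
  by rewrite (qu Z t ts aZ x qx) linear0.
have [|rh rhE] := surj_factor (f := q \o r) ps.
  move=> x /(ses_ker ap) [y <-].
  have h : ext 0 A' X.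
    apply: Fil_extl FA' => W [b [l il sW]].
    by apply: (hom0_std_quot sW); apply: kX.
  exact: (h (q \o r \o a)).
exists sg, rh => x; have [y <-] := qs x.
by rewrite sgE rhE /= rs.
Qed.

Section StandardFiltration.
Hypothesis A_Delta : @Fil C (fun X => exists l, std_quot false l X) (FgMod (@fg_regular A)).

(* Both the vanishing of higher Ext and the finiteness of the projective
   dimension are obtained from above, [X] being a retract of the quotient of the
   regular module by a submodule filtered by the later standard modules. *)
Lemma std_quot_shift i X : std_quot false i X -> exists A' : C,
  Fil (fun Z => exists2 l : 'I_n, (i < l)%N & std_quot false l Z) A' /\
  forall k Y, ext k.+1 A' Y -> ext k.+2 X Y.
Proof.
move=> sX; have [A' [A'' [s F' F'']]] := regular_reorder A_Delta i.
exists A'; split=> // k Y h.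
have hr : @ext C k.+2 (FgMod (@fg_regular A)) Y by apply: ext_regular.
apply: (ext_retractl _ (ext_quotl s h hr)).
apply: std_quot_retract sX s _ _.
  by apply: Fil_mono F' => Z sZ; exists false.
move=> l il; apply: Fil_killed F'' => Z [m mi sZ].
by apply: (std_quot_factors sZ); lia.
Qed.

(** Descending induction on the index: [std_quot_shift] lowers the degree and replaces Delta(i) by
    standard modules of larger index. *)
Lemma ext_Delta_vanish Y : (forall i X, std_quot false i X -> ext 1 X Y) ->
  forall k i X, std_quot false i X -> ext k.+1 X Y.
Proof.
move=> h1 k i X sX; move: {2}(n - i)%N (leqnn (n - i)) => m.
elim: m k i X sX => [|m IH] k i X sX.
  by rewrite leqn0 subn_eq0 leqNgt ltn_ord.
case: k => [_|k im]; first exact: h1 sX.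
have [A' [F' h]] := std_quot_shift sX; apply: h.
apply: Fil_extl F' => Z [l il sZ]; apply: IH sZ _.
by rewrite leq_subLR in im; lia.
Qed.

(** At most n - i shifts are possible before the indices run out; [n] is a bound uniform in [i]. *)
Lemma Delta_pd_le i X : std_quot false i X -> pd_le X n.
Proof.
suff h m k (j : 'I_n) Z Y : std_quot false j Z -> (n - j <= m)%N -> (m <= k)%N -> ext k.+1 Z Y.
  by move=> sX Y; apply: (h (n - i)%N n _ _ _ sX) => //; apply: leq_subr.
elim: m k j Z => [|m IH] k j Z sZ; first by rewrite leqn0 subn_eq0 leqNgt ltn_ord.
move=> jm; case: k => // k mk; have [A' [F' h]] := std_quot_shift sZ; apply: h.
apply: Fil_extl F' => W [l il sW]; apply: IH sW _ mk.
by rewrite leq_subLR in jm; lia.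
Qed.

Hypothesis A_proper : @Fil C (fun X => exists l, std_quot true l X) (FgMod (@fg_regular A)).

(** As for torsion pairs: the vanishing of Hom forces the two submodules of [Z] to contain each
    other. *)
Lemma ses_unique X' Z X'' Y' Y'' : @ses C X' Z X'' -> @ses C Y' Z Y'' ->
  ext 0 X' Y'' -> ext 0 Y' X'' ->
  (exists f : {linear Y' -> X'}, injective f /\ surjective f) /\
  (exists f : {linear Y'' -> X''}, injective f /\ surjective f).
Proof.
move=> [a [p ap]] [c [q cq]] h h'.
have [ai _ ps] := ap; have [ci _ qs] := cq.
have qa x : q (a x) = 0 by rewrite -[LHS]/((q \o a) x) h.
have pc y : p (c y) = 0 by rewrite -[LHS]/((p \o c) y) h'.
split.
  have [|f fE] := inj_lift (f := c) ai; first by move=> y; apply: (ses_ker ap).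
  exists f; split; first by move=> x y xy; apply: ci; rewrite -!fE xy.
  by move=> x; have [y yE] := ses_ker cq (qa x); exists y; apply: ai; rewrite fE.
have [|f fE] := surj_factor (f := p) qs.
  by move=> x /(ses_ker cq) [y <-].
exists f; split; last by move=> x; have [y <-] := ps x; exists (q y).
apply: linear_inj => y; have [x <-] := qs y; rewrite fE => /(ses_ker ap) [w <-].
exact: qa.
Qed.

Lemma killed_Fil_le b i l Y : (i < l)%N ->
  @Fil C (fun Z => exists2 m : 'I_n, (m <= i)%N & std_quot b m Z) Y -> killed l Y.
Proof.
move=> il; apply: Fil_killed => Z [m mi sZ]; apply: (std_quot_factors sZ); lia.
Qed.

Lemma killed_Fil_lt b i l Y : (i <= l)%N ->
  @Fil C (fun Z => exists2 m : 'I_n, (m < i)%N & std_quot b m Z) Y -> killed l Y.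
Proof.
move=> il; apply: Fil_killed => Z [m mi sZ]; apply: (std_quot_factors sZ); lia.
Qed.

(** Removing the factors of index above [i], and then those below [i], is determined by the
    vanishing of Hom. The two filtrations of [A] therefore have the same i-th layer. *)
Lemma common_layer i : exists2 M : C, @Fil C (fun Z => std_quot false i Z) M &
  @Fil C (fun Z => std_quot true i Z) M /\ exists x : M, e i *: x <> 0.
Proof.
have [A' [A'' [s F' F'']]] := regular_reorder A_Delta i.
have [B' [B'' [t G' G'']]] := regular_reorder A_proper i.
have [||_ [f [fi fs]]] := ses_unique s t.
- apply: Fil_extl F' => Z [l il sZ]; apply: (hom0_std_quot sZ).
  exact: killed_Fil_le il G''.
- apply: Fil_extl G' => Z [l il sZ]; apply: (hom0_std_quot sZ).
  exact: killed_Fil_le il F''.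
have {}G'' := Fil_iso fi fs G''.
have layer b : Fil (fun X => exists2 l : 'I_n, (l <= i)%N & std_quot b l X) A'' ->
    exists M N : C, [/\ ses M A'' N, @Fil C (fun Z => std_quot b i Z) M &
      Fil (fun X => exists2 l : 'I_n, (l < i)%N & std_quot b l X) N].
  move=> F; apply: Fil_reorder => [X Y sX [m mi sY]|].
    apply: (ext1_below sX) => k ki; apply: (std_quot_factors sY) => km.
    by move: ki; rewrite /below; case: (b); lia.
  apply: Fil_mono F => X [l]; rewrite leq_eqVlt => /orP [/eqP/val_inj -> sX|li sX].
    by left.
  by right; exists l.
have [M [N [sM FM FN]]] := layer _ F''; have [M' [N' [sM' FM' FN']]] := layer _ G''.
have [||[g [gi gs]] _] := ses_unique sM sM'.
- apply: Fil_extl FM => Z sZ; apply: (hom0_std_quot sZ); exact: killed_Fil_lt (leqnn i) FN'.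
- apply: Fil_extl FM' => Z sZ; apply: (hom0_std_quot sZ); exact: killed_Fil_lt (leqnn i) FN.
exists M => //; split; first exact: Fil_iso gi gs FM'.
(* If e_i killed [M], it would kill A'' and hence its retract Delta(i). *)
apply: contrapT => hM; have [X dX] := Delta_exists fA e_cpoi i.
have sX := Delta_std_quot fA e_cpoi dX.
have Xfg : finitely_generated X by have [q [qs _ _]] := sX; apply: fg_quot_proj qs.
have [x xn0] := std_quot_nonzero fA e_cpoi e_basic sX.
have [||u [v vu]] := @std_quot_retract i (FgMod Xfg) A' A'' sX s.
- by apply: Fil_mono F' => Z sZ; exists false.
- by move=> l il; apply: killed_Fil_le il F''.
have kA : killed i A''.
  apply: (killed_ext e_cpoi sM); last exact: killed_Fil_lt (leqnn i) FN.
  by move=> y; apply: contrapT => yn0; apply: hM; exists y.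
by apply: xn0; rewrite -(vu x) -linZ kA linear0.
Qed.

(** properDelta(i) is the top factor [N] of the common layer, which is orthogonal to [Y] because it
    is filtered by Delta(i). The kernel [L] is filtered by properDelta(i), so degree k+2 for [N]
    reduces to degree k+1 for [L]. *)
Lemma ext_proper_Delta_vanish (Y : C) : (forall i X, std_quot false i X -> ext 1 X Y) ->
  (forall i X, std_quot true i X -> ext 1 X Y) ->
  forall k i X, std_quot true i X -> ext k.+1 X Y.
Proof.
move=> h1 h1' k; elim: k => [|k IH] i X sX; first exact: h1' sX.
have [M FM [/(Fil_filtered (Q := std_quot true i)) [t [ft Qt]] [x xn0]]] := common_layer i.
have hM : ext k.+2 M Y.
  by apply: Fil_extl FM => Z sZ; apply: ext_Delta_vanish h1 _ _ _ sZ.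
case: M FM hM x xn0 ft Qt => M Mfg /= FM hM x xn0 ft.
case: ft Mfg FM hM x xn0 => [X0 z|L M0 N u f g fi ex gs fu] Mfg FM hM x xn0 /=.
  by case: xn0; rewrite (z x) scaler0.
case=> sN Qu; have Lfg := fg_sub nA Mfg fi; have Nfg := fg_surj Mfg gs.
have s : @ses C (FgMod Lfg) (FgMod Mfg) (FgMod Nfg) by exists f, g.
have hL : ext k.+1 (FgMod Lfg : C) Y.
  apply: (Fil_extl (P := fun Z : C => std_quot true i Z)); first by move=> Z; apply: IH.
  by apply: filtered_Fil; exists u.
have hN : ext k.+2 (FgMod Nfg : C) Y by apply: ext_quotl s hL hM.
apply: (ext_retractl _ hN); have [a [ai as_]] := std_quot_unique sX sN.
have [c cE] := inj_lift (f := idfun : {linear N -> N}) ai as_.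
by exists a, c => y; apply: ai; rewrite cE.
Qed.

Lemma ext_vanish b i j k X Y : std_quot b i X -> std_sub (~~ b) j Y -> ext k.+1 X Y.
Proof.
case: b => sX sY; last first.
  by apply: (ext_Delta_vanish _ sX) => l Z sZ; apply: ext1_std sZ sY.
apply: (ext_proper_Delta_vanish _ _ sX) => l Z sZ; last exact: ext1_std sZ sY.
(* Ext^1(Delta(l), Nabla(j)) = 0, both non-proper: by the presentation of Delta(l) if j <= l, by the
   copresentation of Nabla(j) otherwise. *)
have [lj|jl] := leqP j l.
  apply: (ext1_below sZ) => m ml; apply: (std_sub_factors sY) => mj.
  by move: ml; rewrite /below /=; lia.
have [I [Q [s iI h]]] := std_sub_copresentation sY.
apply: (ext_subr s) (iI _ _).
apply: (@Fil_extl C (fun Z => exists2 l0 : 'I_n, (l0 <= l)%N & Z = E l0)).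
  by move=> _ [m ml ->]; apply: h; rewrite /below /=; lia.
by apply: Fil_E => m; apply: std_quot_factors sZ.
Qed.

End StandardFiltration.

End StratifiedExt.

(** * Modules perpendicular to standard or costandard modules *)

Section Perpendicular.
Context {A : nzRingType} {n : nat} (e : 'I_n -> A).
Hypotheses (fA : exists a, flen a (A^o : lmodType A))
  (e_cpoi : complete_primitive_orthogonal_idempotents e) (e_basic : basic_algebra e).
Variable D : lmodType A.
Hypotheses (D_fg : finitely_generated D) (D_inj : injective_module D)
  (D_cog : forall X : fgmod A, exists m (i : {linear X -> {ffun 'I_m -> D}}),
     injective i).
Local Notation nA := (flen_noetherian fA).
Local Notation C := (mod_extcat nA D_fg D_inj D_cog).
Local Notation killed := (killed e).
Local Notation std_quot := (std_quot e).
Local Notation std_sub := (std_sub e).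
Local Notation E i := (E fA e_cpoi D_fg D_inj D_cog i).
Local Notation simple_top_E := (simple_top_E fA e_cpoi D_fg D_inj D_cog).
Implicit Types (X Y Z W : C) (i j l : 'I_n) (b : bool) (M N : lmodType A).

Definition standard b i M := if b then proper_Delta e i M else Delta e i M.
Definition costandard b i M := if b then proper_Nabla e i M else Nabla e i M.

Lemma standard_std_quot b i M : standard b i M -> std_quot b i M.
Proof.
case: b; [exact: proper_Delta_std_quot|exact: Delta_std_quot].
Qed.

Lemma costandard_std_sub b i M : costandard b i M -> std_sub b i M.
Proof.
case: b; [exact: (proper_Nabla_std_sub fA e_cpoi D_fg D_inj D_cog)
  |exact: (Nabla_std_sub fA e_cpoi D_fg D_inj D_cog)].
Qed.

Lemma std_quot_fg b i M : std_quot b i M -> finitely_generated M.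
Proof. by move=> [q [qs _ _]]; apply: fg_quot_proj qs. Qed.

Lemma std_sub_fg b i M : std_sub b i M -> finitely_generated M.
Proof. by move=> [S [I [s [j [_ [_ Ifg _ _] ji _ _]]]]]; apply: fg_sub nA Ifg ji. Qed.

Lemma standard_exists b i : exists X, standard b i X.
Proof.
have [M sM] : exists M, standard b i M.
  by case: b; [apply: proper_Delta_exists|apply: Delta_exists].
by exists (FgMod (std_quot_fg (standard_std_quot sM))).
Qed.

Lemma costandard_exists b i : exists X, costandard b i X.
Proof.
have [M sM] : exists M, costandard b i M.
  case: b; last exact: (Nabla_exists fA e_cpoi D_fg D_inj D_cog).
  exact: (proper_Nabla_exists fA e_cpoi e_basic D_fg D_inj D_cog).
by exists (FgMod (std_sub_fg (costandard_std_sub sM))).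
Qed.

Lemma E_part i : exists w : E i, e i *: w <> 0.
Proof. exact/(simple_topP fA e_cpoi i (proj1 (simple_top_E i)))/simple_top_E. Qed.

Lemma E_span i (x y : E i) : x <> 0 -> exists a, a *: x = y.
Proof.
have [_ Es] := proj1 (simple_top_E i).
move=> xn0; have [h|h] := Es _ (submodule_cyclic x); last exact: eq_setT h.
by case: xn0; apply: (eq_set0 h); exists 1; rewrite scale1r.
Qed.

Lemma nonzero_map M N : ~ hom0 M N -> exists (f : {linear M -> N}) x, f x <> 0.
Proof.
move=> h; apply: contrapT => hf; apply: h => f x; apply: contrapT => fx.
by apply: hf; exists f, x.
Qed.

Lemma length0 X : flen 0 X -> @ext C 0 X X.
Proof. by move=> X0; apply/ext0_zero. Qed.

Lemma socle_nonzero Y : ~ @ext C 0 Y Y -> exists i, ~ @ext C 0 (E i) Y.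
Proof.
move=> Yn0; have [m fY] := fg_has_flen fA (fgmod_fg Y).
have [|S [j [Ss ji]]] := simple_sub fY; first by move=> /ext0_zero.
have [i Si] := simple_has_top fA e_cpoi Ss; exists i => h.
have [f [fi fs]] := simple_top_iso (simple_top_E i) Si.
have [w wn0] := E_part i; apply: wn0; apply: fi; apply: ji.
by rewrite -[LHS]/((j \o f) _) h !linear0.
Qed.

Lemma top_nonzero Y : ~ @ext C 0 Y Y -> exists i, ~ @ext C 0 Y (E i).
Proof.
move=> Yn0; have [m fY] := fg_has_flen fA (fgmod_fg Y).
have [|S [p [Ss ps]]] := simple_factor fY; first by move=> /ext0_zero.
have [i Si] := simple_has_top fA e_cpoi Ss; exists i => h.
have [f [fi fs]] := simple_top_iso Si (simple_top_E i).
have [w wn0] := E_part i; apply: wn0.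
have [s <-] := fs (e i *: w); have [y <-] := ps s.
exact: (h (f \o p)).
Qed.

Lemma std_quot_E b j X : std_quot b j X -> exists2 K : C, ses K X (E j) &
  Fil (fun Z => exists2 l : 'I_n, below b l j & Z = E l) K.
Proof.
move=> sX.
have [K [k [t [kt kK _]]]] := std_quot_top fA e_cpoi e_basic sX (simple_top_E j).
have [ki _ _] := kt; exists (FgMod (fg_sub nA (fgmod_fg X) ki)); first by exists k, t.
by apply: Fil_E => l /negP; apply: kK.
Qed.

Lemma std_sub_E b j X : std_sub b j X -> exists2 Q : C, ses (E j) X Q &
  Fil (fun Z => exists2 l : 'I_n, below b l j & Z = E l) Q.
Proof.
move=> sX.
have [Q [t [p [tp kQ _]]]] := std_sub_soc fA e_cpoi e_basic sX (simple_top_E j).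
have [_ _ ps] := tp; exists (FgMod (fg_surj (fgmod_fg X) ps)); first by exists t, p.
by apply: Fil_E => l /negP; apply: kQ.
Qed.

(** The map E(i) -> Y extends to the costandard module, Ext^1 from the quotient by the socle being
    zero, and stays injective because the socle is essential. *)
Lemma std_sub_embed b i Y : ~ @ext C 0 (E i) Y ->
  (forall j, below b j i -> @ext C 1 (E j) Y) ->
  exists W (Y' : C), costandard b i W /\ ses W Y Y'.
Proof.
move=> /nonzero_map [f fn0] EY; have [W cW] := costandard_exists b i.
have sW := costandard_std_sub cW.
have [Q [t [p [tp kQ ess]]]] := std_sub_soc fA e_cpoi e_basic sW (simple_top_E i).
have [ti _ ps] := tp; pose Q' : C := FgMod (fg_surj (fgmod_fg W) ps).
have QY : @ext C 1 Q' Y.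
  apply: (@Fil_extl C (fun Z => exists2 l : 'I_n, below b l i & Z = E l)).
    by move=> _ [l li ->]; apply: EY.
  by apply: Fil_E => l /negP; apply: kQ.
have [g gE] := @extP1_extends _ D nA D_fg D_inj D_cog Q' Y _ _ t p QY tp f.
have fi := simple_inj (proj1 (simple_top_E i)) fn0.
have gi : injective g.
  apply: essential_inj ess _ => x; rewrite gE => fx.
  by rewrite (fi x 0) ?linear0 // fx linear0.
have [Y' [q gq]] := coker_ses gi; have [_ _ qs] := gq.
by exists W, (FgMod (fg_surj (fgmod_fg Y) qs)); split=> //; exists g, q.
Qed.

(** Dually, the map Y -> E(i) lifts to the standard module and is onto because that module is
    local. *)
Lemma std_quot_cover b i Y : ~ @ext C 0 Y (E i) ->
  (forall j, below b j i -> @ext C 1 Y (E j)) ->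
  exists W (Y' : C), standard b i W /\ ses Y' Y W.
Proof.
move=> /nonzero_map [f [y fy]] EY; have [W cW] := standard_exists b i.
have sW := standard_std_quot cW.
have [K [k [t [kt kK loc]]]] := std_quot_top fA e_cpoi e_basic sW (simple_top_E i).
have [ki _ ts] := kt; pose K' : C := FgMod (fg_sub nA (fgmod_fg W) ki).
have YK : @ext C 1 Y K'.
  apply: (@Fil_extr C (fun Z => exists2 l : 'I_n, below b l i & Z = E l)).
    by move=> _ [l li ->]; apply: EY.
  by apply: Fil_E => l /negP; apply: kK.
have [g gE] := @extP1_lifts _ nA Y K' _ _ k t YK kt f.
have gs : surjective g.
  apply: (loc _ (submodule_im g)); exists (g y); first by exists y.
  by rewrite gE.
have [Y' [q gq]] := ker_ses gs; have [qi _ _] := gq.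
by exists W, (FgMod (fg_sub nA (fgmod_fg Y) qi)); split=> //; exists q, g.
Qed.

Lemma std_sub_socle b i j W : std_sub b i W -> j <> i -> @ext C 0 (E j) W.
Proof.
move=> sW ji f y; apply: contrapT => fy.
have [Q [t [p [tp kQ ess]]]] := std_sub_soc fA e_cpoi e_basic sW (simple_top_E i).
have [|x [tx [z zE]]] := ess _ (submodule_im f).
  by exists (f y) => //; exists y.
have [w wn0] := E_part i.
have [c cE] : exists c, c *: x = w.
  by apply: E_span => x0; apply: tx; rewrite x0 linear0.
apply: wn0; have [ti _ _] := tp; apply: ti; rewrite linear0 -cE !linZ -zE -!linZ.
have kE : killed i (E j) by apply: (simple_top_killed fA e_cpoi e_basic (simple_top_E j)); apply/nesym.
by rewrite kE linear0.
Qed.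

Lemma std_quot_E_hom b i j W : std_quot b i W -> j <> i -> @ext C 0 W (E j).
Proof.
move=> sW ji; apply: (hom0_std_quot e_cpoi sW).
by apply: (simple_top_killed fA e_cpoi e_basic (simple_top_E j)); apply/nesym.
Qed.

Lemma std_sub_nonzero b i W : std_sub b i W -> ~ @ext C 0 W W.
Proof.
move=> sW /ext0_zero W0.
have [Q [t [p [[ti _ _] _ _]]]] := std_sub_soc fA e_cpoi e_basic sW (simple_top_E i).
have [w wn0] := E_part i; apply: wn0; apply: ti.
by rewrite (W0 (t 0)) (W0 (t _)).
Qed.

Lemma std_quot_nz b i W : std_quot b i W -> ~ @ext C 0 W W.
Proof.
move=> sW /ext0_zero W0; have [x xn0] := std_quot_nonzero fA e_cpoi e_basic sW.
by apply: xn0; rewrite (W0 x) scaler0.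
Qed.

Section Vanishing.
Variable b : bool.
Hypothesis vanish : forall i j k X Y, std_quot b i X -> std_sub (~~ b) j Y ->
  @ext C k.+1 X Y.

(** Exactly one of the relations [below b] and [below (~~ b)] is strict, so their composite is
    strict, as [perp_filtered] requires. The bound [t] on the indices serves the induction in
    [Nabla_id_le]. *)
Lemma perp_costandard (t : nat) Y : (forall i X, standard b i X -> @ext C 1 X Y) ->
  (forall j, (j < t)%N -> @ext C 0 (E j) Y) ->
  @Fil C (fun X => exists2 l : 'I_n, (t <= l)%N & costandard (~~ b) l X) Y.
Proof.
move=> TY EY; have [m fY] := fg_has_flen fA (fgmod_fg Y).
apply: (@perp_filtered C n (fun i => E i) (fun i X => standard b i X)
  (fun i X => costandard (~~ b) i X) (below b) (below (~~ b)) (fun m X => flen m X)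
  _ _ _ _ _ _ _ _ _ _ _ _ Y m t fY) => //.
- exact: length0.
- by move=> X' X X'' k s Xn; apply: flen_quot_strict s _ => /ext0_zero.
- exact: socle_nonzero.
- exact: standard_exists.
- by move=> j X /standard_std_quot; apply: std_quot_E.
- exact: std_sub_embed.
- by move=> i j W /costandard_std_sub; apply: std_sub_socle.
- by move=> i W /costandard_std_sub; apply: std_sub_nonzero.
- by move=> i j X W /standard_std_quot sX /costandard_std_sub sW; apply: (vanish (k := 0%N) sX sW).
- by move=> i j X W /standard_std_quot sX /costandard_std_sub sW; apply: (vanish (k := 1%N) sX sW).
- by move=> l j i; rewrite /below; case: (b) => /=; lia.
- by move=> l j i; rewrite /below; case: (b) => /=; lia.
Qed.

Lemma perp_standard Y : (forall i X, costandard (~~ b) i X -> @ext C 1 Y X) ->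
  @Fil C (fun X => exists l, standard b l X) Y.
Proof.
move=> TY; have [m fY] := fg_has_flen fA (fgmod_fg Y).
suff: @Fil (op C) (fun X => exists2 l : 'I_n, (0 <= l)%N & standard b l X) Y.
  by move/(Fil_op (C := C)); apply: Fil_mono => Z [l _ sZ]; exists l.
apply: (@perp_filtered (op C) n (fun i => E i) (fun i X => costandard (~~ b) i X)
  (fun i X => standard b i X) (below (~~ b)) (below b) (fun m X => flen m X)
  _ _ _ _ _ _ _ _ _ _ _ _ Y m 0%N fY) => //.
- exact: length0.
- by move=> X' X X'' k s Xn fX; apply: flen_sub_strict s _ fX => z; apply: Xn; apply/ext0_zero.
- exact: top_nonzero.
- exact: costandard_exists.
- move=> j X /costandard_std_sub /std_sub_E [Q s F]; exists Q => //.
  exact/(Fil_op (C := C)).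
- exact: std_quot_cover.
- by move=> i j W /standard_std_quot; apply: std_quot_E_hom.
- by move=> i W /standard_std_quot; apply: std_quot_nz.
- by move=> i j X W /costandard_std_sub sX /standard_std_quot sW; apply: (vanish (k := 0%N) sW sX).
- by move=> i j X W /costandard_std_sub sX /standard_std_quot sW; apply: (vanish (k := 1%N) sW sX).
- by move=> l j i; rewrite /below; case: (b) => /=; lia.
- by move=> l j i; rewrite /below; case: (b) => /=; lia.
Qed.

End Vanishing.

(** Descending induction on the index. The cokernel of Nabla(j) in its injective envelope is
    orthogonal to the proper standard modules and admits no nonzero map from E(l) with l <= j;
    taking t = j + 1, it is filtered by the Nabla(l) with l > j. *)
Lemma Nabla_id_le : (forall i j k X Y, std_quot true i X -> std_sub false j Y ->
  @ext C k.+1 X Y) -> forall j Y, std_sub false j Y -> @pd_le (op C) Y n.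
Proof.
move=> vanish j0 Y0.
suff h m k j Y X : std_sub false j Y -> (n - j <= m)%N -> (m <= k)%N -> @ext C k.+1 X Y.
  by move=> sY X; apply: (h (n - j0)%N n _ _ _ sY) => //; apply: leq_subr.
elim: m k j Y => [|m IH] k j Y sY; first by rewrite leqn0 subn_eq0 leqNgt ltn_ord.
move=> jm; case: k => // k mk.
have [I [Q [s iI EQ]]] := @std_sub_copresentation A n e fA e_cpoi e_basic D D_fg D_inj D_cog false j Y sY.
apply: (ext_subr s) (iI _ _).
apply: (@Fil_extr C (fun Z => exists2 l : 'I_n, (j.+1 <= l)%N & costandard false l Z)).
  move=> Z [l jl /costandard_std_sub sZ]; apply: (IH _ _ _ sZ _ mk).
  by rewrite leq_subLR in jm; lia.
apply: (@perp_costandard true) => [//|i X' /standard_std_quot sX'|l lj].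
  exact: (ext_quotr s (iI _ _) (vanish _ _ _ _ _ sX' sY)).
by apply: EQ; rewrite /below /= -ltnS.
Qed.

End Perpendicular.

(** * Least values, suprema and padding of resolutions *)

Section ExtendedNaturals.
Implicit Types P Q : nat -> Prop.

Lemma enat_min_eq P Q : (forall d, P d <-> Q d) -> enat_min P = enat_min Q.
Proof. by move=> PQ; congr enat_min; apply/funext => d; apply/propext. Qed.

Lemma enat_min_ex P : enat_min P <> None -> exists d, P d.
Proof. by rewrite /enat_min; case: pselect. Qed.

Lemma enat_min_le P d : (forall k, (k <= d)%N -> P k -> P d) ->
  enat_le (enat_min P) d <-> P d.
Proof.
rewrite /enat_min => mono; case: pselect => [h|h] /=; last first.
  by split=> // Pd; case: h; exists d.
case: ex_minnP => k /asboolP Pk kmin; split=> [kd|Pd]; first exact: mono kd Pk.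
by apply: kmin; apply/asboolP.
Qed.

End ExtendedNaturals.

Section Monotonicity.
Context {B : nzRingType}.
Implicit Types (P : lmodType B -> Prop) (X : lmodType B).

(** The sequence is unchanged: the degrees from k + 1 to [d] already hold zero modules. *)
Lemma coresolution_le P X k d : (forall M, zero_module M -> P M) -> (k <= d)%N ->
  coresolution P X k -> coresolution P X d.
Proof.
move=> P0 kd [M [eps [f [ie ee ef PM M0]]]]; exists M, eps, f; split=> // j jd.
  by have [/PM //|/M0 /P0] := leqP j k.
exact/M0/(leq_ltn_trans kd).
Qed.

Lemma resolution_le P X k d : (forall M, zero_module M -> P M) -> (k <= d)%N ->
  resolution P X k -> resolution P X d.
Proof.
move=> P0 kd [M [eps [f [ie ee ef PM M0]]]]; exists M, eps, f; split=> // j jd.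
  by have [/PM //|/M0 /P0] := leqP j k.
exact/M0/(leq_ltn_trans kd).
Qed.

Lemma coresolution_supE P : (forall M, zero_module M -> P M) ->
  enat_sup (@finitely_generated B) (coresolution_dim P) =
  enat_min (fun d => forall X : fgmod B, coresolution P X d).
Proof.
move=> P0; apply: enat_min_eq => d; split=> h.
  move=> [X Xfg]; apply/enat_min_le; last exact: h.
  by move=> k; apply: coresolution_le.
move=> X Xfg; apply/enat_min_le; last exact: (h (FgMod Xfg)).
by move=> k; apply: coresolution_le.
Qed.

Lemma resolution_supE P : (forall M, zero_module M -> P M) ->
  enat_sup (@finitely_generated B) (resolution_dim P) =
  enat_min (fun d => forall X : fgmod B, resolution P X d).
Proof.
move=> P0; apply: enat_min_eq => d; split=> h.
  move=> [X Xfg]; apply/enat_min_le; last exact: h.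
  by move=> k; apply: resolution_le.
move=> X Xfg; apply/enat_min_le; last exact: (h (FgMod Xfg)).
by move=> k; apply: resolution_le.
Qed.

Lemma filtered_flen (Q : lmodType B -> Prop) X :
  (forall N, Q N -> exists m, flen m N) -> filtered Q X -> exists m, flen m X.
Proof.
move=> Qf [s [fs]]; elim: fs => [Y Y0 _|L Y N t f g fi ex gs _ IH /= [QN Qt]].
  by exists 0%N.
have [a fL] := IH Qt; have [b fN] := Qf _ QN.
by exists (b + a)%N; apply: flen_ext fL fN; exists f, g.
Qed.

Lemma resolution_target_fg P X d : (forall M, P M -> finitely_generated M) ->
  resolution P X d -> finitely_generated X.
Proof.
move=> Pfg [M [eps [f [es _ _ PM _]]]].
exact: fg_surj (Pfg _ (PM 0%N (leq0n _))) es.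
Qed.

End Monotonicity.

(** * Approximations by add(T) and add(S) *)

Section Approximations.
Context {R : comNzRingType} {A : algType R} (J : lmodType R).
Local Notation D := (dual_module A J).
Hypotheses (artA : artin_algebra A) (nA : @noetherian_ring A)
  (D_fg : finitely_generated D) (D_inj : injective_module D)
  (D_cog : forall X : fgmod A, exists m (i : {linear X -> {ffun 'I_m -> D}}),
     injective i).
Local Notation C := (mod_extcat nA D_fg D_inj D_cog).
Local Notation balance := (ext_balance nA D_fg D_inj D_cog).

Lemma central_scale_linear (X Y : lmodType A) (r : R) (f : {linear X -> Y}) :
  exists g : {linear X -> Y}, forall x, g x = r%:A *: f x.
Proof.
apply: linear_exists => a x y; rewrite linearP scalerDr !scalerA.
by congr (_ *: _ + _); rewrite -scalerAl mul1r -scalerAr mulr1.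
Qed.

Lemma regular_generates (Y : C) : exists (Y' F : C), ses Y' F Y /\
  forall (Z : C) k, ext k Z (FgMod (@fg_regular A) : C) -> ext k Z F.
Proof.
have [m [p ps]] := free_cover (fgmod_fg Y); have [K [i s]] := ker_ses ps.
have [ii _ _] := s; have Kfg := fg_sub nA (@fg_free A m) ii.
exists (FgMod Kfg), (FgMod (@fg_free A m)); split; first by exists i, p.
by move=> Z k; apply: extP_pow.
Qed.

Lemma dual_cogenerates_ext (Y : C) : exists (Y' F : C), ses Y F Y' /\
  forall (Z : C) k, ext k (FgMod D_fg : C) Z -> ext k F Z.
Proof.
have [m [i ii]] := D_cog Y; have [Q [p s]] := coker_ses ii; have [_ _ ps] := s.
have Ifg := fg_pow m D_fg.
exists (FgMod (fg_surj Ifg ps)), (FgMod Ifg); split; first by exists i, p.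
by move=> Z k /balance h; apply/balance/extI_pow.
Qed.

(* As Hom(T, Y) is a finitely generated R-module, finitely many maps T -> Y
   give a right add(T)-approximation of Y. *)
Lemma right_approximation (T Y T0 K : C) : ext 1 T T -> add_closure T T0 ->
  ses (FgMod (@fg_regular A) : C) T0 K -> ext 1 K Y ->
  exists Y1 T1 : C, [/\ ses Y1 T1 Y, add_closure T T1 & ext 1 T Y1].
Proof.
move=> TT [m [f0 [g0 gf]]] [a [q aq]] KY.
have [p [g gP]] := Hom_fg artA (fgmod_fg T) (fgmod_fg Y).
have [G GE] := pow_in g.
have lif (h : {linear T -> Y}) : exists h' : {linear T -> {ffun 'I_p -> T}},
    forall t, G (h' t) = h t.
  have [c cE] := gP h.
  have [s sE] := choice (fun j => central_scale_linear (c j) (idfun : {linear T -> T})).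
  have [h' h'E] := pow_out s; exists h' => t; rewrite GE cE.
  by apply: eq_bigr => j _; rewrite h'E sE linZ.
(* Since Ext^1(K, Y) = 0, the map A -> Y with 1 -> y extends to T0, a summand of a power of [T]. So
   [y] is a sum of values of maps T -> Y, and these factor through [G]. *)
have Gs : surjective G.
  move=> y; have [y' y'E] : exists y' : {linear A^o -> Y}, forall x : A, y' x = x *: y.
    by apply: linear_exists => x u v; rewrite scalerDl scalerA.
  have [h hE] := extP1_extends D_fg D_inj D_cog KY aq y'.
  have -> : y = h (g0 (f0 (a 1))) by rewrite gf hE y'E scale1r.
  rewrite [f0 _]pow_sum !linear_sum.
  apply: (submodule_sum (U := [set y | exists x, G x = y])) => [|j]; first exact: submodule_im.
  have [i iE] := pow_inj T j; have [h' h'E] := lif (h \o g0 \o i).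
  by exists (h' (f0 (a 1) j)); rewrite h'E /= iE.
have [Y1 [k kG]] := ker_ses Gs; have [ki _ _] := kG.
have Tfg := fg_pow p (fgmod_fg T).
exists (FgMod (fg_sub nA Tfg ki)), (FgMod Tfg); split.
- by exists k, G.
- exact: add_closure_self.
apply: (lifts_extends_sub kG (pc_ses (pc nA T))); first exact: lif.
exact: (extP_pow p TT).
Qed.

(** Generators of Hom(X, S) over [R] give X -> S^p. It is injective: [X] embeds into a power of D,
    each coordinate X -> D lifts to S0 since Ext^1(X, K) = 0, and so an element killed by all maps
    to [S] is zero. *)
Lemma left_approximation (S X S0 K : C) : ext 1 S S -> add_closure S S0 ->
  ses K S0 (FgMod D_fg : C) -> ext 1 X K ->
  exists X1 S1 : C, [/\ ses X S1 X1, add_closure S S1 & ext 1 X1 S].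
Proof.
move=> SS [m [f0 [g0 gf]]] [a [q aq]] XK.
have [p [g gP]] := Hom_fg artA (fgmod_fg X) (fgmod_fg S).
have [G GE] := pow_out g.
have Gi : injective G.
  apply: linear_inj => x Gx; have [l [i ii]] := D_cog X.
  apply: ii; rewrite linear0; apply/ffunP => j; rewrite [RHS]ffunE.
  have [pj pjE] := pow_proj D j.
  have [h hE] := extP1_lifts XK aq (pj \o i).
  rewrite -pjE -[LHS]/((pj \o i) x) -hE -(gf (h x)).
  suff -> : f0 (h x) = 0 by rewrite !linear0.
  apply/ffunP => l'; have [pl plE] := pow_proj S l'.
  have [c cE] := gP (pl \o f0 \o h).
  rewrite -plE -[LHS]/((pl \o f0 \o h) x) cE [RHS]ffunE big1 // => j' _.
  by rewrite -GE Gx ffunE scaler0.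
have [X1 [k Gk]] := coker_ses Gi; have [_ _ ks] := Gk.
have Sfg := fg_pow p (fgmod_fg S).
exists (FgMod (fg_surj Sfg ks)), (FgMod Sfg); split.
- by exists G, k.
- exact: add_closure_self.
apply/balance; apply: (extends_lifts_quot Gk (ih_ses (ih D_fg D_inj D_cog S))).
  move=> h; have [c cE] := gP h.
  have [s sE] := choice (fun j => central_scale_linear (c j) (idfun : {linear S -> S})).
  have [h' h'E] := pow_in s; exists h' => x; rewrite h'E cE.
  by apply: eq_bigr => j _; rewrite sE GE.
by apply: (extI_pow (k := 1%N)); apply/balance.
Qed.

End Approximations.

(** * The two chains of equalities *)

Section ProperlyStratified.
Context {R : comNzRingType} {A : algType R} {n : nat} (e : 'I_n -> A) (J : lmodType R).
Local Notation D := (dual_module A J).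
Hypotheses (artA : artin_algebra A)
  (e_cpoi : complete_primitive_orthogonal_idempotents e) (e_basic : basic_algebra e)
  (fA : exists a, flen a (A^o : lmodType A)) (strat : properly_stratified e)
  (D_fg : finitely_generated D) (D_inj : injective_module D)
  (D_cog : forall X : fgmod A, exists m (i : {linear X -> {ffun 'I_m -> D}}),
     injective i).
Local Notation nA := (flen_noetherian fA).
Local Notation C := (mod_extcat nA D_fg D_inj D_cog).
Local Notation AA := (FgMod (@fg_regular A) : C).
Local Notation DA := (FgMod D_fg : C).

Lemma standard_fg b M : (exists i, standard e b i M) -> finitely_generated M.
Proof. by case=> i /(standard_std_quot fA e_cpoi); apply: std_quot_fg. Qed.

Lemma costandard_fg b M : (exists i, costandard e b i M) -> finitely_generated M.
Proof.
by case=> i /(costandard_std_sub fA e_cpoi D_fg D_inj D_cog); apply: (std_sub_fg fA).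
Qed.

Lemma regular_filtered b : @Fil C (fun Z => exists l, std_quot e b l Z) AA.
Proof.
have [FD FpD] := strat.
have : @Fil C (fun Z => exists l, standard e b l Z) AA.
  case: b; first exact: (filtered_Fil (X := AA) FpD).
  exact: (filtered_Fil (X := AA) FD).
apply: Fil_mono => Z [l sZ]; exists l; exact: (standard_std_quot fA e_cpoi sZ).
Qed.

Lemma strat_vanish b (i j : 'I_n) k (X Y : C) : std_quot e b i X ->
  std_sub e (~~ b) j Y -> ext k.+1 X Y.
Proof.
apply: (ext_vanish e_cpoi e_basic); exact: regular_filtered.
Qed.

Lemma proj_dimE (X : C) : proj_dim X = enat_min (@pd_le C X).
Proof. by apply: enat_min_eq => d; apply: resolution_pd_le. Qed.

Lemma inj_dimE (X : C) : inj_dim X = enat_min (@pd_le (op C) X).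
Proof. by apply: enat_min_eq => d; apply: coresolution_id_le. Qed.

Lemma tilting_equalities (T : lmodType A) : tilting T ->
  (forall X : lmodType A,
     add_closure T X <-> Filt (Delta e) X /\ Filt (proper_Nabla e) X) ->
  [/\ proper_Nabla_gfd_algebra e = proj_dim T,
      proj_dim T = coresolution_dim (add_closure T) A^o
    & coresolution_dim (add_closure T) A^o = proper_Nabla_gfd e A^o].
Proof.
move=> [Tfg Tpd Tself [s0 Tcores]] addT; pose TT : C := FgMod Tfg.
have Tiso := @add_closure_iso A T.
have addT_fg := @add_closure_fg A T.
have Niso : iso_closed (Filt (proper_Nabla e)) by apply: filtered_iso.
have Nfg M : Filt (proper_Nabla e) M -> finitely_generated M.
  by apply: filtered_fg => N; apply: (@costandard_fg true).
pose Om (X : C) := exists i, proper_Nabla e i X.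
pose Th (X : C) := exists i, Delta e i X.
have ThQ (X : C) i : Delta e i X -> std_quot e false i X by apply: Delta_std_quot.
have OmS (X : C) i : proper_Nabla e i X -> std_sub e true i X.
  exact: (proper_Nabla_std_sub fA e_cpoi D_fg D_inj D_cog).
have TTself k : @ext C k.+1 TT TT by apply: Ext_succ_vanishes_ext.
have TTpd : exists d, @pd_le C TT d.
  by have [d r] := enat_min_ex Tpd; exists d; apply/resolution_pd_le.
have tfae d := @tilting_dimension C AA TT (fun X => add_closure T (fgmod_sort X)) Om Th
  _ _ _ _ _ _ TTpd _ _ _ _ _ _ _ d.
have {tfae} tfae d : [/\ (forall X : C, cores (Fil Om) d X) <-> pd_le TT d,
      cores (fun X : C => add_closure T X) d AA <-> pd_le TT d
    & cores (Fil Om) d AA <-> pd_le TT d].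
  apply: tfae => //.
  - exact: regular_generates.
  - by move=> X aX k Y; apply: (add_closure_extl (T := TT) aX).
  - by move=> X aX k Y; apply: (add_closure_extr (T := TT) aX).
  - by move=> X /ext0_zero; apply: add_closure_zero.
  - by move=> X Y; apply: add_closure_retract.
  - by exists s0; apply/coresolution_cores => // M; apply: addT_fg.
  - move=> Y T0 K _ aT0 s KY.
    exact: (right_approximation artA (TTself 0%N) aT0 s KY).
  - have /addT [FT _] := add_closure_refl T.
    exact: (filtered_Fil (X := TT) FT).
  - by move=> X /addT [_ FX]; exact: (filtered_Fil (X := X) FX).
  - by move=> X Y k [i /ThQ sX] [j /OmS sY]; apply: (@strat_vanish false i j k X Y sX sY).
  - exists n => X [i /ThQ]; exact: (Delta_pd_le e_cpoi e_basic (regular_filtered false)).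
  - move=> Y TY; have := @perp_costandard A n e fA e_cpoi e_basic D D_fg D_inj D_cog
      false (@strat_vanish false) 0%N Y.
    move=> h; apply: Fil_mono (h _ _) => [Z [l _ cZ]|i X dX|//]; first by exists l.
    by apply: TY; exists i.
have corN d (X : C) : coresolution (Filt (proper_Nabla e)) X d <-> cores (Fil Om) d X.
  have h : coresolution (Filt (proper_Nabla e)) X d <->
      @cores C (fun M => Filt (proper_Nabla e) M) d X by apply: coresolution_cores.
  split=> [/h|c]; [|apply/h; move: c]; apply: cores_mono => Z h'.
    exact: (filtered_Fil (X := Z) h').
  exact: (Fil_filtered (Q := fun M => exists i, proper_Nabla e i M) h').
have corT d : coresolution (add_closure T) A^o d <->
    cores (fun X : C => add_closure T X) d AA.
  by apply: (coresolution_cores AA) => // M; apply: addT_fg.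
have pdT : proj_dim T = enat_min (@pd_le C TT) := proj_dimE TT.
split.
- rewrite /proper_Nabla_gfd_algebra /proper_Nabla_gfd coresolution_supE; last first.
    by move=> M; apply: filtered_zero.
  rewrite pdT; apply: enat_min_eq => d; have [h _ _] := tfae d.
  by split=> [h'|/h h' X]; [apply/h => X; apply/corN|apply/corN].
- rewrite pdT; apply: enat_min_eq => d; have [_ h _] := tfae d.
  by split=> [/h /corT|/corT /h].
- apply: enat_min_eq => d; have [_ h h'] := tfae d.
  by split=> [/corT /h /h' /(corN d AA)|/(corN d AA) /h' /h /corT].
Qed.

Lemma cotilting_equalities (S : lmodType A) : cotilting D S ->
  (forall X : lmodType A,
     add_closure S X <-> Filt (Nabla e) X /\ Filt (proper_Delta e) X) ->
  [/\ proper_Delta_gfd_algebra e = inj_dim S,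
      inj_dim S = resolution_dim (add_closure S) D
    & resolution_dim (add_closure S) D = proper_Delta_gfd e D].
Proof.
move=> [Sfg Sid Sself [s0 Sres]] addS; pose SS : C := FgMod Sfg.
have Siso := @add_closure_iso A S.
have addS_fg := @add_closure_fg A S.
have Niso : iso_closed (Filt (proper_Delta e)) by apply: filtered_iso.
have Nfg M : Filt (proper_Delta e) M -> finitely_generated M.
  by apply: filtered_fg => N; apply: (@standard_fg true).
pose Om (X : C) := exists i, proper_Delta e i X.
pose Th (X : C) := exists i, Nabla e i X.
have OmQ (X : C) i : proper_Delta e i X -> std_quot e true i X.
  by apply: proper_Delta_std_quot.
have ThS (X : C) i : Nabla e i X -> std_sub e false i X.
  exact: (Nabla_std_sub fA e_cpoi D_fg D_inj D_cog).
have SSself k : @ext C k.+1 SS SS by apply: Ext_succ_vanishes_ext.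
have SSid : exists d, @pd_le (op C) SS d.
  by have [d r] := enat_min_ex Sid; exists d; apply/coresolution_id_le.
have resS d : resolution (add_closure S) D d <->
    @cores (op C) (fun X => add_closure S (fgmod_sort X)) d DA.
  by apply: (resolution_cores DA) => // M; apply: addS_fg.
have tfae d := @tilting_dimension (op C) DA SS (fun X => add_closure S (fgmod_sort X)) Om Th
  _ _ _ _ _ _ SSid _ _ _ _ _ _ _ d.
have {tfae} tfae d : [/\ (forall X : C, @cores (op C) (@Fil (op C) Om) d X) <-> @pd_le (op C) SS d,
      @cores (op C) (fun X => add_closure S (fgmod_sort X)) d DA <-> @pd_le (op C) SS d
    & @cores (op C) (@Fil (op C) Om) d DA <-> @pd_le (op C) SS d].
  apply: tfae => //.
  - exact: dual_cogenerates_ext.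
  - by move=> X aX k Y; apply: (add_closure_extr (T := SS) aX).
  - by move=> X aX k Y; apply: (add_closure_extl (T := SS) aX).
  - by move=> X h; apply: add_closure_zero; exact/(ext0_zero (X : C)).
  - by move=> X Y; apply: add_closure_retract.
  - by exists s0; apply/resS.
  - move=> Y S0 K _ aS0 s KY.
    exact: (left_approximation artA (SSself 0%N) aS0 s KY).
  - have /addS [FS _] := add_closure_refl S.
    by apply/(Fil_op (C := C)); exact: (filtered_Fil (X := SS) FS).
  - move=> X /addS [_ FX].
    by apply/(Fil_op (C := C)); exact: (filtered_Fil (X := X) FX).
  - by move=> X Y k [i /ThS sX] [j /OmQ sY]; apply: (@strat_vanish true j i k Y X sY sX).
  - exists n => X [i /ThS sX]; apply: (@Nabla_id_le A n e fA e_cpoi e_basic D D_fg D_inj D_cog _ i X sX).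
    by move=> j l k Y Z; apply: (@strat_vanish true).
  - move=> Y TY; apply/(Fil_op (C := C)).
    apply: (@perp_standard A n e fA e_cpoi e_basic D D_fg D_inj D_cog
      true (@strat_vanish true) Y) => i X dX.
    by apply: TY; exists i.
have resN d (X : C) : resolution (Filt (proper_Delta e)) X d <->
    @cores (op C) (@Fil (op C) Om) d X.
  have h : resolution (Filt (proper_Delta e)) X d <->
      @cores (op C) (fun M => Filt (proper_Delta e) (fgmod_sort M)) d X.
    exact: resolution_cores.
  split=> [/h|c]; [|apply/h; move: c]; apply: cores_mono => Z h'.
    by apply/(Fil_op (C := C)); exact: (filtered_Fil (X := Z) h').
  move/(Fil_op (C := C)): h' => h'.
  exact: (Fil_filtered (Q := fun M => exists i, proper_Delta e i M) h').
have idS : inj_dim S = enat_min (@pd_le (op C) SS) := inj_dimE SS.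
split.
- rewrite /proper_Delta_gfd_algebra /proper_Delta_gfd resolution_supE; last first.
    by move=> M; apply: filtered_zero.
  rewrite idS; apply: enat_min_eq => d; have [h _ _] := tfae d.
  by split=> [h'|/h h' X]; [apply/h => X; apply/resN|apply/resN].
- rewrite idS; apply: enat_min_eq => d; have [_ h _] := tfae d.
  by split=> [/h /resS|/resS /h].
- apply: enat_min_eq => d; have [_ h h'] := tfae d.
  by split=> [/resS /h /h' /(resN d DA)|/(resN d DA) /h' /h /resS].
Qed.

End ProperlyStratified.

Theorem corollary2p8 (R : comNzRingType) (A : algType R) (n : nat)
    (e : 'I_n -> A) (J : lmodType R) (T S : lmodType A) :
  artin_algebra A ->
  complete_primitive_orthogonal_idempotents e ->
  basic_algebra e ->
  dualizing_module J ->
  properly_stratified e ->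
  basic_module T -> tilting T ->
  (forall X : lmodType A,
     add_closure T X <-> Filt (Delta e) X /\ Filt (proper_Nabla e) X) ->
  basic_module S -> cotilting (dual_module A J) S ->
  (forall X : lmodType A,
     add_closure S X <-> Filt (Nabla e) X /\ Filt (proper_Delta e) X) ->
  [/\ proper_Nabla_gfd_algebra e = proj_dim T,
      proj_dim T = coresolution_dim (add_closure T) A^o
    & coresolution_dim (add_closure T) A^o = proper_Nabla_gfd e A^o] /\
  [/\ proper_Delta_gfd_algebra e = inj_dim S,
      inj_dim S = resolution_dim (add_closure S) (dual_module A J)
    & resolution_dim (add_closure S) (dual_module A J) = proper_Delta_gfd e (dual_module A J)].
Proof.
move=> artA cpoi basic dJ strat _ tiltT addT _ cotS addS.
(* Multiplicity one in the definition of a proper standard module provides a composition series; the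
   filtration of [A] adds up their lengths. *)
have fA : exists a, flen a (A^o : lmodType A).
  have [_ F] := strat; apply: filtered_flen F => N [i [Y [_ [[s cs _] _]]]].
  by exists (size s); apply: composition_series_flen cs.
(* The resolution contained in the cotilting hypothesis exhibits D(A) as a factor of a module in
   add(S). *)
have D_fg : finitely_generated (dual_module A J).
  have [Sfg _ _ [s r]] := cotS; apply: resolution_target_fg r => M.
  exact: add_closure_fg.
have D_inj : injective_module (dual_module A J).
  by have [K [_ [Ji _]]] := dJ; apply: dual_injective.
have D_cog (X : fgmod A) :
    exists m (i : {linear X -> {ffun 'I_m -> dual_module A J}}), injective i.
  have [m fX] := flen_fg fA (fgmod_fg X); have [aR _] := artA.
  exact: dual_embedding aR dJ fX.
split; first exact: (tilting_equalities artA cpoi basic fA strat D_fg D_inj D_cog tiltT addT).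
exact: (cotilting_equalities artA cpoi basic fA strat D_fg D_inj D_cog cotS addS).
Qed.
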